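(* Fix $a>a^*$ and let $V\in C^1(\mathbb{R}^2)$ satisfy $V\ge0$, $\lim_{|x|\to\infty}V(x)=\infty$ and $\inf_{x\in\mathbb{R}^2}V(x)=0$. Assume in addition that there are $n\ge1$ distinct points $x_1,\dots,x_n\in\mathbb{R}^2$ with $V(x_i)=0$ for all $i$ and $V(x)>0$ for all $x\notin\{x_1,\dots,x_n\}$, and numbers $p_i>0$ such that for each $i=1,\dots,n$, $V(x)=O(|x-x_i|^{p_i})$ near $x_i$ and $\lim_{x\to x_i}\frac{V(x)}{|x-x_i|^{p_i}}$ exists. Let $p=\max\{p_1,\dots,p_n\}$, let $$\lambda_i=\lim_{x\to x_i}\frac{V(x)}{|x-x_i|^{p}}\in(0,\infty],\qquad \lambda=\min\{\lambda_1,\dots,\lambda_n\},\qquad \mathcal{Z}:=\{x_i:\lambda_i=\lambda\}.$$ For each $q\in(0,2)$ let $u_q\in\mathcal{H}$ be a non-negative minimizer of $d_a(q)$. Let $\{q_k\}\subset(0,2)$ with $q_k\nearrow2$, points $\bar z_k\in\mathbb{R}^2$ and $y_0\in\mathbb{R}^2$ with $V(y_0)=0$ be such that $\{u_{q_k}\}$ concentrates at $y_0$ in the following sense: for each large $k$, $\bar z_k$ is the unique global maximum point of $u_{q_k}$, $\bar z_k\to y_0$ as $k\to\infty$, and $$\lim_{k\to\infty}\Big(\frac{a}{a^*_{q_k}}\Big)^{-\frac{1}{2-q_k}}u_{q_k}\Big(\big(\tfrac{a}{a^*_{q_k}}\big)^{-\frac{1}{2-q_k}}x+\bar z_k\Big)=\frac{1}{\sqrt{e}\,\|Q\|_2}\,Q\Big(\frac{|x|}{\sqrt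 e}\Big)\quad\text{in } H^1(\mathbb{R}^2).$$ Then $$y_0\in\mathcal{Z}\qquad\text{and}\qquad \lim_{k\to\infty}|\bar z_k-y_0|\Big(\frac{a}{a^*_{q_k}}\Big)^{\frac{1}{2-q_k}}=0 .$$
   Context: All functions are real-valued; $\|\cdot\|_2$ is the $L^2(\mathbb{R}^2)$ norm. $Q=Q(|x|)$ is the unique (up to translations) positive solution in $H^1(\mathbb{R}^2)$ of $\Delta u-u+u^3=0$ in $\mathbb{R}^2$, taken radially symmetric about the origin, and $a^*:=\|Q\|_2^2$. For $q\in(0,2]$, $\phi_q=\phi_q(|x|)$ is the unique (up to translations) positive solution in $H^1(\mathbb{R}^2)$ of $\Delta u-\frac2q u+\frac2q u^{q+1}=0$ in $\mathbb{R}^2$, taken radially symmetric about the origin, and $a_q^*:=\|\phi_q\|_2^q$. Let $\mathcal{H}:=\{u\in H^1(\mathbb{R}^2):\int_{\mathbb{R}^2}V(x)|u(x)|^2dx<\infty\}$ and $$E_q(u):=\int_{\mathbb{R}^2}\big(|\nabla u|^2+V(x)|u|^2\big)dx-\frac{2a}{q+2}\int_{\mathbb{R}^2}|u|^{q+2}dx .$$ The minimization problem is $d_a(q):=\inf\{E_q(u):u\in\mathcal{H},\ \int_{\mathbb{R}^2}u^2dx=1\}$; a minimizer of $d_a(q)$ is a $u\in\mathcal{H}$ with $\int_{\mathbb{R}^2} u^2dx=1$ and $E_q(u)=d_a(q)$. *)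

(* Defs.v *)
From HB Require Import structures.
From mathcomp Require Import all_boot all_order all_algebra.
From mathcomp Require Import all_classical all_reals all_analysis.

Set Implicit Arguments.
Unset Strict Implicit.
Unset Printing Implicit Defensive.

Import Order.TTheory GRing.Theory Num.Theory.
Import numFieldNormedType.Exports.

Local Open Scope classical_set_scope.
Local Open Scope ring_scope.

Section Plane.
Context {R : realType}.
Implicit Types (u v g V : R * R -> R) (x z : R * R) (a q : R).

(* Euclidean norm; the library norm `|x| on R * R is the sup norm. *)
Definition enorm x : R := Num.sqrt (x.1 ^+ 2 + x.2 ^+ 2).

Definition leb2 :
  {measure set (measurableTypeR R * measurableTypeR R) -> \bar R} :=
  (@lebesgue_measure R \x @lebesgue_measure R)%E.

Definition basis_vec (i : bool) : R * R := if i then (0, 1) else (1, 0).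

Definition partial (i : bool) u : R * R -> R := 'D_(basis_vec i) u.

Fixpoint Cn (k : nat) u : Prop :=
  if k is k'.+1 then
    continuous u /\ forall i, (forall x, derivable u x (basis_vec i)) /\
                              Cn k' (partial i u)
  else continuous u.

Definition laplacian u x : R := \sum_(i : bool) partial i (partial i u) x.

Definition test_function u : Prop :=
  (forall k, Cn k u) /\ compact (closure [set x | u x != 0]).

Definition L2norm u : R := fine ('N[leb2]_2%:E[EFin \o u])%E.

Definition weak_partial (i : bool) u g : Prop :=
  forall t, test_function t ->
    \int[leb2]_x (u x * partial i t x) = - \int[leb2]_x (g x * t x).

(* Elements of H^1 are represented by functions, not by classes modulo
   equality almost everywhere. *)
Definition H1 : set (R * R -> R) :=
  [set u | u \in Lfun leb2 2%:E /\
     forall i, exists2 g, g \in Lfun leb2 2%:E & weak_partial i u g].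

(* A chosen square-integrable weak partial derivative (unique up to a null
   set); the default value 0 is only taken when there is none. *)
Definition wpartial (i : bool) u : R * R -> R :=
  xget (cst 0) [set g | g \in Lfun leb2 2%:E /\ weak_partial i u g].

Definition grad_sq u x : R := \sum_(i : bool) wpartial i u x ^+ 2.

Definition H1norm u : R :=
  Num.sqrt (L2norm u ^+ 2 + \int[leb2]_x grad_sq u x).

Definition cvg_in_H1 (w : nat -> R * R -> R) (l : R * R -> R) : Prop :=
  [/\ forall k, H1 (w k), H1 l & H1norm (w k \- l) @[k --> \oo] --> (0 : R)].

Definition positive_H1_solution (f : R -> R) u : Prop :=
  [/\ Cn 2 u, forall x, 0 < u x, H1 u &
      forall x, laplacian u x + f (u x) = 0].

Definition radial u : Prop := forall x z, enorm x = enorm z -> u x = u z.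

(* u is "the" positive H^1 solution of (Laplacian u) + f(u) = 0, normalised to
   be radial about the origin; the last clause is uniqueness up to
   translations. *)
Definition ground_state (f : R -> R) u : Prop :=
  [/\ positive_H1_solution f u, radial u &
      forall v, positive_H1_solution f v ->
        exists z, forall x, v x = u (x - z)].

Definition nonlin_cubic (s : R) : R := - s + s ^+ 3.

Definition nonlin q (s : R) : R := - (2 / q * s) + 2 / q * s `^ (q + 1).

Definition Hspace V : set (R * R -> R) :=
  [set u | H1 u /\ (\int[leb2]_x (V x * u x ^+ 2)%:E < +oo)%E].

Definition energy V a q u : R :=
  \int[leb2]_x (grad_sq u x + V x * u x ^+ 2)
  - 2 * a / (q + 2) * \int[leb2]_x (`|u x| `^ (q + 2)).

Definition admissible V : set (R * R -> R) :=
  [set u | Hspace V u /\ \int[leb2]_x (u x ^+ 2) = 1].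

Definition min_energy V a q : \bar R :=
  ereal_inf [set (energy V a q u)%:E | u in admissible V].

Definition minimizer V a q u : Prop :=
  admissible V u /\ (energy V a q u)%:E = min_energy V a q.

Definition unique_global_max u z : Prop := forall x, x != z -> u x < u z.

Definition tends_to_infinity V : Prop :=
  forall A : R, exists r : R, forall x, r < enorm x -> A < V x.

(* The L^2-norm preserving blow-up of u at z. *)
Definition rescale (eps : R) u z x : R := eps * u (eps *: x + z).

(* Since Q is radial, Q(|x| / sqrt e) is Q at the point x / sqrt e. *)
Definition limit_profile (Q : R * R -> R) x : R :=
  (Num.sqrt (expR 1) * L2norm Q)^-1 * Q ((Num.sqrt (expR 1))^-1 *: x).

End Plane.

(* Main.v *)
Require Import Defs.
From HB Require Import structures.
From mathcomp Require Import all_boot all_order all_algebra.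
From mathcomp Require Import all_classical all_reals all_analysis.
From mathcomp Require Import measurable_realfun.
From mathcomp Require Import ring lra.

Set Implicit Arguments.
Unset Strict Implicit.
Unset Printing Implicit Defensive.

Import Order.TTheory GRing.Theory Num.Theory.
Import numFieldNormedType.Exports.

Local Open Scope classical_set_scope.
Local Open Scope ring_scope.

(** Write e for (a / astar q)^(-1/(2-q)), w for the blow-up of u at the
   point z, and w0 for the limit profile.

   In the variables y = (x - z) / e the energy becomes e^-2 times
     int |grad w|^2 + e^2 int V(e y + z) w^2 - c int |w|^(q+2),
   and the centre z may be chosen freely for each competitor
   (minimizer_rescaled). The theorem results from comparing centres. On the
   one hand, let w be cut off at a radius of order 1/e and recentred at a zero
   X_i of V with lambda_i = lambda; minimality gives
     e^-p int V(e y + z) w^2 <= lambda int |y|^p w0^2 + o(1)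
   (excess_upper). On the other hand y0 is some X_j, and for lambda' < lambda_j
   one has V(x) >= lambda' |x - y0|^p near y0. With b = (z - y0) / e this gives
     e^-p int V(e y + z) w^2 >= lambda' int |y + b|^p w0^2 - o(1)
   on every disc (excess_ge). Since w0 is radial and |.|^p is subharmonic,
     int |y + b|^p w0^2 >= int max(|y|, |b|)^p w0^2
   (radial_translate). Dropping b yields lambda_j <= lambda, so y0 is in Z
   (lower_le_upper); with lambda_j = lambda, a drift b that does not tend to 0
   would make the lower bound exceed the upper one (drift_cvg). This is the
   second claim, because |b| = |z - y0| (a / astar q)^(1/(2-q)).

   The cut must cost only o(e^(p+2)), so w has to decay faster than a given
   power, uniformly in k. Comparing w with its own truncation (cut_estimate)
   shows that the H^1 mass outside radius 8 r is a small multiple of that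
   outside radius r (tail_contracts), provided that the Lagrange multiplier is
   bounded above by a negative constant. The nonlinear term is absorbed thanks
   to Ladyzhenskaya's inequality, which bounds the integral of w^4 over
   a tail by the square of the H^1 mass of the tail. The sign of the multiplier comes from the
   Euler-Lagrange equation tested with a bump placed where w0 is tiny
   (multiplier_neg): there the equation lap w0 = w0/e - |Q|^2 w0^3, in which e
   is the base of the natural logarithm, is almost linear. A bump placed far
   away, where V is large, shows in the same way that the scale tends to 0
   (e_small).

   The first parts provide what these arguments rest on: integrals of real
   functions on the plane, affine maps and shears as changes of variables,
   smooth bumps, the uniqueness of weak derivatives and their product and
   chain rules. *)

(** * Real-valued integrals over the plane *)

Section Plane_integral.
Context {R : realType}.
Implicit Types (f g h : R * R -> R) (A B : set (R * R)) (c M : R).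

Local Notation T2 := (measurableTypeR R * measurableTypeR R)%type.

(** Measurability for the product sigma-algebra, which is the one under which
   leb2 is a measure; open_measurable2 links it to the topology. *)
Definition mfun2 f := measurable_fun [set: T2] f.
Definition integ f := (@leb2 R).-integrable [set: T2] (EFin \o f).
Definition Int f : R := \int[@leb2 R]_x f x.

Lemma integ_mfun f : integ f -> mfun2 f.
Proof. by move=> /measurable_int /measurable_EFinP. Qed.

Lemma eq_Int f g : f =1 g -> Int f = Int g.
Proof. by move=> fg; congr Int; apply/funext. Qed.

Lemma integD f g : integ f -> integ g -> integ (fun x => f x + g x).
Proof. by move=> hf hg; exact: (integrableD measurableT hf hg). Qed.

Lemma integB f g : integ f -> integ g -> integ (fun x => f x - g x).
Proof. by move=> hf hg; exact: (integrableB measurableT hf hg). Qed.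

Lemma integZ c f : integ f -> integ (fun x => c * f x).
Proof. by move=> hf; exact: (integrableZl measurableT c hf). Qed.

Lemma integN f : integ f -> integ (fun x => - f x).
Proof. by move=> hf; exact: integrableN hf. Qed.

Lemma integ0 : integ (fun=> 0).
Proof. exact: integrable0. Qed.

Lemma integ_abs f : integ f -> integ (fun x => `|f x|).
Proof. by move=> hf; exact: integrable_norm hf. Qed.

Lemma integ_le f g : mfun2 f -> (forall x, `|f x| <= g x) -> integ g -> integ f.
Proof.
move=> mf fg hg; apply: (le_integrable measurableT _ _ hg) => //.
  exact/measurable_EFinP.
by move=> x _ /=; rewrite lee_fin (le_trans (fg x))// ler_norm.
Qed.

Lemma IntD f g : integ f -> integ g -> Int (fun x => f x + g x) = Int f + Int g.
Proof. by move=> hf hg; rewrite /Int RintegralD. Qed.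

Lemma IntB f g : integ f -> integ g -> Int (fun x => f x - g x) = Int f - Int g.
Proof. by move=> hf hg; rewrite /Int RintegralB. Qed.

Lemma IntZ c f : integ f -> Int (fun x => c * f x) = c * Int f.
Proof. by move=> hf; rewrite /Int RintegralZl. Qed.

Lemma IntN f : integ f -> Int (fun x => - f x) = - Int f.
Proof.
move=> hf; rewrite -mulN1r -IntZ//; apply: eq_Int => x; by rewrite mulN1r.
Qed.

Lemma Int0 : Int (fun=> 0) = 0.
Proof. by rewrite /Int /Rintegral integral0. Qed.

Lemma Int_ge0 f : (forall x, 0 <= f x) -> 0 <= Int f.
Proof. by move=> f0; apply: Rintegral_ge0. Qed.

Lemma Int_le f g : integ f -> integ g -> (forall x, f x <= g x) -> Int f <= Int g.
Proof. by move=> hf hg fg; apply: le_Rintegral. Qed.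

Lemma Int_abs f : integ f -> `|Int f| <= Int (fun x => `|f x|).
Proof. by move=> hf; apply: le_normr_Rintegral. Qed.

Lemma Int_abs_le f g : integ f -> integ g -> (forall x, `|f x| <= g x) ->
  `|Int f| <= Int g.
Proof.
move=> hf hg fg; apply: (le_trans (Int_abs hf)).
by apply: Int_le => //; exact: integ_abs.
Qed.

Lemma EFin_Int f : integ f -> (Int f)%:E = (\int[@leb2 R]_x (f x)%:E)%E.
Proof. by move=> hf; rewrite /Int /Rintegral fineK//; exact: (integrable_fin_num measurableT hf). Qed.

#[global] Instance ae2_filter : Filter (almost_everywhere (@leb2 R)).
Proof. exact: ae_filter_ringOfSetsType. Qed.

Lemma ae2S (P Q : R * R -> Prop) : (forall x, P x -> Q x) ->
  {ae @leb2 R, forall x, P x} -> {ae @leb2 R, forall x, Q x}.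
Proof. by move=> PQ; apply: filterS. Qed.

Lemma ae2S2 (P Q S : R * R -> Prop) : (forall x, P x -> Q x -> S x) ->
  {ae @leb2 R, forall x, P x} -> {ae @leb2 R, forall x, Q x} ->
  {ae @leb2 R, forall x, S x}.
Proof. by move=> PQ; apply: filterS2. Qed.

Definition aeeq f g := {ae @leb2 R, forall x, f x = g x}.

Lemma aeeq_Int f g : mfun2 f -> mfun2 g -> aeeq f g -> Int f = Int g.
Proof.
move=> mf mg fg; rewrite /Int /Rintegral; congr fine.
apply: ae_eq_integral => //; [exact/measurable_EFinP|exact/measurable_EFinP|].
by apply: ae2S fg => x /= -> .
Qed.

Lemma aeeq_integ f g : mfun2 g -> aeeq f g -> integ f -> integ g.
Proof.
move=> mg fg hf; apply/integrableP; split; first exact/measurable_EFinP.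
move/integrableP : (hf) => [_]; apply: le_lt_trans.
rewrite le_eqVlt; apply/orP; left; apply/eqP; apply: ae_eq_integral => //.
- by apply: measurableT_comp => //; exact/measurable_EFinP.
- by apply: measurableT_comp => //; exact: (measurable_int _ hf).
by apply: ae2S fg => x /= ->.
Qed.

Lemma mfun2D f g : mfun2 f -> mfun2 g -> mfun2 (fun x => f x + g x).
Proof. exact: measurable_funD. Qed.
Lemma mfun2B f g : mfun2 f -> mfun2 g -> mfun2 (fun x => f x - g x).
Proof. exact: measurable_funB. Qed.
Lemma mfun2M f g : mfun2 f -> mfun2 g -> mfun2 (fun x => f x * g x).
Proof. exact: measurable_funM. Qed.
Lemma mfun2Z c f : mfun2 f -> mfun2 (fun x => c * f x).
Proof. by move=> hf; apply: measurable_funM. Qed.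
Lemma mfun2X f n : mfun2 f -> mfun2 (fun x => f x ^+ n).
Proof. exact: measurable_funX. Qed.
Lemma mfun2_abs f : mfun2 f -> mfun2 (fun x => `|f x|).
Proof. by move=> hf; apply: measurableT_comp => //. Qed.
Lemma mfun2_powR f c : mfun2 f -> mfun2 (fun x => f x `^ c).
Proof. by move=> hf; apply: (measurableT_comp (measurable_powR c)). Qed.
Lemma mfun2_indic A : measurable (A : set T2) -> mfun2 (\1_A).
Proof. by move=> mA; exact: measurable_indic. Qed.

Lemma integM f g M : mfun2 g -> (forall x, `|g x| <= M) -> integ f ->
  integ (fun x => g x * f x).
Proof.
move=> mg gM hf; apply: (@integ_le _ (fun x => M * `|f x|)).
- by apply: mfun2M => //; exact: integ_mfun.
- by move=> x; rewrite normrM ler_wpM2r.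
- exact/integZ/integ_abs.
Qed.

(** The plane is second countable: an open set is a countable union of squares
   with rational centres. *)
Lemma open_measurable2 A : open A -> measurable (A : set T2).
Proof.
move=> oA.
pose F (a b : rat) (n : nat) : set T2 :=
  [set x | ball (ratr a : R) n.+1%:R^-1 x.1 /\ ball (ratr b : R) n.+1%:R^-1 x.2].
have mF a b n : measurable (F a b n).
  have -> : F a b n = ball (ratr a : R) n.+1%:R^-1 `*` ball (ratr b : R) n.+1%:R^-1.
    by apply/seteqP; split.
  by apply: measurableX; exact: measurable_ball.
have -> : (A : set T2) = \bigcup_a \bigcup_b \bigcup_n
    (if `[< F a b n `<=` A >] then F a b n else set0).
  apply/seteqP; split => [x Ax|x [a _ [b _ [n _]]]]; last first.
    by case: asboolP => // h /h.
  move: oA; rewrite openE => /(_ _ Ax) /nbhs_ballP[e /= e0 he].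
  have [n hn] : exists n : nat, (n.+1%:R^-1 : R) < e / 2.
    have e20 : 0 < e / 2 by apply: divr_gt0.
    by near \oo => n; exists n; near: n; exact: (near_infty_natSinv_lt (PosNum e20)).
  have [a] := @rat_in_itvoo R (x.1 - n.+1%:R^-1) (x.1 + n.+1%:R^-1)
    ltac:(by rewrite ltrD2l gtrN ?invr_gt0// ltr0n).
  rewrite in_itv/= => /andP[a1 a2].
  have [b] := @rat_in_itvoo R (x.2 - n.+1%:R^-1) (x.2 + n.+1%:R^-1)
    ltac:(by rewrite ltrD2l gtrN ?invr_gt0// ltr0n).
  rewrite in_itv/= => /andP[b1 b2].
  exists a => //; exists b => //; exists n => //.
  have xF : F a b n x.
    move: a1 a2 b1 b2; rewrite /F; set r : R := _%:R^-1; clearbody r => a1 a2 b1 b2.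
    by split => /=; rewrite -ball_normE/= ltr_norml; apply/andP; split; lra.
  case: asboolP => // -[] y [y1 y2]; apply: he.
  move: xF => [x1 x2]; move: hn x1 x2 y1 y2.
  set r : R := _%:R^-1; clearbody r => hn x1 x2 y1 y2.
  split; rewrite -ball_normE/=.
  - move: y1 x1; rewrite -!ball_normE/= !ltr_norml => /andP[? ?] /andP[? ?]; apply/andP; split; lra.
  - move: y2 x2; rewrite -!ball_normE/= !ltr_norml => /andP[? ?] /andP[? ?]; apply/andP; split; lra.
apply: bigcupT_measurable_rat => a; apply: bigcupT_measurable_rat => b.
by apply: bigcupT_measurable => n; case: ifP.
Unshelve. all: end_near. Qed.

Lemma cont_mfun2 f : continuous f -> mfun2 f.
Proof.
move=> cf; apply: (measurability _ (RGenOInfty.measurableE R)) => // _ [_ [a ->] <-].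
rewrite setTI; apply: open_measurable2.
by move/continuousP : cf; apply; exact: interval_open.
Qed.
End Plane_integral.

(** * Affine maps and shears as changes of variables *)

Section Change_of_variables.
Context {R : realType}.
Implicit Types (f g h : R * R -> R) (A B : set (R * R)) (c k : R).
Local Notation T2 := (measurableTypeR R * measurableTypeR R)%type.
Local Notation mu := (@lebesgue_measure R).

(** A change of variables with Jacobian k, stated on measurable sets. *)
Definition preserves k (T : T2 -> T2) :=
  [/\ 0 < k, measurable_fun [set: T2] T &
   forall A, measurable (A : set T2) -> (k%:E * leb2 (T @^-1` A) = leb2 A)%E].

Definition aff1 k c (x : measurableTypeR R) : measurableTypeR R := k * x + c.

Lemma measurable_aff1 k c : measurable_fun [set: measurableTypeR R] (aff1 k c).
Proof. by apply: measurable_funD => //; exact: measurable_funM. Qed.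

Lemma measurable_aff1_preimage k c (B : set (measurableTypeR R)) :
  measurable B -> measurable (aff1 k c @^-1` B).
Proof. by move=> mB; rewrite -[X in measurable X]setTI; exact: measurable_aff1. Qed.

Lemma leb_affine k c (A : set (measurableTypeR R)) : 0 < k -> measurable A ->
  (k%:E * mu (aff1 k c @^-1` A) = mu A)%E.
Proof.
move=> k0 mA; set phi := aff1 k c; have mphi := measurable_aff1 k c.
pose phi' : {mfun (measurableTypeR R) >-> measurableTypeR R} :=
  HB.pack phi (isMeasurableFun.Build _ _ _ _ _ mphi).
have k0' : 0 <= k by exact: ltW.
rewrite [RHS](@lebesgue_measure_unique _ (mscale (NngNum k0') (pushforward mu phi')))//.
move=> _ [[a b]] _ <-.
rewrite /mscale /pushforward [in RHS]/=.
rewrite [X in _ = (_ * mu X)%E](_ : _ = `](a - c) / k, (b - c) / k]%classic); last first.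
  apply/seteqP; split=> x /=; rewrite !in_itv/= /phi /aff1 ltr_pdivrMr// ler_pdivlMr// [x * k]mulrC;
  by move=> /andP[? ?]; apply/andP; split; lra.
rewrite !lebesgue_measure_itv/= !lte_fin ltr_pM2r ?invr_gt0// ltrD2r.
case: ifPn => ab; last by rewrite mule0.
by rewrite -!EFinB -EFinM; congr EFin; field; rewrite gt_eqF//.
Qed.

Lemma preserves_ge0 k T (g : T2 -> \bar R) : preserves k T ->
  measurable_fun [set: T2] g -> (forall x, 0 <= g x)%E ->
  (k%:E * \int[@leb2 R]_x g (T x) = \int[@leb2 R]_x g x)%E.
Proof.
move=> [k0 mT kT] mg g0.
pose T' : {mfun T2 >-> T2} := HB.pack T (isMeasurableFun.Build _ _ _ _ _ mT).
have k0' : 0 <= k by exact: ltW.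
pose nu' : {measure set T2 -> \bar R} :=
  mscale (NngNum k0') (pushforward (@leb2 R) T' : {measure set T2 -> \bar R}).
pose nu := nu' mT.
have -> : (\int[@leb2 R]_x g x = \int[nu]_x g x)%E.
  by apply: eq_measure_integral => A mA _ /=; rewrite /mscale/= -kT.
rewrite (ge0_integral_mscale _ measurableT); [|by []|by []].
rewrite (ge0_integral_pushforward mT _ measurableT); [|by []|by []].
by rewrite preimage_setT.
Qed.

Lemma preserves_integ k T f : preserves k T -> integ f -> integ (f \o T).
Proof.
move=> kT hf; have [k0 mT _] := kT.
have mf := integ_mfun hf.
have mfT : mfun2 (f \o T) by apply: measurableT_comp.
apply/integrableP; split; first exact/measurable_EFinP.
move/integrableP: (hf) => [_]; rewrite -(preserves_ge0 kT)//; last first.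
  by apply: measurableT_comp => //; exact/measurable_EFinP.
set I := (\int[_]_(x in _) _)%E => kI.
have : (I < +oo)%E.
  rewrite ltNge leye_eq; apply: contraTN kI => /eqP ->.
  by rewrite gt0_muley ?lte_fin// ltxx.
exact.
Qed.

Lemma preserves_Int k T f : preserves k T -> integ f -> k * Int (f \o T) = Int f.
Proof.
move=> kT hf; have hfT := preserves_integ kT hf.
apply/EFin_inj; rewrite EFinM !EFin_Int//.
rewrite [in LHS]integralE [in RHS]integralE muleBr//; last first.
  exact: integrable_add_def hfT.
congr (_ - _)%E.
  rewrite -[RHS](preserves_ge0 kT); first by congr (_ * _)%E; apply: eq_integral => x _; rewrite !funeposE.
    by apply: measurable_funepos; exact: (measurable_int _ hf).
  by move=> x; exact: funepos_ge0.
rewrite -[RHS](preserves_ge0 kT); first by congr (_ * _)%E; apply: eq_integral => x _; rewrite !funenegE.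
  by apply: measurable_funeneg; exact: (measurable_int _ hf).
by move=> x; exact: funeneg_ge0.
Qed.

Lemma preserves_ae k T (P : R * R -> Prop) : preserves k T ->
  {ae @leb2 R, forall x, P x} -> {ae @leb2 R, forall x, P (T x)}.
Proof.
move=> [k0 mT kT] [N [mN N0 PN]]; exists (T @^-1` N); split.
- by rewrite -[X in measurable X]setTI; exact: mT.
- have := kT _ mN; rewrite N0 => /eqP; rewrite mule_eq0 eqe gt_eqF//= => /eqP //.
- by move=> x /= nP; apply: PN.
Qed.
Lemma preserves_comp k T k' T' : preserves k T -> preserves k' T' ->
  preserves (k * k') (T \o T').
Proof.
move=> [k0 mT kT] [k0' mT' kT']; split; first exact: mulr_gt0.
  exact: measurableT_comp.
move=> A mA; have mTA : measurable (T @^-1` A) by rewrite -[X in measurable X]setTI; exact: mT.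
by rewrite comp_preimage EFinM -muleA kT'// kT.
Qed.

Lemma leb2_prod (A B : set (measurableTypeR R)) : measurable A -> measurable B ->
  leb2 (A `*` B) = (mu A * mu B)%E.
Proof. by move=> mA mB; exact: product_measure1E. Qed.

Definition affmap (k : R) (z x : R * R) : R * R := k *: x + z.

(** By uniqueness of product measures it is enough to treat rectangles, whose
   sides are scaled separately. *)
Lemma preserves_affine k (z : R * R) : 0 < k -> preserves (k ^+ 2) (affmap k z).
Proof.
move=> k0; have mT : measurable_fun [set: T2] (affmap k z : T2 -> T2).
  apply/measurable_fun_pairP; split => /=.
    by apply: measurable_funD => //; apply: measurable_funM.
  by apply: measurable_funD => //; apply: measurable_funM.
split => //; first by rewrite exprn_gt0.
move=> A mA.
have k0' : 0 <= k ^+ 2 by rewrite ltW// exprn_gt0.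
pose T' : {mfun T2 >-> T2} := HB.pack (affmap k z : T2 -> T2) (isMeasurableFun.Build _ _ _ _ _ mT).
rewrite [RHS](@product_measure_unique _ _ _ _ _ _ _
  (mscale (NngNum k0') (pushforward (@leb2 R) T')))// => {mA}A1 A2 m1 m2.
rewrite -[LHS]/((k ^+ 2)%:E *
  leb2 ((aff1 k z.1 @^-1` A1) `*` (aff1 k z.2 @^-1` A2)))%E.
rewrite leb2_prod; try exact: measurable_aff1_preimage.
transitivity (mu A1 * mu A2)%E; last by [].
rewrite -(@leb_affine k z.1 A1)// -(@leb_affine k z.2 A2)//.
by rewrite expr2 EFinM -!muleA; congr (_ * _)%E; rewrite muleCA.
Qed.

Lemma leb2_ysection A : measurable (A : set T2) ->
  leb2 A = (\int[mu]_y mu (ysection A y))%E.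
Proof.
move=> mA; rewrite [LHS](@product_measure_unique _ _ _ _ _ _ _ (mu \x^ mu)%E)//.
by move=> B C mB mC; exact: product_measure2E.
Qed.

Definition shear1 (s : R) (x : R * R) : R * R := (x.1 + s * x.2, x.2).
Definition shear2 (s : R) (x : R * R) : R * R := (x.1, x.2 + s * x.1).

Lemma mu_shift c (B : set (measurableTypeR R)) : measurable B ->
  mu ((fun x : measurableTypeR R => (x + c)%R : measurableTypeR R) @^-1` B) = mu B.
Proof.
move=> mB; rewrite -[RHS](@leb_affine 1 c)// mul1e; congr (mu _).
by apply/seteqP; split => x /=; rewrite /aff1 mul1r.
Qed.

(** A shear translates each horizontal section, and Lebesgue measure on the
   line is invariant under translations. Rotations will be obtained as
   products of three shears. *)
Lemma preserves_shear1 s : preserves 1 (shear1 s).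
Proof.
have mT : measurable_fun [set: T2] (shear1 s : T2 -> T2).
  apply/measurable_fun_pairP; split => /=; last exact: measurable_snd.
  by apply: measurable_funD => //; apply: measurable_funM.
split; [exact: ltr01|exact: mT|move=> A mA; rewrite mul1e].
have mTA : measurable (shear1 s @^-1` A : set T2) by rewrite -[X in measurable X]setTI; exact: mT.
rewrite !leb2_ysection//; apply: eq_integral => y _.
rewrite -[RHS](@mu_shift (s * y)); last exact: measurable_ysection.
congr (mu _); apply/seteqP; split => x /=; rewrite !ysectionE//=.
Qed.

Lemma preserves_shear2 s : preserves 1 (shear2 s).
Proof.
have mT : measurable_fun [set: T2] (shear2 s : T2 -> T2).
  apply/measurable_fun_pairP; split => /=; first exact: measurable_fst.
  by apply: measurable_funD => //; apply: measurable_funM.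
split; [exact: ltr01|exact: mT|move=> A mA; rewrite mul1e].
have mTA : measurable (shear2 s @^-1` A : set T2) by rewrite -[X in measurable X]setTI; exact: mT.
rewrite /leb2 /product_measure1 /=; apply: eq_integral => y _ /=.
rewrite -[RHS](@mu_shift (s * y)); last exact: measurable_xsection.
congr (mu _); apply/seteqP; split => x /=; rewrite !xsectionE//=.
Qed.
End Change_of_variables.

(** * Square-integrable functions and limit theorems *)

Section Square_integrable.
Context {R : realType}.
Implicit Types (f g h : R * R -> R) (c k M : R).
Local Notation T2 := (measurableTypeR R * measurableTypeR R)%type.

Definition sqint f := mfun2 f /\ integ (fun x => f x ^+ 2).

Lemma sqint_mfun f : sqint f -> mfun2 f. Proof. by case. Qed.
Lemma sqint_sqr f : sqint f -> integ (fun x => f x ^+ 2). Proof. by case. Qed.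

Lemma Lfun_sqint f : f \in Lfun (@leb2 R) 2%:E <-> sqint f.
Proof.
split=> [f2|[mf if2]].
  split; last exact: (Lfun2_integrable_sqr f2).
  by move: f2; rewrite inE => /andP[]; rewrite inE.
rewrite inE; apply/andP; split; rewrite inE/=; first exact: mf.
rewrite /finite_norm unlock poweR_lty//.
move/integrableP : if2 => [_]; apply: le_lt_trans; rewrite le_eqVlt.
apply/orP; left; apply/eqP; apply: eq_integral => x _ /=.
by rewrite powR_mulrn// normrX.
Qed.

Lemma L2norm_sqr f : sqint f -> L2norm f ^+ 2 = Int (fun x => f x ^+ 2).
Proof.
move=> [mf if2]; rewrite /L2norm unlock.
have -> : (\int[@leb2 R]_x `|(EFin \o f) x| `^ 2)%E =
    (Int (fun x => f x ^+ 2))%:E.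
  by rewrite EFin_Int//; apply: eq_integral => x _ /=; rewrite powR_mulrn// -normrX ger0_norm// sqr_ge0.
rewrite /= -powR_mulrn ?powR_ge0// -powRrM mulVf// powRr1//.
by apply: Int_ge0 => x; rewrite sqr_ge0.
Qed.

Lemma sqintD f g : sqint f -> sqint g -> sqint (fun x => f x + g x).
Proof.
move=> [mf f2] [mg g2]; split; first exact: mfun2D.
apply: (@integ_le _ _ (fun x => 2 * f x ^+ 2 + 2 * g x ^+ 2)).
- exact: (mfun2X 2 (mfun2D mf mg)).
- by move=> x; rewrite ger0_norm ?sqr_ge0//; have := sqr_ge0 (f x - g x); lra.
- by apply: integD; exact: integZ.
Qed.

Lemma sqintZ c f : sqint f -> sqint (fun x => c * f x).
Proof.
move=> [mf f2]; split; first exact: mfun2Z.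
have -> : (fun x => (c * f x) ^+ 2) = (fun x => c ^+ 2 * f x ^+ 2).
  by apply/funext => x; rewrite exprMn.
exact: integZ f2.
Qed.

Lemma sqintB f g : sqint f -> sqint g -> sqint (fun x => f x - g x).
Proof.
move=> hf /(sqintZ (-1)) hg; have := sqintD hf hg.
by under eq_fun do rewrite mulN1r.
Qed.

Lemma sqint_le f g : mfun2 f -> (forall x, `|f x| <= `|g x|) -> sqint g -> sqint f.
Proof.
move=> mf fg [mg g2]; split=> //; apply: integ_le g2; first exact: mfun2X.
by move=> x; rewrite normrX -[leRHS]ger0_norm ?sqr_ge0// normrX lerXn2r ?nnegrE.
Qed.

Lemma sqintM f g M : mfun2 g -> (forall x, `|g x| <= M) -> sqint f ->
  sqint (fun x => g x * f x).
Proof.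
move=> mg gM hf; apply: (sqint_le _ _ (sqintZ M hf)).
  by apply: mfun2M => //; exact: sqint_mfun.
by move=> x; rewrite !normrM ler_wpM2r// (le_trans (gM x))// ler_norm.
Qed.

Lemma integ_mul f g : sqint f -> sqint g -> integ (fun x => f x * g x).
Proof.
move=> [mf f2] [mg g2].
apply: (@integ_le _ _ (fun x => f x ^+ 2 + g x ^+ 2)).
- exact: mfun2M.
- move=> x; have := sqr_ge0 (f x - g x); have := sqr_ge0 (f x + g x).
  have := sqr_ge0 (f x); have := sqr_ge0 (g x).
  by move=> *; rewrite ler_norml; apply/andP; split; nra.
- exact: integD.
Qed.

Lemma Int_sqr_ge0 f : 0 <= Int (fun x => f x ^+ 2).
Proof. by apply: Int_ge0 => x; rewrite sqr_ge0. Qed.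

Lemma Int_sqrD c f g : sqint f -> sqint g ->
  Int (fun x => (f x + c * g x) ^+ 2) = Int (fun x => f x ^+ 2) +
   2 * c * Int (fun x => f x * g x) + c ^+ 2 * Int (fun x => g x ^+ 2).
Proof.
move=> hf hg; have hfg := integ_mul hf hg.
have := sqint_sqr hf; have := sqint_sqr hg => g2 f2.
have i1 := integZ (2 * c) hfg; have i2 := integZ (c ^+ 2) g2.
rewrite -(IntZ (2 * c) hfg) -(IntZ _ g2) -(IntD f2 i1) -(IntD (integD f2 i1) i2).
by apply: eq_Int => x; ring.
Qed.

Lemma Cauchy_Schwarz f g : sqint f -> sqint g ->
  Int (fun x => f x * g x) ^+ 2 <= Int (fun x => f x ^+ 2) * Int (fun x => g x ^+ 2).
Proof.
move=> hf hg.
have h c : 0 <= Int (fun x => f x ^+ 2) +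
   2 * c * Int (fun x => f x * g x) + c ^+ 2 * Int (fun x => g x ^+ 2).
  by rewrite -Int_sqrD//; exact: Int_sqr_ge0.
move: h (Int_sqr_ge0 g) (Int_sqr_ge0 f).
set F := Int _; set P := Int _; set G := Int _ => h G0 profile_moment.
have [G00|Gn0] := eqVneq G 0.
  have [->|P0] := eqVneq P 0; first by rewrite expr0n/= mulr_ge0.
  have := h (- (F + 1) / P); rewrite G00 mulr0 addr0.
  have -> : F + 2 * (- (F + 1) / P) * P = - F - 2 by field.
  by move=> ?; exfalso; lra.
have Gp : 0 < G by rewrite lt_def Gn0.
have := h (- P / G).
have -> : F + 2 * (- P / G) * P + (- P / G) ^+ 2 * G = F - P ^+ 2 / G by field.
by rewrite subr_ge0 ler_pdivrMr.
Qed.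

Lemma Cauchy_Schwarz_sqrt f g : sqint f -> sqint g ->
  `|Int (fun x => f x * g x)| <=
  Num.sqrt (Int (fun x => f x ^+ 2)) * Num.sqrt (Int (fun x => g x ^+ 2)).
Proof.
move=> hf hg; rewrite -sqrtrM ?Int_sqr_ge0// -sqrtr_sqr ler_wsqrtr//.
exact: Cauchy_Schwarz.
Qed.

Lemma aeeq_sym f g : aeeq f g -> aeeq g f.
Proof. by apply: ae2S. Qed.

Lemma Int_dominated (f_ : nat -> R * R -> R) f g :
  (forall n, mfun2 (f_ n)) -> mfun2 f ->
  (forall x, f_ n x @[n --> \oo] --> f x) ->
  integ g -> (forall n x, `|f_ n x| <= g x) ->
  Int (f_ n) @[n --> \oo] --> Int f.
Proof.
move=> mf_ mf ff ig fg.
have ig_ n : integ (f_ n) by apply: integ_le (fg n) ig.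
have [] := @dominated_convergence _ _ _ (@leb2 R) setT measurableT
  (fun n => EFin \o f_ n) (EFin \o f) (EFin \o g).
- by move=> n; apply/measurable_EFinP; exact: mf_.
- exact/measurable_EFinP.
- by apply: aeW => x _ /=; apply: cvg_EFin; [exact: nearW|exact: ff].
- exact: ig.
- by apply: aeW => x n _ /=; rewrite lee_fin.
move=> iff _; have ifi : integ f by exact: iff.
move=> h; have : (fun n => \int[@leb2 R]_x (EFin \o f_ n) x)%E @ \oo --> (Int f)%:E.
  by rewrite EFin_Int.
by move/fine_cvg; apply: cvg_trans; apply: near_eq_cvg; apply: nearW.
Qed.

(** Monotone convergence along an exhaustion of the plane; a bound on the
   partial integrals is what gives integrability. *)
Lemma Int_bounded_exhaustion f C (A : nat -> set (R * R)) : mfun2 f ->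
  (forall x, 0 <= f x) -> (forall n, measurable (A n : set T2)) ->
  (forall n m, (n <= m)%N -> A n `<=` A m) -> (forall x, exists n, A n x) ->
  (forall n, integ (fun x => \1_(A n) x * f x)) ->
  (forall n, Int (fun x => \1_(A n) x * f x) <= C) ->
  [/\ integ f, Int f <= C &
      Int (fun x => \1_(A n) x * f x) @[n --> \oo] --> Int f].
Proof.
move=> mf f0 mA ndA cA iA AC.
have c : forall x, (\1_(A n) x * f x) @[n --> \oo] --> f x.
  move=> x; have [n Anx] := cA x; apply: cvg_near_cst.
  exists n => // m /= nm; rewrite indicE mem_set ?mul1r//; exact: ndA nm _ Anx.
have ifi : integ f /\ (\int[@leb2 R]_x (f x)%:E <= C%:E)%E.
  suff leC : (\int[@leb2 R]_x (f x)%:E <= C%:E)%E.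
    split=> //; apply/integrableP; split; first exact/measurable_EFinP.
    under eq_integral => x _ do rewrite /= ger0_norm//.
    exact: le_lt_trans leC (ltry _).
  have := @fatou _ _ _ (@leb2 R) setT measurableT (fun n x => (\1_(A n) x * f x)%:E).
  move=> /(_ _ _) H; apply: le_trans (le_trans _ (H _ _)) _ => {H}.
  - rewrite le_eqVlt; apply/orP; left; apply/eqP; apply: eq_integral => x _.
    have /cvg_limn_einf_sup[-> _]// : (\1_(A n) x * f x)%:E @[n --> \oo] --> (f x)%:E.
    by apply: cvg_EFin; [exact: nearW|exact: c].
  - by move=> n; apply/measurable_EFinP; exact: integ_mfun (iA n).
  - by move=> n x _; rewrite lee_fin mulr_ge0// indicE.
  - rewrite limn_einf_lim; apply: lime_le; first exact: is_cvg_einfs.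
    apply: nearW => n; apply: (@le_trans _ _ (Int (fun x => \1_(A n) x * f x))%:E).
      by apply: ereal_inf_lbound; exists n => //=; rewrite EFin_Int.
    by rewrite lee_fin.
have [hf leC] := ifi; split=> //; first by rewrite -lee_fin EFin_Int.
apply: (@Int_dominated _ _ f) => //; first by move=> n; exact: integ_mfun (iA n).
move=> n x; rewrite normrM [`|f x|]ger0_norm// ger0_norm ?indicE//.
by rewrite ler_piMl// lern1 leq_b1.
Qed.
End Square_integrable.

(** * Calculus of functions of class C^k on the plane *)

Section Smooth_functions.
Context {R : realType}.

Lemma fst_cont : continuous (fst : R * R -> R).
Proof. by move=> x; exact: cvg_fst. Qed.

Lemma snd_cont : continuous (snd : R * R -> R).
Proof. by move=> x; exact: cvg_snd. Qed.

Lemma pair_cont (f g : R * R -> R) : continuous f -> continuous g ->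
  continuous (fun x => (f x, g x)).
Proof. by move=> cf cg x; exact: (cvg_pair (cf x) (cg x)). Qed.

Implicit Types (u v g : R * R -> R) (A : R -> R) (c e : R) (x z : R * R).

(** The way to establish membership in C^(k+1): exhibit the partial
   derivatives. *)
Lemma CnS_intro k u (g : bool -> R * R -> R) : continuous u ->
  (forall i x, is_derive x (basis_vec i) u (g i x)) ->
  (forall i, Cn k (g i)) -> Cn k.+1 u.
Proof.
move=> cu du Cg; split=> // i; split; first by move=> x; exact: ex_derive.
have -> // : partial i u = g i by apply/funext => x; exact: derive_val.
Qed.

Lemma Cn_derive k u i x : Cn k.+1 u -> is_derive x (basis_vec i) u (partial i u x).
Proof. by move=> [_ /(_ i)[/(_ x) du _]]; exact: derivableP. Qed.

Lemma Cn_partial k u i : Cn k.+1 u -> Cn k (partial i u).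
Proof. by move=> [_ /(_ i)[]]. Qed.

Lemma Cn_cont k u : Cn k u -> continuous u.
Proof. by case: k => // k []. Qed.

Lemma Cn_pred k u : Cn k.+1 u -> Cn k u.
Proof.
elim: k u => [|k IH] u Cu; first exact: Cn_cont Cu.
apply: (CnS_intro (Cn_cont Cu) (g := fun i => partial i u)).
  by move=> i x; exact: Cn_derive Cu.
by move=> i; apply: IH; exact: Cn_partial.
Qed.

Lemma Cn_cst k c : Cn k (fun=> c : R).
Proof.
elim: k c => [|k IH] c; first exact: cst_continuous.
apply: (@CnS_intro k _ (fun=> fun=> 0)) => //; exact: cst_continuous.
Qed.

Lemma CnD k u v : Cn k u -> Cn k v -> Cn k (fun x => u x + v x).
Proof.
elim: k u v => [|k IH] u v Cu Cv.
  by move=> x; apply: cvgD; [exact: Cu|exact: Cv].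
apply: (@CnS_intro k _ (fun i x => partial i u x + partial i v x)).
- by move=> x; apply: cvgD; [exact: (Cn_cont Cu)|exact: (Cn_cont Cv)].
- move=> i x; have := Cn_derive i x Cu; have := Cn_derive i x Cv => ? ?.
  exact: is_deriveD.
- by move=> i; apply: IH; exact: Cn_partial.
Qed.

Lemma CnM k u v : Cn k u -> Cn k v -> Cn k (fun x => u x * v x).
Proof.
elim: k u v => [|k IH] u v Cu Cv.
  by move=> x; apply: cvgM; [exact: Cu|exact: Cv].
apply: (@CnS_intro k _ (fun i x => u x * partial i v x + v x * partial i u x)).
- by move=> x; apply: cvgM; [exact: (Cn_cont Cu)|exact: (Cn_cont Cv)].
- move=> i x; have := Cn_derive i x Cu; have := Cn_derive i x Cv => ? ?.
  exact: is_deriveM.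
- by move=> i; apply: CnD; apply: IH; solve [exact: Cn_partial|exact: Cn_pred].
Qed.

Lemma CnZ k c u : Cn k u -> Cn k (fun x => c * u x).
Proof. by move=> Cu; apply: CnM => //; exact: Cn_cst. Qed.

Lemma is_derive_lineP u x w d : is_derive x w u d <->
  is_derive (0 : R) 1 (fun h : R => u (h *: w + x)) d.
Proof.
have E : 'D_w u x = 'D_1 (fun h : R => u (h *: w + x)) (0 : R).
  rewrite /derive (_ : (fun h : R => h^-1 *: ((u \o shift x) (h *: w) - u x)) =
    (fun h : R => h^-1 *: (((fun h : R => u (h *: w + x)) \o shift (0 : R)) (h *: (1 : R)) -
      u ((0 : R) *: w + x))))//; apply/funext => h /=.
  by rewrite scale0r add0r addr0; congr (_ *: (u (_ *: _ + _) - _)); rewrite /GRing.scale/= mulr1.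
split=> -[du dE].
  by split; [exact/(derivable1P u x w)|rewrite -E].
by split; [exact/(derivable1P u x w)|rewrite E].
Qed.

Lemma is_derive_affine u e z x w d : is_derive (affmap e z x) w u d ->
  is_derive x w (u \o affmap e z) (e * d).
Proof.
move=> /is_derive_lineP FE; apply/is_derive_lineP; move: FE.
set F := (fun h : R => u (h *: w + affmap e z x)) => FE.
have H : is_derive (0:R) 1 (fun h : R => e * h) e.
  by apply: is_derive_eq; rewrite /GRing.scale/= mulr1.
have FE' : is_derive (e * 0) 1 F d by rewrite mulr0.
have := is_derive1_comp FE' H; rewrite mulrC.
suff -> : F \o (fun h : R => e * h) = (fun h : R => (u \o affmap e z) (h *: w + x)) by [].
by apply/funext => h; rewrite /F /= /affmap scalerDr scalerA addrA.
Qed.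

Lemma affmap_cont e z : continuous (affmap e z).
Proof.
by move=> x; apply: cvgD; [apply: cvgZl_tmp; exact: cvg_id|exact: cvg_cst].
Qed.

Lemma Cn_affine k u e z : Cn k u -> Cn k (u \o affmap e z).
Proof.
elim: k u => [|k IH] u Cu.
  by move=> x; apply: continuous_comp; [exact: affmap_cont|exact: Cu].
apply: (@CnS_intro k _ (fun i x => e * (partial i u \o affmap e z) x)).
- by move=> x; apply: continuous_comp; [exact: affmap_cont|exact: (Cn_cont Cu)].
- by move=> i x; apply: is_derive_affine; exact: Cn_derive Cu.
- by move=> i; apply: CnZ; apply: IH; exact: Cn_partial.
Qed.

Definition swap2 x : R * R := (x.2, x.1).

Lemma Cn_swap k u : Cn k u -> Cn k (u \o swap2).
Proof.
have csw : continuous swap2.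
  exact: (pair_cont snd_cont fst_cont).
elim: k u => [|k IH] u Cu.
  by move=> x; apply: continuous_comp; [exact: csw|exact: Cu].
apply: (@CnS_intro k _ (fun i x => (partial (~~ i) u \o swap2) x)).
- by move=> x; apply: continuous_comp; [exact: csw|exact: (Cn_cont Cu)].
- move=> i x; have [du dE] := Cn_derive (~~ i) (swap2 x) Cu.
  have E : (fun h : R => h^-1 *: ((u \o shift (swap2 x)) (h *: basis_vec (~~ i)) - u (swap2 x))) =
      (fun h : R => h^-1 *: (((u \o swap2) \o shift x) (h *: basis_vec i) - (u \o swap2) x)).
    by apply/funext => h /=; case: i {du dE}.
  by split; [rewrite /derivable -E|rewrite /derive -E].
- by move=> i; apply: IH; exact: Cn_partial.
Qed.

Lemma is_derive_fst A x d i : is_derive x.1 1 A d ->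
  is_derive x (basis_vec i) (fun y => A y.1) (if i then 0 else d).
Proof.
move=> [dA dE]; case: i; last first.
  by split; [exact: dA|exact: dE].
have E : (fun h : R => h^-1 *: (((fun y : R * R => A y.1) \o shift x) (h *: basis_vec true) - A x.1)) = cst 0.
  by apply/funext => h /=; rewrite /= -[h *: 0]/(h * 0) mulr0 add0r subrr scaler0.
by split; [rewrite /derivable E; exact: is_cvg_cst|rewrite /derive E; exact: lim_cst].
Qed.

Lemma CnS_fst k A (A' : R -> R) : (forall x : R, is_derive x 1 A (A' x)) ->
  Cn k (fun x => A' x.1) -> Cn k.+1 (fun x => A x.1).
Proof.
move=> dA CA'.
have cA : continuous A.
  move=> x; apply: differentiable_continuous; apply/derivable1_diffP.
  by have [] := dA x.
apply: (@CnS_intro k _ (fun i x => if i then 0 else A' x.1)).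
- by move=> x; apply: (@continuous_comp _ _ _ fst A); [exact: cvg_fst|exact: cA].
- by move=> i x; exact: is_derive_fst.
- by case => //; exact: Cn_cst.
Qed.

Lemma CnV k u : (forall x, u x != 0) -> Cn k u -> Cn k (fun x => (u x)^-1).
Proof.
move=> u0; elim: k => [|k IH] Cu.
  by move=> x; apply: cvgV; [exact: u0|exact: Cu].
apply: (@CnS_intro k _ (fun i x => (-1) * ((u x)^-1 * (u x)^-1 * partial i u x))).
- by move=> x; apply: cvgV; [exact: u0|exact: (Cn_cont Cu)].
- move=> i x; have du := Cn_derive i x Cu.
  apply/is_derive_lineP; move/is_derive_lineP : du => du.
  have ux : u ((0 : R) *: basis_vec i + x) != 0 by exact: u0.
  have := is_deriveV ux du; rewrite scale0r add0r => H.
  by apply: is_derive_eq; rewrite /GRing.scale/= expr2 invfM; ring.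
- move=> i; have CV := IH (Cn_pred Cu).
  by apply: CnZ; apply: CnM; [exact: CnM|exact: Cn_partial].
Qed.
End Smooth_functions.

(** * A smooth step function *)

Section Smooth_step.
Context {R : realType}.
Implicit Types (x y c a b : R).

Lemma is_derive_flat (f : R -> R) c : f 0 = 0 -> (forall y, `|f y| <= c * y ^+ 2) ->
  is_derive (0 : R) 1 f 0.
Proof.
move=> f0 fc.
have H : (fun h : R => h^-1 *: ((f \o shift 0) (h *: (1 : R)) - f 0)) @ 0^' --> (0 : R).
  apply/cvgrPdist_lt => /= e e0.
  have c0 : 0 <= c by have := fc 1; rewrite expr1n mulr1; apply: le_trans.
  near=> h.
  have h0 : h != 0 by near: h; exact: nbhs_dnbhs_neq.
  rewrite f0 subr0 addr0 /GRing.scale/= mulr1 sub0r normrN normrM normfV.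
  rewrite mulrC ltr_pdivrMr ?normr_gt0//.
  apply: (le_lt_trans (fc h)); rewrite -normr_id -real_normK ?num_real// normr_id expr2 mulrA.
  rewrite ltr_pM2r ?normr_gt0//.
  have : `|h| < e / (c + 1).
    near: h; apply: dnbhs0_lt; apply: divr_gt0 => //; lra.
  rewrite ltr_pdivlMr; last by lra.
  have := normr_ge0 h; nra.
by split; [apply/cvg_ex; exists 0|apply: cvg_lim].
Unshelve. all: by end_near. Qed.

(** The functions x^-n exp(-1/x), extended by 0 to the left, form a family
   closed under derivation up to linear combinations, so that flat 0 is
   smooth. *)
Definition flat (n : nat) x : R := if 0 < x then x^-1 ^+ n * expR (- x^-1) else 0.

Lemma flat_ge0 n x : 0 <= flat n x.
Proof.
rewrite /flat; case: ifPn => // x0.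
by rewrite mulr_ge0// ?expR_ge0// exprn_ge0// invr_ge0 ltW.
Qed.

Lemma flat0_gt0 x : 0 < x -> 0 < flat 0 x.
Proof. by move=> x0; rewrite /flat x0 expr0 mul1r expR_gt0. Qed.

Lemma flat_le0 n x : x <= 0 -> flat n x = 0.
Proof. by move=> x0; rewrite /flat ltNge x0. Qed.

(** The quadratic bound makes the derivative at 0 vanish. *)
Lemma flat_sqr n x : `|flat n x| <= (n.+2)`!%:R * x ^+ 2.
Proof.
rewrite ger0_norm ?flat_ge0//; have [x0|x0] := leP x 0.
  by rewrite flat_le0// mulr_ge0 ?sqr_ge0.
rewrite /flat x0 expRN ler_pdivrMr ?expR_gt0//.
have s0 : 0 <= x^-1 by rewrite invr_ge0 ltW.
have := expR_ge1Dxn n.+1 s0.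
set E := expR _ => H.
have H2 : x^-1 ^+ n.+2 / (n.+2)`!%:R <= E by apply: le_trans H; rewrite lerDr.
move: H2; rewrite ler_pdivrMr ?ltr0n ?fact_gt0// => H2.
have -> : x^-1 ^+ n = x ^+ 2 * x^-1 ^+ n.+2.
  by rewrite -[n.+2]addn2 exprD mulrCA -exprMn mulfV ?gt_eqF// expr1n mulr1.
apply: le_trans (ler_wpM2l (sqr_ge0 x) H2) _.
by rewrite [E * _]mulrC mulrA [x ^+ 2 * _]mulrC.
Qed.

Lemma is_derive_flatn n x : is_derive x 1 (flat n) (flat n.+2 x - n%:R * flat n.+1 x).
Proof.
have [x0|x0|->] := ltgtP x 0.
- rewrite !flat_le0 ?ltW// mulr0 subr0.
  apply: (near_eq_is_derive (f := cst 0)).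
  near=> y; rewrite flat_le0//; apply/ltW; near: y; exact: lt_nbhsl.
- apply: (near_eq_is_derive (f := (fun y => y^-1 ^+ n * expR (- y^-1)))).
    near=> y; rewrite /flat; suff -> : 0 < y by []; near: y; exact: lt_nbhsr.
  have xn0 : x != 0 by rewrite gt_eqF.
  have dV : is_derive x 1 (fun y : R => y^-1) (- x ^- 2).
    have := @is_deriveV _ (@id R) x 1 1 xn0 (is_derive_id _ _).
    by move=> H; apply: is_derive_eq; rewrite /GRing.scale/= mulr1.
  have dX : is_derive x 1 (fun y : R => y^-1 ^+ n) (n%:R * x^-1 ^+ n.-1 * (- x ^- 2)).
    have H := @is_deriveX _ _ (fun y : R => y^-1) n x 1 _ dV.
    by rewrite exprfctE in H.
  have dE : is_derive x 1 (fun y : R => expR (- y^-1)) (expR (- x^-1) * x ^- 2).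
    have dN : is_derive x 1 (fun y : R => - y^-1) (x ^- 2).
      by apply: is_derive_eq; rewrite opprK.
    exact: (is_derive1_comp (is_derive_expR _) dN).
  have := is_deriveM dX dE => H; apply: (is_derive_eq H).
  rewrite /flat x0 /GRing.scale/=.
  case: n {dX H} => [|n] /=; first by rewrite !expr0 !mul0r subr0 mulr0 addr0 mul1r exprVn mulrC.
  by rewrite -!exprVn !exprS; ring.
- rewrite [X in is_derive _ _ _ X](_ : _ = 0); last by rewrite !flat_le0// mulr0 subr0.
  by apply: is_derive_flat (flat_sqr n); rewrite flat_le0.
Unshelve. all: by end_near. Qed.

Lemma Cn_flat k n : Cn k (fun x : R * R => flat n x.1).
Proof.
elim: k n => [|k IH] n.
  move=> x; apply: (@continuous_comp _ _ _ fst (flat n)); first exact: fst_cont.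
  apply: differentiable_continuous; apply/derivable1_diffP.
  by have [] := is_derive_flatn n x.1.
apply: (CnS_fst (A' := fun x => flat n.+2 x - n%:R * flat n.+1 x)).
  exact: is_derive_flatn.
have -> : (fun x : R * R => flat n.+2 x.1 - n%:R * flat n.+1 x.1) =
  (fun x : R * R => flat n.+2 x.1 + (- n%:R) * flat n.+1 x.1).
  by apply/funext => x; rewrite mulNr.
by apply: CnD => //; exact: CnZ.
Qed.

Definition step x : R := flat 0 x / (flat 0 x + flat 0 (1 - x)).

Lemma step_den x : 0 < flat 0 x + flat 0 (1 - x).
Proof.
have [x0|x0] := leP x 0.
  by rewrite ltr_wpDl ?flat_ge0//; apply: flat0_gt0; lra.
by rewrite ltr_pwDl ?flat_ge0//; exact: flat0_gt0.
Qed.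

Lemma step_ge0 x : 0 <= step x.
Proof. by rewrite /step divr_ge0 ?flat_ge0// ltW// step_den. Qed.

Lemma step_le1 x : step x <= 1.
Proof. by rewrite /step ler_pdivrMr ?step_den// mul1r lerDl flat_ge0. Qed.

Lemma step_le0 x : x <= 0 -> step x = 0.
Proof. by move=> x0; rewrite /step flat_le0// mul0r. Qed.

Lemma step_ge1 x : 1 <= x -> step x = 1.
Proof.
move=> x1; rewrite /step [flat 0 (1 - x)]flat_le0; last by lra.
by rewrite addr0 divff// gt_eqF// flat0_gt0//; lra.
Qed.

Lemma Cn_step k : Cn k (fun x : R * R => step x.1).
Proof.
have C2 : Cn k (fun x : R * R => flat 0 (1 - x.1)).
  have := @Cn_affine _ k _ (-1) (1, 0) (Cn_flat k 0).
  suff -> : (fun x : R * R => flat 0 x.1) \o affmap (-1) (1, 0) =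
    (fun x : R * R => flat 0 (1 - x.1)) by [].
  by apply/funext => x; rewrite /affmap /= /GRing.scale/= mulN1r addrC.
apply: CnM; first exact: Cn_flat.
apply: CnV; last by apply: CnD => //; exact: Cn_flat.
by move=> x; rewrite gt_eqF// step_den.
Qed.

Lemma Cn_step1 k c a : Cn k (fun x : R * R => step (c * x.1 + a)).
Proof. by have := @Cn_affine _ k _ c (a, 0) (Cn_step k). Qed.

Lemma Cn_step2 k c a : Cn k (fun x : R * R => step (c * x.2 + a)).
Proof. by have := Cn_swap (Cn_step1 k c a). Qed.
End Smooth_step.

(** * Test functions and integration by parts *)

Section Test_functions.
Context {R : realType}.
Implicit Types (f g h t u v F : R * R -> R) (c M : R) (x z : R * R) (i : bool).
Local Notation T2 := (measurableTypeR R * measurableTypeR R)%type.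
Local Notation mu := (@lebesgue_measure R).

Definition smooth u := forall k, Cn k u.
(** The norm here is the sup norm, so functions vanish off squares. *)
Definition vanishes_off M u := forall x, M < `|x| -> u x = 0.

Lemma normp_le x M : (`|x| <= M) = (`|x.1| <= M) && (`|x.2| <= M).
Proof. by rewrite prod_normE num_ge_max. Qed.

Lemma normp_ge1 x : `|x.1| <= `|x|.
Proof. by have := lexx `|x|; rewrite normp_le => /andP[]. Qed.

Lemma normp_ge2 x : `|x.2| <= `|x|.
Proof. by have := lexx `|x|; rewrite normp_le => /andP[]. Qed.

Definition box M : set (R * R) := [set x | `|x| <= M].

Lemma boxE M : box M = `[- M, M]%classic `*` `[- M, M]%classic.
Proof.
apply/seteqP; split=> x /=; rewrite /box/= normp_le !in_itv/= !ler_norml.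
  by move=> /andP.
by move=> [-> ->].
Qed.

Lemma box_compact M : compact (box M).
Proof. by rewrite boxE; apply: compact_setX; exact: segment_compact. Qed.

Lemma box_measurable M : measurable (box M : set T2).
Proof. by rewrite boxE; apply: measurableX. Qed.

Lemma test_functionP u :
  test_function u <-> smooth u /\ exists M, vanishes_off M u.
Proof.
split=> -[su].
  move=> /compact_bounded [M [_ hM]]; split=> //.
  exists (M + 1) => x Mx; apply/eqP; apply: contraTT Mx => ux.
  by rewrite -leNgt; apply: (hM (M + 1)); [rewrite ltrDl|exact: subset_closure].
move=> [M hM]; split=> //.
apply: (@subclosed_compact _ _ (box M)); [exact: closed_closure|exact: box_compact|].
have cb : closed (box M).
  have -> : box M = (fun x : R * R => `|x|) @^-1` [set y | y <= M] by [].
  apply: closed_comp; last exact: closed_le.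
  by move=> x _; exact: norm_continuous.
rewrite [X in _ `<=` X](closure_id _).1//; apply: closure_subset => x /= ux.
by rewrite /box/= leNgt; apply: contra ux => /hM ->.
Qed.

Lemma cont_vanishes_bounded M u : continuous u -> vanishes_off M u ->
  exists2 c, 0 <= c & forall x, `|u x| <= c.
Proof.
move=> cu hM.
have : compact (u @` box M).
  by apply: continuous_compact; [exact: continuous_subspaceT|exact: box_compact].
move=> /compact_bounded [c [_ hc]].
exists (`|c| + 1) => [|x]; first by rewrite addr_ge0.
have [xM|/hM ->] := leP `|x| M; last by rewrite normr0 addr_ge0.
by apply: (hc (`|c| + 1)); [have := ler_norm c; lra|exists x].
Qed.

Lemma leb2_box_fin M : (leb2 (box M) < +oo)%E.
Proof.
rewrite boxE leb2_prod// lebesgue_measure_itv/=.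
by case: ifP => _; rewrite -?EFinB -?EFinM ?mul0e ltry.
Qed.

Lemma integ_indic (A : set (R * R)) : measurable (A : set T2) ->
  (leb2 A < +oo)%E -> integ (\1_A).
Proof.
move=> mA fA; apply/integrableP; split.
  by apply/measurable_EFinP; exact: mfun2_indic.
rewrite (_ : (fun x => _) = (fun x => (\1_A x)%:E)).
  by rewrite integral_indic// setIT.
by apply/funext => x /=; rewrite ger0_norm// indicE.
Qed.

Lemma csupp_integ M c u : mfun2 u -> vanishes_off M u -> (forall x, `|u x| <= c) ->
  integ u.
Proof.
move=> mu' hM uc; apply: (@integ_le _ _ (fun x => c * \1_(box M) x)) => //.
- move=> x; rewrite indicE; have [xM|xM] := leP `|x| M.
    by rewrite mem_set// mulr1.
  by rewrite hM// normr0 memNset ?mulr0// /box/= leNgt xM.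
- by apply: integZ; apply: integ_indic; [exact: box_measurable|exact: leb2_box_fin].
Qed.

Lemma csupp_sqint M c u : mfun2 u -> vanishes_off M u -> (forall x, `|u x| <= c) ->
  sqint u.
Proof.
move=> mu' hM uc; split=> //; apply: (@csupp_integ M (c ^+ 2)).
- exact: (mfun2X 2 mu').
- by move=> x /hM ->; rewrite expr0n.
- by move=> x; rewrite normrX lerXn2r ?nnegrE// (le_trans _ (uc x)).
Qed.

Lemma is_derive_section1 F x : is_derive x (basis_vec false) F (partial false F x) ->
  is_derive x.1 1 (fun s : R => F (s, x.2)) (partial false F x).
Proof.
move=> [dF dE].
have E : (fun h : R => h^-1 *: ((F \o shift x) (h *: basis_vec false) - F x)) =
  (fun h : R => h^-1 *: (((fun s : R => F (s, x.2)) \o shift x.1) (h *: (1 : R)) - F (x.1, x.2))).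
  apply/funext => h /=; congr (_ *: (F _ - F _)); last by case: x {dF dE}.
  by case: x {dF dE} => a b /=; congr (_, _); rewrite /= /GRing.scale/= mulr0 add0r.
by split; [rewrite /derivable -E|rewrite /derive -E].
Qed.

Lemma is_derive_section2 F x : is_derive x (basis_vec true) F (partial true F x) ->
  is_derive x.2 1 (fun s : R => F (x.1, s)) (partial true F x).
Proof.
move=> [dF dE].
have E : (fun h : R => h^-1 *: ((F \o shift x) (h *: basis_vec true) - F x)) =
  (fun h : R => h^-1 *: (((fun s : R => F (x.1, s)) \o shift x.2) (h *: (1 : R)) - F (x.1, x.2))).
  apply/funext => h /=; congr (_ *: (F _ - F _)); last by case: x {dF dE}.
  by case: x {dF dE} => a b /=; congr (_, _); rewrite /= /GRing.scale/= mulr0 add0r.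
by split; [rewrite /derivable -E|rewrite /derive -E].
Qed.

(** The integral over a long interval is a difference of boundary values,
   which vanish. *)
Lemma integral_derive0 (G g : R -> R) M : (forall s : R, is_derive s 1 G (g s)) ->
  continuous g -> (forall s : R, M < `|s| -> G s = 0 /\ g s = 0) ->
  (\int[mu]_x (g x)%:E = 0)%E.
Proof.
move=> dG cg hM; pose N := `|M| + 1.
have MN : M < N by rewrite /N; have := ler_norm M; lra.
have N0 : 0 < N by rewrite /N ltr_wpDl.
have GN : G N = 0 by apply: (hM _ _).1; rewrite gtr0_norm.
have GNN : G (- N) = 0 by apply: (hM _ _).1; rewrite normrN gtr0_norm.
have cG : continuous G.
  move=> x; apply: differentiable_continuous; apply/derivable1_diffP.
  by have [] := dG x.
have := @continuous_FTC2 R g G (- N) N.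
rewrite GN GNN subee// => <-; first last.
- by move=> x _; rewrite derive1E; have [] := dG x.
- split; first by move=> x _; have [] := dG x.
  + by apply: cvg_at_right_filter; exact: cG.
  + by apply: cvg_at_left_filter; exact: cG.
- exact: continuous_subspaceT.
- lra.
rewrite [RHS]integral_mkcond; apply: eq_integral => x _; rewrite patchE.
case: ifPn => // /negP xN; rewrite (hM x _).2//.
apply: lt_le_trans MN _; rewrite leNgt; apply/negP => xN'; apply: xN.
by rewrite inE/= in_itv/= -ler_norml ltW.
Qed.

Lemma section1_cont F (b : R) : continuous F -> continuous (fun s : R => F (s, b)).
Proof.
move=> cF s; apply: (@continuous_comp _ _ _ (fun s : R => (s, b)) F); last exact: cF.
exact: (cvg_pair cvg_id (cvg_cst b)).
Qed.

Lemma section2_cont F (a : R) : continuous F -> continuous (fun s : R => F (a, s)).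
Proof.
move=> cF s; apply: (@continuous_comp _ _ _ (fun s : R => (a, s)) F); last exact: cF.
exact: (cvg_pair (cvg_cst a) cvg_id).
Qed.

Lemma vanishes_partial M F i : Cn 1 F -> vanishes_off M F -> vanishes_off M (partial i F).
Proof.
move=> CF hM x Mx; rewrite /partial -[RHS](derive_cst 0 x (basis_vec i)).
apply: near_eq_derive; have : open ((fun y : R * R => `|y|) @^-1` [set r | M < r]).
  by apply: open_comp; [move=> y _; exact: norm_continuous|exact: open_gt].
rewrite openE => /(_ x Mx); apply: filterS => y; exact: hM.
Qed.

Lemma Int_partial0 M F i : Cn 1 F -> vanishes_off M F -> Int (partial i F) = 0.
Proof.
move=> CF hM.
have hd := vanishes_partial i CF hM.
have cd : continuous (partial i F) by exact: (Cn_cont (Cn_partial i CF)).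
have [c c0 hc] := cont_vanishes_bounded cd hd.
have id : integ (partial i F) := csupp_integ (cont_mfun2 cd) hd hc.
apply/EFin_inj; rewrite EFin_Int//; case: i hd cd hc id => hd cd hc id.
- rewrite -(integral12_prod_meas1 id) /fubini_F.
  rewrite (eq_integral (cst 0)) ?integral0// => a _ /=.
  apply: (@integral_derive0 (fun s => F (a, s)) _ M).
  + by move=> s; exact: (@is_derive_section2 F (a, s) (Cn_derive true _ CF)).
  + exact: section2_cont.
  + move=> s Ms; have : M < `|(a, s)| by apply: lt_le_trans Ms (normp_ge2 (a, s)).
    by move=> Mas; split; [exact: hM|exact: hd].
- rewrite -(integral21_prod_meas1 id) /fubini_G.
  rewrite (eq_integral (cst 0)) ?integral0// => b _ /=.
  apply: (@integral_derive0 (fun s => F (s, b)) _ M).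
  + by move=> s; exact: (@is_derive_section1 F (s, b) (Cn_derive false _ CF)).
  + exact: section1_cont.
  + move=> s Ms; have : M < `|(s, b)| by apply: lt_le_trans Ms (normp_ge1 (s, b)).
    by move=> Mas; split; [exact: hM|exact: hd].
Qed.

Lemma partialM i u v : Cn 1 u -> Cn 1 v ->
  partial i (fun x => u x * v x) = (fun x => u x * partial i v x + v x * partial i u x).
Proof.
move=> Cu Cv; apply/funext => x.
have := Cn_derive i x Cu; have := Cn_derive i x Cv => ? ?.
by have [] := is_deriveM (df := partial i u x) (dg := partial i v x).
Qed.

Lemma partialD i u v : Cn 1 u -> Cn 1 v ->
  partial i (fun x => u x + v x) = (fun x => partial i u x + partial i v x).
Proof.
move=> Cu Cv; apply/funext => x.
have := Cn_derive i x Cu; have := Cn_derive i x Cv => ? ?.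
by have [] := is_deriveD (df := partial i u x) (dg := partial i v x).
Qed.

Lemma csupp_cont_integ M u : continuous u -> vanishes_off M u -> integ u.
Proof.
move=> cu hM; have [c c0 hc] := cont_vanishes_bounded cu hM.
exact: csupp_integ (cont_mfun2 cu) hM hc.
Qed.

Lemma csupp_cont_sqint M u : continuous u -> vanishes_off M u -> sqint u.
Proof.
move=> cu hM; have [c c0 hc] := cont_vanishes_bounded cu hM.
exact: csupp_sqint (cont_mfun2 cu) hM hc.
Qed.

Lemma contM u v : continuous u -> continuous v -> continuous (fun x => u x * v x).
Proof. by move=> cu cv x; apply: cvgM; [exact: cu|exact: cv]. Qed.

Lemma integration_by_parts2 M u t i : Cn 1 u -> Cn 1 t -> vanishes_off M t ->
  Int (fun x => u x * partial i t x) = - Int (fun x => partial i u x * t x).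
Proof.
move=> Cu Ct hM; have hd := vanishes_partial i Ct hM.
have := @Int_partial0 M _ i (CnM Cu Ct).
rewrite partialM// => /(_ _)H; apply/eqP; rewrite -addr_eq0 -IntD.
- rewrite -[X in _ == X]H; last by move=> x /hM ->; rewrite mulr0.
  by apply/eqP; apply: eq_Int => x; rewrite [partial i u x * _]mulrC.
- apply: (@csupp_cont_integ M).
    by apply: contM; [exact: Cn_cont Cu|exact: (Cn_cont (Cn_partial i Ct))].
  by move=> x /hd ->; rewrite mulr0.
- apply: (@csupp_cont_integ M).
    by apply: contM; [exact: (Cn_cont (Cn_partial i Cu))|exact: Cn_cont Ct].
  by move=> x /hM ->; rewrite mulr0.
Qed.
End Test_functions.

(** * Integrals over boxes determine a function almost everywhere *)

Section Fundamental_lemma.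
Context {R : realType}.
Implicit Types (f g h t u v F : R * R -> R) (M a b c d : R) (x z : R * R) (i : bool).
Local Notation T1 := (measurableTypeR R).
Local Notation T2 := (measurableTypeR R * measurableTypeR R)%type.

Lemma integ_indicM (A : set (R * R)) f : measurable (A : set T2) -> integ f ->
  integ (fun x => \1_A x * f x).
Proof.
move=> mA; apply: (@integM _ _ _ 1); first exact: mfun2_indic.
by move=> x; rewrite indicE; case: (_ \in _); rewrite ?normr1 ?normr0.
Qed.

Lemma cvg_indicM (A : nat -> set (R * R)) f : nondecreasing_seq A ->
  (forall n, measurable (A n : set T2)) -> integ f ->
  Int (fun x => \1_(A n) x * f x) @[n --> \oo] --> Int (fun x => \1_(\bigcup_n A n) x * f x).
Proof.
move=> ndA mA hf; apply: (@Int_dominated _ _ _ (fun x => `|f x|)).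
- by move=> n; exact: integ_mfun (integ_indicM (mA n) hf).
- by apply: (integ_mfun (integ_indicM _ hf)); exact: bigcupT_measurable.
- move=> x; apply: cvgM; last exact: cvg_cst.
  have [[n _ Anx]|nA] := pselect ((\bigcup_n A n) x).
    apply: cvg_near_cst; exists n => // m /= nm.
    have /subsetPset nAm := ndA _ _ nm.
    by rewrite !indicE !mem_set//; [exists n|exact: nAm].
  apply: cvg_near_cst; apply: nearW => n; rewrite !indicE !memNset// => Anx.
  by apply: nA; exists n.
- exact: integ_abs.
- move=> n x; rewrite normrM ler_piMl// indicE.
  by case: (_ \in _); rewrite ?normr1 ?normr0.
Qed.

(** S is the product with a fixed set on one side, or the identity on sets of
   the plane; in each case the conclusion extends the vanishing of the
   integral from a generating family to all measurable sets. *)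
Lemma null_set_lambda (T : Type) (S : set T -> set (R * R)) f : integ f ->
  (forall A B, S (A `\` B) = S A `\` S B) ->
  (forall A B, A `<=` B -> S A `<=` S B) ->
  (forall F : (set T)^nat, S (\bigcup_n F n) = \bigcup_n S (F n)) ->
  let H := [set A | measurable (S A : set T2) /\ Int (fun x => \1_(S A) x * f x) = 0] in
  H setT -> lambda_system setT H.
Proof.
move=> hf SD SS SU H HT; split => //.
- move=> A B BA [mA A0] [mB B0]; rewrite /H/= SD; split; first exact: measurableD.
  have -> : (fun x => \1_(S A `\` S B) x * f x) =
      (fun x => \1_(S A) x * f x - \1_(S B) x * f x).
    apply/funext => x; rewrite -mulrBl; congr (_ * _); rewrite !indicE in_setD.
    case: (boolP (x \in S B)) => /= xB; last by rewrite andbT subr0.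
    by rewrite andbF mem_set ?subrr//; apply: SS BA _ _; exact: set_mem xB.
  by rewrite IntB ?A0 ?B0 ?subrr//; exact: integ_indicM.
- move=> F ndF HF; rewrite /H/= SU; split.
    by apply: bigcupT_measurable => n; have [] := HF n.
  have ndS : nondecreasing_seq (fun n => S (F n)).
    by move=> n m nm; apply/subsetPset; apply: SS; apply/subsetPset; exact: ndF.
  have := cvg_indicM ndS (fun n => (HF n).1) hf.
  have -> : (fun n => Int (fun x => \1_(S (F n)) x * f x)) = (fun=> 0).
    by apply/funext => n; have [] := HF n.
  by move=> /(cvg_lim (@Rhausdorff R)) <-; rewrite lim_cst.
Qed.

Lemma bigcup_ocitv : \bigcup_n `](- n%:R), n%:R]%classic = [set: R].
Proof.
apply/seteqP; split=> // s _; have [n hn] : exists n : nat, `|s| < n%:R.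
  exists (Num.truncn `|s|).+1; exact: truncnS_gt.
by exists n => //=; rewrite in_itv/=; move: hn; rewrite ltr_norml => /andP[-> /ltW].
Qed.

Lemma nondecreasing_ocitv : nondecreasing_seq (fun n : nat => `](- n%:R), n%:R]%classic : set R).
Proof.
move=> n m nm; apply/subsetPset => s /=; rewrite !in_itv/= => /andP[h1 h2].
have nm' : n%:R <= m%:R :> R by rewrite ler_nat.
by apply/andP; split; lra.
Qed.

Lemma Int_indicU0 (A : nat -> set (R * R)) f : nondecreasing_seq A ->
  (forall n, measurable (A n : set T2)) -> integ f ->
  (forall n, Int (fun x => \1_(A n) x * f x) = 0) ->
  Int (fun x => \1_(\bigcup_n A n) x * f x) = 0.
Proof.
move=> ndA mA hf A0; have := cvg_indicM ndA mA hf.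
have -> : (fun n => Int (fun x => \1_(A n) x * f x)) = (fun=> 0) by apply/funext.
by move=> /(cvg_lim (@Rhausdorff R)) <-; rewrite lim_cst.
Qed.

(** Half-open boxes form a pi-system that generates the measurable sets, so a
   function with vanishing integrals over them is 0 almost everywhere. *)
Lemma Int_boxes0 f : integ f ->
  (forall A B : set R, ocitv A -> ocitv B -> Int (fun x => \1_(A `*` B) x * f x) = 0) ->
  aeeq f (fun=> 0).
Proof.
move=> hf hbox.
have moc (A : set T1) : ocitv A -> measurable A by exact: sub_sigma_algebra.
have mA1 (A : set T1) : measurable A -> forall B : set R, ocitv B ->
    Int (fun x => \1_((A : set R) `*` B) x * f x) = 0.
  move=> mA B oB; pose S (A : set T1) : set (R * R) := A `*` B.
  have SU (F : (set T1)^nat) : S (\bigcup_n F n) = \bigcup_n S (F n).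
    by apply/seteqP; split => [x [[n _ Fx] Bx]|x [n _ [Fx Bx]]]; [exists n|split => //; exists n].
  have mSB (A' : set T1) : measurable A' -> measurable (S A' : set T2).
    by move=> mA'; apply: measurableX => //; exact: moc.
  have := @lambda_system_subset T1 (@ocitv R) (@ocitvI R) setT
    [set A | measurable (S A : set T2) /\ Int (fun x => \1_(S A) x * f x) = 0].
  move=> /(_ _ _ _) H; have [] // := H _ _ _ A mA; last first.
  - by move=> A' oA'; split; [by apply: mSB; apply: moc|exact: hbox].
  - apply: (null_set_lambda hf) => //.
    + move=> A' B'; apply/seteqP; split => [x [[Ax nB] Bx]|x [[Ax Bx] nB]].
        by split=> // -[].
      by split=> //; split=> // B'x; apply: nB.
    + by move=> A' B' AB x [/AB].
    + split; first by apply: mSB.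
      rewrite -(bigcup_ocitv) SU; apply: Int_indicU0 => //.
      * move=> n m nm; apply/subsetPset => x [Ax Bx]; split=> //.
        by have /subsetPset := nondecreasing_ocitv nm; apply.
      * by move=> n; apply: mSB; apply: moc; exact: is_ocitv.
      * by move=> n; apply: hbox => //; exact: is_ocitv.
have mA2 (A B : set T1) : measurable A -> measurable B ->
    Int (fun x => \1_((A : set R) `*` (B : set R)) x * f x) = 0.
  move=> mA mB; pose S (B : set T1) : set (R * R) := A `*` B.
  have SU (F : (set T1)^nat) : S (\bigcup_n F n) = \bigcup_n S (F n).
    by apply/seteqP; split => [x [Ax [n _ Fx]]|x [n _ [Fx Bx]]]; [exists n|split => //; exists n].
  have mSB (B' : set T1) : measurable B' -> measurable (S B' : set T2).
    by move=> mB'; apply: measurableX.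
  have := @lambda_system_subset T1 (@ocitv R) (@ocitvI R) setT
    [set A | measurable (S A : set T2) /\ Int (fun x => \1_(S A) x * f x) = 0].
  move=> /(_ _ _ _) H; have [] // := H _ _ _ B mB; last first.
  - by move=> A' oA'; split; [by apply: mSB; apply: moc|exact: mA1].
  - apply: (null_set_lambda hf) => //.
    + move=> A' B'; apply/seteqP; split => [x [Ax [Bx nB]]|x [[Ax Bx] nB]].
        by split=> // -[].
      by split=> //; split=> // B'x; apply: nB.
    + by move=> A' B' AB x [Ax /AB].
    + split; first by apply: mSB.
      rewrite -(bigcup_ocitv) SU; apply: Int_indicU0 => //.
      * move=> n m nm; apply/subsetPset => x [Ax Bx]; split=> //.
        by have /subsetPset := nondecreasing_ocitv nm; apply.
      * by move=> n; apply: mSB; apply: moc; exact: is_ocitv.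
      * by move=> n; apply: mA1 => //; exact: is_ocitv.
have mA3 (A : set T2) : measurable A -> Int (fun x => \1_A x * f x) = 0.
  move=> mA.
  have := @lambda_system_subset T2 [set A `*` B | A in measurable & B in measurable]
    _ setT [set A | measurable (A : set T2) /\ Int (fun x => \1_A x * f x) = 0].
  move=> /(_ _ _ _ _) H; have [] // := H _ _ _ _ A.
  - move=> _ _ [A1 mA1' [B1 mB1 <-]] [A2' mA2' [B2 mB2 <-]].
    rewrite -setXI; exists (A1 `&` A2'); first exact: measurableI.
    by exists (B1 `&` B2) => //; exact: measurableI.
  - apply: (@null_set_lambda _ id) => //=; split=> //.
    rewrite -setXTT; exact: mA2.
  - by move=> _ [A1 mA1' [B1 mB1 <-]]; split; [exact: measurableX|exact: mA2].
  - by rewrite -measurable_prod_measurableType.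
have H : ae_eq (@leb2 R) setT (EFin \o f) (cst 0%E).
  apply: (@integral_ae_eq _ _ _ (@leb2 R) setT measurableT (cst 0%E) (EFin \o f)).
  - exact: hf.
  - exact: measurable_cst.
  move=> E _ mE; rewrite integral0; have := mA3 E mE.
  have iE := integ_indicM mE hf.
  move=> E0; transitivity ((Int (fun x => \1_E x * f x))%:E); last by rewrite E0.
  rewrite EFin_Int//.
  rewrite integral_mkcond; apply: eq_integral => x _.
  by rewrite patchE indicE; case: (_ \in _); rewrite ?mul1r ?mul0r.
by apply: ae2S H => x /(_ I) [].
Qed.
End Fundamental_lemma.

(** * Weak gradients *)

Section Weak_derivatives.
Context {R : realType}.
Implicit Types (f h t u v F : R * R -> R) (g : bool -> R * R -> R)
  (M a b c d e s : R) (x z : R * R) (i : bool) (n k : nat).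
Local Notation T1 := (measurableTypeR R).
Local Notation T2 := (measurableTypeR R * measurableTypeR R)%type.

(** Smooth functions that converge pointwise, without exception, to the
   indicator of the half-open interval ]a, b]. *)
Definition plateau n a b s : R :=
  step (n.+1%:R * s + - (n.+1%:R * a)) * step (- n.+1%:R * s + (1 + n.+1%:R * b)).

Lemma plateau_ge0 n a b s : 0 <= plateau n a b s.
Proof. by rewrite mulr_ge0// step_ge0. Qed.

Lemma plateau_le1 n a b s : plateau n a b s <= 1.
Proof. by rewrite mulr_ile1// ?step_ge0// step_le1. Qed.

Lemma plateau_off n a b s : s <= a \/ b + 1 <= s -> plateau n a b s = 0.
Proof.
rewrite /plateau; have n0 : 1 <= n.+1%:R :> R by rewrite ler1n.
move=> [sa|bs]; first by rewrite step_le0 ?mul0r//; nra.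
by rewrite [X in _ * X]step_le0 ?mulr0//; nra.
Qed.

Lemma plateau_cvg a b s : plateau n a b s @[n --> \oo] --> (\1_(`]a, b]%classic : set R) s : R).
Proof.
rewrite indicE; have [sa|sa] := leP s a.
  rewrite memNset; last by rewrite /= in_itv/= ltNge sa.
  by apply: cvg_near_cst; apply: nearW => n; apply: plateau_off; left.
have [sb|sb] := leP s b.
  rewrite mem_set; last by rewrite /= in_itv/= sa sb.
  apply: cvg_near_cst; near=> n; rewrite /plateau !step_ge1 ?mulr1//.
    suff : 0 <= n.+1%:R :> R by nra.
    exact: ler0n.
  have : (s - a)^-1 <= n.+1%:R.
    near: n; exists (Num.truncn (s - a)^-1) => // m /= hm.
    by apply: ltW; apply: lt_le_trans (truncnS_gt _) _; rewrite ler_nat ltnS.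
  have sa0 : 0 < s - a by rewrite subr_gt0.
  by rewrite -(ler_pM2r sa0 (s - a)^-1) mulVf ?gt_eqF// => ?; lra.
rewrite memNset; last by rewrite /= in_itv/= sa leNgt sb.
apply: cvg_near_cst; near=> n; rewrite /plateau [X in _ * X]step_le0 ?mulr0//.
have : (s - b)^-1 <= n.+1%:R.
  near: n; exists (Num.truncn (s - b)^-1) => // m /= hm.
  by apply: ltW; apply: lt_le_trans (truncnS_gt _) _; rewrite ler_nat ltnS.
have sb0 : 0 < s - b by rewrite subr_gt0.
by rewrite -(ler_pM2r sb0 (s - b)^-1) mulVf ?gt_eqF// => ?; lra.
Unshelve. all: by end_near. Qed.

Definition box_bump n a b c d x : R := plateau n a b x.1 * plateau n c d x.2.

Lemma Cn_plateau1 k n a b : Cn k (fun x : R * R => plateau n a b x.1).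
Proof. by apply: CnM; exact: Cn_step1. Qed.

Lemma Cn_plateau2 k n a b : Cn k (fun x : R * R => plateau n a b x.2).
Proof. by apply: CnM; exact: Cn_step2. Qed.

Lemma Cn_bump k n a b c d : Cn k (box_bump n a b c d).
Proof. by apply: CnM; [exact: Cn_plateau1|exact: Cn_plateau2]. Qed.

Lemma bump_ge0 n a b c d x : 0 <= box_bump n a b c d x.
Proof. by rewrite mulr_ge0// plateau_ge0. Qed.

Lemma bump_le1 n a b c d x : box_bump n a b c d x <= 1.
Proof. by rewrite mulr_ile1// ?plateau_ge0// plateau_le1. Qed.

Lemma bump_vanishes n a b c d :
  vanishes_off (`|a| + `|b| + `|c| + `|d| + 1) (box_bump n a b c d).
Proof.
move=> x; rewrite ltNge => /negP Mx; rewrite /box_bump.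
have [h|/not_orP[h1 h2]] := pselect (x.1 <= a \/ b + 1 <= x.1).
  by rewrite plateau_off// mul0r.
have [h|/not_orP[h3 h4]] := pselect (x.2 <= c \/ d + 1 <= x.2).
  by rewrite [X in _ * X]plateau_off// mulr0.
exfalso; apply: Mx; rewrite normp_le; move/negP: h1; move/negP: h2; move/negP: h3; move/negP: h4.
rewrite -!ltNge => h4 h3 h2 h1.
have := ler_norm a; have := ler_norm b; have := ler_norm c; have := ler_norm d.
have := ler_norm (- a); have := ler_norm (- b); have := ler_norm (- c); have := ler_norm (- d).
rewrite !normrN => *.
have := normr_ge0 a; have := normr_ge0 b; have := normr_ge0 c; have := normr_ge0 d => *.
by apply/andP; split; rewrite ler_norml; apply/andP; split; lra.
Qed.

Lemma test_bump n a b c d : test_function (box_bump n a b c d).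
Proof.
apply/test_functionP; split; first by move=> k; exact: Cn_bump.
by eexists; exact: bump_vanishes.
Qed.

Lemma indic_prod (A B : set R) x : \1_(A `*` B) x = \1_A x.1 * \1_B x.2 :> R.
Proof.
rewrite !indicE -natrM mulnb; congr (_%:R); congr nat_of_bool.
by apply/idP/andP => [/set_mem[/mem_set ? /mem_set ?]|[/set_mem ? /set_mem ?]] //; exact: mem_set.
Qed.

Lemma cvg_bump a b c d x : box_bump n a b c d x @[n --> \oo] -->
  (\1_(`]a, b]%classic `*` `]c, d]%classic) x : R).
Proof.
rewrite indic_prod; apply: cvgM; exact: plateau_cvg.
Qed.

(** Letting n tend to infinity turns integrals against bumps into integrals
   over boxes. *)
Lemma ae_eq0_bump_loc f : mfun2 f -> (forall M, integ (fun x => \1_(box M) x * f x)) ->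
  (forall n a b c d, Int (fun x => f x * box_bump n a b c d x) = 0) -> aeeq f (fun=> 0).
Proof.
move=> mf hf h0.
have hoc (A B : set R) : ocitv A -> ocitv B -> Int (fun x => \1_(A `*` B) x * f x) = 0.
  move=> [[a b]] _ <- [[c d]] _ <- /=.
  pose M := `|a| + `|b| + `|c| + `|d| + 1.
  have : Int (fun x => f x * box_bump n a b c d x) @[n --> \oo] -->
      Int (fun x => \1_(`]a, b]%classic `*` `]c, d]%classic) x * f x).
    apply: (@Int_dominated _ _ _ (fun x => `|\1_(box M) x * f x|)).
    - by move=> n; apply: mfun2M => //; apply: cont_mfun2; exact: (@Cn_bump 0).
    - by apply: mfun2M => //; apply: mfun2_indic; apply: measurableX.
    - by move=> x; rewrite mulrC; apply: cvgM; [exact: cvg_cst|exact: cvg_bump].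
    - by apply: integ_abs; exact: hf.
    - move=> n x; rewrite (normrM (f x)) [leRHS]normrM mulrC ler_wpM2r// indicE.
      have [xM|xM] := leP `|x| M; last by rewrite bump_vanishes// normr0.
      by rewrite mem_set// normr1 ger0_norm ?bump_ge0// bump_le1.
  under eq_cvg do rewrite h0.
  by move=> /(cvg_lim (@Rhausdorff R)) <-; rewrite lim_cst.
pose K (N : nat) : set R := `](- N%:R), N%:R]%classic.
have oK N : ocitv (K N) by exact: is_ocitv.
have h N : aeeq (fun x => \1_(K N `*` K N) x * f x) (fun=> 0).
  apply: Int_boxes0.
    have mK : measurable (K N `*` K N : set T2) by apply: measurableX; exact: measurable_itv.
    have := integ_indicM mK (hf N%:R).
    suff -> : (fun x => \1_(K N `*` K N) x * (\1_(box N%:R) x * f x)) =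
       (fun x => \1_(K N `*` K N) x * f x) by [].
    apply/funext => x; rewrite mulrA; congr (_ * _); rewrite !indicE.
    case: (boolP (x \in K N `*` K N)) => [/set_mem[]|]; last by rewrite mul0r.
    rewrite /K/= !in_itv/= => /andP[? ?] /andP[? ?]; rewrite mul1r mem_set//.
    by rewrite /box/= normp_le !ler_norml; apply/andP; split; apply/andP; split => //; exact: ltW.
  move=> A B oA oB; rewrite -[RHS](@hoc (A `&` K N) (B `&` K N)); [|exact: ocitvI|exact: ocitvI].
  by apply: eq_Int => x; rewrite setXI indicI mulrA.
have := ae_foralln h; apply: ae2S => x /= hx.
have [n hn] : exists n : nat, `|x| < n%:R.
  exists (Num.truncn `|x|).+1; exact: truncnS_gt.
have := hx n; rewrite indicE mem_set ?mul1r//; split; rewrite /K/= in_itv/=.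
  by have := le_lt_trans (normp_ge1 x) hn; rewrite ltr_norml => /andP[-> /ltW].
by have := le_lt_trans (normp_ge2 x) hn; rewrite ltr_norml => /andP[-> /ltW].
Qed.

Lemma sqint_indic_box M : sqint (\1_(box M)).
Proof.
apply: (@csupp_sqint _ M 1); first by apply: mfun2_indic; exact: box_measurable.
  by move=> x Mx; rewrite indicE memNset// /box/= leNgt Mx.
by move=> x; rewrite indicE; case: (_ \in _); rewrite ?normr1 ?normr0.
Qed.

Lemma ae_eq0_bump f : sqint f ->
  (forall n a b c d, Int (fun x => f x * box_bump n a b c d x) = 0) -> aeeq f (fun=> 0).
Proof.
move=> hf; apply: ae_eq0_bump_loc; first exact: sqint_mfun.
by move=> M; apply: integ_mul => //; exact: sqint_indic_box.
Qed.

Lemma test_smooth t k : test_function t -> Cn k t.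
Proof. by move=> /test_functionP[]. Qed.

Lemma test_partial t i : test_function t -> test_function (partial i t).
Proof.
move=> /test_functionP[st [M hM]]; apply/test_functionP; split.
  by move=> k; apply: Cn_partial; exact: st.
by exists M; exact: vanishes_partial.
Qed.

Lemma testM h t : smooth h -> test_function t -> test_function (fun x => h x * t x).
Proof.
move=> sh /test_functionP[st [M hM]]; apply/test_functionP; split.
  by move=> k; exact: CnM.
by exists M => x /hM ->; rewrite mulr0.
Qed.

Lemma test_cont t : test_function t -> continuous t.
Proof. exact: (@test_smooth t 0). Qed.

Lemma test_sqint t : test_function t -> sqint t.
Proof.
move=> tt; have /test_functionP[st [M hM]] := tt.
exact: csupp_cont_sqint (test_cont tt) hM.
Qed.

Lemma test_integ_mul u t : sqint u -> test_function t -> integ (fun x => u x * t x).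
Proof. by move=> hu /test_sqint; exact: integ_mul. Qed.

Lemma test_affine t e z : 0 < e -> test_function t -> test_function (t \o affmap e z).
Proof.
move=> e0 /test_functionP[st [M hM]]; apply/test_functionP; split.
  by move=> k; exact: Cn_affine.
exists ((M + `|z|) / e) => x; rewrite ltr_pdivrMr// => Mx; apply: hM; rewrite /affmap.
have : `|e *: x| <= `|e *: x + z| + `|z|.
  by rewrite -{1}(addrK z (e *: x)); exact: ler_normB.
by rewrite normrZ gtr0_norm// => ?; lra.
Qed.

Lemma weak_partialE i u f : weak_partial i u f <->
  (forall t, test_function t -> Int (fun x => u x * partial i t x) = - Int (fun x => f x * t x)).
Proof. by []. Qed.

Lemma weak_partial_unique i u f f' : sqint f -> sqint f' ->
  weak_partial i u f -> weak_partial i u f' -> aeeq f f'.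
Proof.
move=> hf hf' wf wf'.
have : aeeq (fun x => f x - f' x) (fun=> 0).
  apply: ae_eq0_bump; first exact: sqintB.
  move=> n a b c d; have tb := test_bump n a b c d.
  rewrite (@eq_Int _ _ (fun x => f x * box_bump n a b c d x - f' x * box_bump n a b c d x)); last first.
    by move=> x; rewrite mulrBl.
  rewrite IntB; [|exact: test_integ_mul|exact: test_integ_mul].
  have := wf _ tb; rewrite (wf' _ tb) => /oppr_inj E.
  by apply/eqP; rewrite subr_eq0; apply/eqP; exact: esym.
by apply: ae2S => x /eqP; rewrite subr_eq0 => /eqP.
Qed.

Definition has_grad u g := forall i, sqint (g i) /\ weak_partial i u (g i).
Definition gsq g x : R := g false x ^+ 2 + g true x ^+ 2.

Lemma has_grad_sqint u g i : has_grad u g -> sqint (g i).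
Proof. by move=> /(_ i)[]. Qed.

Lemma H1P u : H1 u <-> sqint u /\ exists g, has_grad u g.
Proof.
split=> [[/Lfun_sqint hu hg]|[hu [g hg]]].
  split=> //; have [g0 /Lfun_sqint h0 w0] := hg false; have [g1 /Lfun_sqint h1 w1] := hg true.
  by exists (fun i => if i then g1 else g0); case.
split; first exact/Lfun_sqint.
by move=> i; exists (g i); [apply/Lfun_sqint|]; have [] := hg i.
Qed.

(** The derivative picked by xget has the expected properties as soon as one
   exists. *)
Lemma wpartialP u : H1 u -> has_grad u (wpartial^~ u).
Proof.
move=> [_ hu] i; rewrite /wpartial; have [g hg wg] := hu i.
have := @xgetPex _ (cst 0) [set g | g \in Lfun (@leb2 R) 2%:E /\ weak_partial i u g].
by move=> /(_ (ex_intro _ g (conj hg wg)))[/Lfun_sqint].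
Qed.

Lemma has_grad_unique u g g' i : has_grad u g -> has_grad u g' -> aeeq (g i) (g' i).
Proof.
by move=> /(_ i)[hg wg] /(_ i)[hg' wg']; exact: weak_partial_unique wg wg'.
Qed.

Lemma gsq_integ u g : has_grad u g -> integ (gsq g).
Proof. by move=> hg; apply: integD; exact: sqint_sqr (has_grad_sqint _ hg). Qed.

Lemma grad_sqE u x : grad_sq u x = gsq (wpartial^~ u) x.
Proof. by rewrite /grad_sq /gsq big_bool addrC. Qed.

Lemma gsq_unique u g g' : has_grad u g -> has_grad u g' -> aeeq (gsq g) (gsq g').
Proof.
move=> hg hg'; apply: ae2S2 (has_grad_unique false hg hg') (has_grad_unique true hg hg').
by move=> x; rewrite /gsq => -> ->.
Qed.

Lemma has_gradD u v g g' : sqint u -> sqint v -> has_grad u g -> has_grad v g' ->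
  has_grad (fun x => u x + v x) (fun i x => g i x + g' i x).
Proof.
move=> su sv hg hg' i; have [sg wg] := hg i; have [sg' wg'] := hg' i.
split; first exact: sqintD.
move=> t tt; have tp := test_partial i tt.
transitivity (Int (fun x => u x * partial i t x + v x * partial i t x)).
  by apply: eq_Int => x; rewrite mulrDl.
rewrite IntD; [|exact: test_integ_mul|exact: test_integ_mul].
rewrite [X in X + _](wg _ tt) [X in _ + X](wg' _ tt) -opprD; congr (- _).
rewrite -IntD; [|exact: test_integ_mul|exact: test_integ_mul].
by apply: eq_Int => x; rewrite mulrDl.
Qed.

Lemma has_gradZ c u g : sqint u -> has_grad u g ->
  has_grad (fun x => c * u x) (fun i x => c * g i x).
Proof.
move=> su hg i; have [sg wg] := hg i; split; first exact: sqintZ.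
move=> t tt; have tp := test_partial i tt.
transitivity (Int (fun x => c * (u x * partial i t x))).
  by apply: eq_Int => x; rewrite mulrA.
rewrite IntZ; last exact: test_integ_mul.
rewrite [X in _ * X](wg _ tt) mulrN; congr (- _).
rewrite -IntZ; last exact: test_integ_mul.
by apply: eq_Int => x; rewrite mulrA.
Qed.

(** Apply the definition of the weak derivative of u to h t, which is again a
   test function; square integrability of the new gradient is a hypothesis
   because h may be unbounded. *)
Lemma has_gradM h u g : smooth h -> sqint u -> has_grad u g ->
  (forall i, sqint (fun x => h x * g i x + u x * partial i h x)) ->
  has_grad (fun x => h x * u x) (fun i x => h x * g i x + u x * partial i h x).
Proof.
move=> sh su hg sM i; have [sg wg] := hg i; split => // t tt.
have tht := testM sh tt.
have thp : test_function (fun x => partial i h x * t x).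
  by apply: testM => // k; apply: Cn_partial; exact: sh.
have tp := test_partial i tt.
transitivity (Int (fun x => u x * partial i (fun y => h y * t y) x - u x * (partial i h x * t x))).
  apply: eq_Int => x; rewrite partialM; [|exact: sh|exact: (test_smooth 1 tt)].
  ring.
rewrite IntB; [|apply: test_integ_mul => //; exact: test_partial|exact: test_integ_mul].
rewrite [X in X - _](wg _ tht) -opprD; congr (- _).
rewrite -IntD; [|exact: test_integ_mul|exact: test_integ_mul].
by apply: eq_Int => x; ring.
Qed.

Lemma weak_partial_C1 i u : Cn 1 u -> weak_partial i u (partial i u).
Proof.
move=> Cu t tt; have /test_functionP[st [M hM]] := tt.
exact: (integration_by_parts2 i Cu (st 1) hM).
Qed.

Lemma has_grad_test t : test_function t -> has_grad t (partial^~ t).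
Proof.
move=> tt i; split; first exact/test_sqint/test_partial.
exact: weak_partial_C1 (test_smooth 1 tt).
Qed.

Lemma partial_affine i t e z : Cn 1 t ->
  partial i (t \o affmap e z) = (fun x => e * partial i t (affmap e z x)).
Proof.
move=> Ct; apply/funext => x.
by have [] := is_derive_affine (Cn_derive i (affmap e z x) Ct).
Qed.

Lemma affmapK e z x : e != 0 -> affmap e^-1 (- (e^-1 *: z)) (affmap e z x) = x.
Proof. by move=> e0; rewrite /affmap scalerDr scalerA mulVf// scale1r addrK. Qed.

Lemma sqint_affine u e z : 0 < e -> sqint u -> sqint (u \o affmap e z).
Proof.
move=> e0 [mu' u2]; have P := preserves_affine z e0; split.
  by have [_ mT _] := P; apply: measurableT_comp.
exact: (preserves_integ P u2).
Qed.

Lemma has_grad_affine u g e z : 0 < e -> sqint u -> has_grad u g ->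
  has_grad (u \o affmap e z) (fun i x => e * g i (affmap e z x)).
Proof.
move=> e0 su hg i; have [sg wg] := hg i; split.
  by apply: sqintZ; exact: sqint_affine.
move=> t tt; have P := preserves_affine z e0.
have e0' : 0 < e^-1 by rewrite invr_gt0.
pose s := t \o affmap e^-1 (- (e^-1 *: z)).
have ts : test_function s by exact: test_affine.
have tps := test_partial i ts.
have := wg _ ts; rewrite -[LHS]/(Int _) -[X in - X]/(Int _).
rewrite -(preserves_Int P (test_integ_mul su tps)) -(preserves_Int P (test_integ_mul sg ts)).
have -> : ((fun x => u x * partial i s x) \o affmap e z) =
   (fun x => e^-1 * ((u \o affmap e z) x * partial i t x)).
  apply/funext => x /=; rewrite partial_affine; last exact: test_smooth.
  by rewrite affmapK ?gt_eqF// mulrCA.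
have -> : ((fun x => g i x * s x) \o affmap e z) =
   (fun x => e^-1 * ((e * g i (affmap e z x)) * t x)).
  by apply/funext => x /=; rewrite /s/= affmapK ?gt_eqF// !mulrA mulVf ?gt_eqF// mul1r.
rewrite !IntZ; [|apply: test_integ_mul => //; apply: sqintZ; exact: sqint_affine
  |apply: test_integ_mul => //; [exact: sqint_affine|exact: test_partial]].
rewrite -mulrN -mulrN !mulrA.
by move=> /mulfI; apply; rewrite mulf_neq0// ?expf_neq0// ?invr_eq0 gt_eqF.
Qed.
End Weak_derivatives.

(** * Translation along a coordinate axis *)

Section Line_shift.
Context {R : realType}.
Implicit Types (f v t w g : R * R -> R) (M c d e s r h : R) (x z : R * R).
Local Notation T1 := (measurableTypeR R).
Local Notation T2 := (measurableTypeR R * measurableTypeR R)%type.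
Local Notation mu := (@lebesgue_measure R).

Lemma leb2_sigma_finite : sigma_finite [set: T2] (@leb2 R).
Proof.
exists (fun n => box n%:R).
  apply/seteqP; split=> // x _; exists (Num.truncn `|x|).+1 => //.
  by rewrite /box/=; apply: ltW; exact: truncnS_gt.
by move=> n; split; [exact: box_measurable|exact: leb2_box_fin].
Qed.

(** The plane's measure packed as a sigma-finite one, which Fubini's theorem
   asks for. *)
Definition leb2s : {sigma_finite_measure set T2 -> \bar R} :=
  HB.pack (@leb2 R : set T2 -> \bar R) (Measure.class (@leb2 R))
   (Measure_isSigmaFinite.Build _ _ _ (@leb2 R) leb2_sigma_finite).

Definition shx r x : R * R := (x.1 + r, x.2).

Lemma shxE r : shx r = affmap 1 (r, 0).
Proof. by apply/funext => x; rewrite /affmap scale1r; case: x => a b; rewrite /shx/= -[RHS]/(_, _) addr0. Qed.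

Lemma preserves_shx r : preserves 1 (shx r).
Proof. by have := preserves_affine (r, 0) (@ltr01 R); rewrite expr1n -shxE. Qed.

Lemma shxK r x : shx (- r) (shx r x) = x.
Proof. by case: x => a b; rewrite /shx/= addrK. Qed.

Lemma test_shx t r : test_function t -> test_function (t \o shx r).
Proof. by rewrite shxE; exact: test_affine. Qed.

Lemma sqint_shx t r : sqint t -> sqint (t \o shx r).
Proof. by rewrite shxE; exact: sqint_affine. Qed.

Lemma Int_shx f r : integ f -> Int (f \o shx r) = Int f.
Proof. by move=> hf; rewrite -(preserves_Int (preserves_shx r) hf) mul1r. Qed.

Lemma Int_shx_mul v t r : sqint v -> test_function t ->
  Int (fun x => v x * t (shx (- r) x)) = Int (fun x => v (shx r x) * t x).
Proof.
move=> hv tt; rewrite -(@Int_shx (fun x => v x * t (shx (- r) x)) r).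
  by apply: eq_Int => x /=; rewrite shxK.
exact: (test_integ_mul hv (test_shx (- r) tt)).
Qed.

Lemma partial_shx t i r : Cn 1 t -> partial i (t \o shx r) = partial i t \o shx r.
Proof.
move=> Ct; rewrite shxE partial_affine//; apply/funext => x.
by rewrite mul1r.
Qed.

Lemma normp_shx r x : `|x| <= `|shx r x| + `|r|.
Proof.
rewrite normp_le; apply/andP; split.
  by rewrite -{1}(addrK r x.1); apply: (le_trans (ler_normB _ _)); rewrite lerD2r; exact: (normp_ge1 (shx r x)).
by apply: (le_trans (normp_ge2 (shx r x))); rewrite lerDl.
Qed.

Lemma is_derive_shx t x r : Cn 1 t ->
  is_derive r 1 (fun s => t (shx (- s) x)) (- partial false t (shx (- r) x)).
Proof.
move=> Ct; have D := @is_derive_section1 _ t (shx (- r) x) (Cn_derive false _ Ct).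
have H : is_derive r 1 (fun s : R => x.1 - s) (- 1).
  have := is_deriveB (is_derive_cst x.1 r (1 : R)) (is_derive_id r (1 : R)).
  by rewrite sub0r.
have D' : is_derive ((fun s : R => x.1 - s) r) 1 (fun s => t (s, x.2)) (partial false t (shx (- r) x)) := D.
by have := @is_derive1_comp _ (fun s => t (s, x.2)) (fun s => x.1 - s) r _ _ D' H; rewrite mulrN1.
Qed.

(** Moving the translation onto the test function makes the dependence on r
   differentiable; the derivative is then moved back by the definition of weak
   derivatives. *)
Lemma shift_derive v t g h : 0 < h -> sqint v -> sqint g -> test_function t ->
  weak_partial false v g ->
  (forall r, r \in `]-1, h + 1[ ->
     is_derive r 1 (fun r => Int (fun x => v (shx r x) * t x)) (Int (fun x => g (shx r x) * t x)))
  /\ {within `[0, h], continuous (fun r => Int (fun x => g (shx r x) * t x))}.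
Proof.
move=> h0 hv hg tt wg; have /test_functionP[st [M hM]] := tt.
have Ct : Cn 1 t := st 1.
pose f r x := v x * t (shx (- r) x).
pose f' r x := v x * - partial false t (shx (- r) x).
have cp : continuous (partial false t) := Cn_cont (Cn_partial false Ct).
have [C C0 hC] := cont_vanishes_bounded cp (vanishes_partial false Ct hM).
pose N := M + h + 1.
pose G x := C * `|\1_(box N) x * v x|.
have iG : integ G.
  exact: (integZ C (integ_abs (integ_mul (sqint_indic_box N) hv))).
have G0 x : 0 <= G x by rewrite mulr_ge0.
have if_ r : integ (f r) by exact: (test_integ_mul hv (test_shx (- r) tt)).
have if' r : integ (f' r).
  have := integN (test_integ_mul hv (test_shx (- r) (test_partial false tt))).
  by rewrite /f'; under [X in _ -> integ X]eq_fun do rewrite mulrN.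
have f'G r x : r \in `]-1, h + 1[ -> `|f' r x| <= G x.
  rewrite in_itv/= => /andP[r1 r2]; rewrite /f' /G normrM normrN [`|_ * v x|]normrM indicE.
  have [xN|xN] := leP `|x| N; first by rewrite mem_set// normr1 mul1r [leRHS]mulrC ler_wpM2l.
  rewrite (vanishes_partial false Ct hM) ?normr0 ?mulr0 ?mulr_ge0//.
  have := normp_shx (- r) x; rewrite normrN.
  have : `|r| <= h + 1 by rewrite ler_norml; apply/andP; split; lra.
  by move: xN; rewrite /N => *; lra.
have df r x : is_derive r 1 (f^~ x) (f' r x).
  have := is_derive_shx x r Ct => D; rewrite /f /f'.
  apply: is_derive_eq; rewrite /GRing.scale/= ?mul0r ?scaler0 ?addr0 //.
have fE r : Int (f r) = Int (fun x => v (shx r x) * t x) by exact: Int_shx_mul.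
have f'E r : Int (f' r) = Int (fun x => g (shx r x) * t x).
  have ts := test_shx (- r) tt.
  have E : Int (fun x => v x * partial false (t \o shx (- r)) x) =
    - Int (fun x => g x * (t \o shx (- r)) x) := wg _ ts.
  rewrite partial_shx// in E; rewrite -(Int_shx_mul r hg tt).
  rewrite (@eq_Int _ _ (fun x => - (v x * (partial false t \o shx (- r)) x))); last first.
    by move=> x; rewrite /f' mulrN.
  rewrite IntN ?E ?opprK//.
  by have := test_integ_mul hv (test_shx (- r) (test_partial false tt)).
split.
  move=> r rI.
  have D1 : partial1of2 f = f'.
    by apply/funext => r'; apply/funext => x; rewrite partial1of2E; have [] := df r' x.
  have := @cvg_differentiation_under_integral _ _ _ (@leb2 R) f setT measurableT
     r (-1) (h + 1) rI (fun r' _ => if_ r') (fun r' x _ _ => @ex_derive _ _ _ _ _ _ _ (df r' x))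
     G G0 iG.
  have Gub (r' : R) (x : T2) : `]-1, h + 1[%classic r' -> [set: T2] x ->
      `|partial1of2 f r' x| <= G x.
    by move=> h' _; rewrite D1; exact: f'G.
  move=> /(_ Gub); rewrite D1 => H.
  have FE : (fun r => Int (fun x => v (shx r x) * t x)) = (fun r => Int (f r)).
    by apply/funext => r'; rewrite fE.
  rewrite FE -f'E; split.
    apply/cvg_ex; exists (Int (f' r)); apply: cvg_trans H.
    by apply: near_eq_cvg; apply: nearW => k /=; rewrite /GRing.scale/= mulr1.
  apply: cvg_lim => //; apply: cvg_trans H.
  by apply: near_eq_cvg; apply: nearW => k /=; rewrite /GRing.scale/= mulr1.
have FE : (fun r => Int (fun x => g (shx r x) * t x)) = (fun r => Int (f' r)).
  by apply/funext => r'; rewrite f'E.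
rewrite FE.
have := @continuity_under_integral _ _ _ (@leb2 R) f' setT measurableT (-1) (h + 1)
  (fun r' _ => if' r').
move=> /(_ _ _ iG) H.
apply: continuous_in_subspaceT => r /set_mem /=; rewrite in_itv/= => /andP[r0 rh].
apply: H.
- apply: aeW => x _ r' _.
  apply: cvgM; first exact: cvg_cst.
  apply: cvgN; apply: (@continuous_comp _ _ _ (fun s : R => shx (- s) x) (partial false t)); last exact: cp.
  exact: (cvg_pair (cvgB (cvg_cst _) cvg_id) (cvg_cst _)).
- by move=> r' rI; apply: aeW => x _; exact: f'G.
- by apply/mem_set; rewrite /= in_itv/=; apply/andP; split; lra.
Qed.

Lemma shift_FTC v t g h : 0 < h -> sqint v -> sqint g -> test_function t ->
  weak_partial false v g ->
  (\int[mu]_(r in `[0%R, h]) (Int (fun x => g (shx r x) * t x))%:E =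
   (Int (fun x => v (shx h x) * t x))%:E - (Int (fun x => v x * t x))%:E)%E.
Proof.
move=> h0 hv hg tt wg; have [D C] := shift_derive h0 hv hg tt wg.
rewrite (continuous_FTC2 h0 C (F := fun r => Int (fun x => v (shx r x) * t x))).
- congr (_ - _%:E)%E; apply: eq_Int => x; congr (v _ * _).
  by case: x => a b; rewrite /shx/= addr0.
- have cF r : r \in `[0, h] -> {for r, continuous (fun r => Int (fun x => v (shx r x) * t x))}.
    rewrite in_itv/= => /andP[? ?].
    apply: differentiable_continuous; apply/derivable1_diffP.
    have [|//] := D r; rewrite in_itv/=; apply/andP; split; lra.
  split.
  + move=> r; rewrite in_itv/= => /andP[? ?].
    have [|//] := D r; rewrite in_itv/=; apply/andP; split; lra.
  + by apply: cvg_at_right_filter; apply: cF; rewrite in_itv/= lexx ltW.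
  + by apply: cvg_at_left_filter; apply: cF; rewrite in_itv/= lexx ltW.
- move=> r; rewrite in_itv/= => /andP[? ?]; rewrite derive1E.
  have [|_ //] := D r; rewrite in_itv/=; apply/andP; split; lra.
Qed.
End Line_shift.

(** * Weak derivatives and integrals along segments *)

Section Line_integral.
Context {R : realType}.
Implicit Types (f v t w g : R * R -> R) (M c d e s r h : R) (x z : R * R).
Local Notation T1 := (measurableTypeR R).
Local Notation T2 := (measurableTypeR R * measurableTypeR R)%type.
Local Notation mu := (@lebesgue_measure R).

Lemma Tonelli_line (F : T2 * T1 -> \bar R) : measurable_fun [set: T2 * T1] F ->
  (forall p, 0 <= F p)%E ->
  (\int[leb2]_x \int[mu]_r F (x, r) = \int[mu]_r \int[leb2]_x F (x, r))%E.
Proof. by move=> mF profile_moment; exact: (@fubini_tonelli _ _ T2 T1 R leb2s mu F mF profile_moment). Qed.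

Lemma measurable_shx2 : measurable_fun [set: T2 * T1] (fun p : T2 * T1 => shx p.2 p.1 : T2).
Proof.
apply/measurable_fun_pairP; split.
  apply: measurable_funD; last exact: measurable_snd.
  exact: (measurableT_comp measurable_fst measurable_fst).
exact: (measurableT_comp measurable_snd measurable_fst).
Qed.

(** The integral of g along the horizontal segment from x to x + (h, 0). *)
Definition seg h g x : R := \int[mu]_(r in `[0, h]) g (shx r x).

Definition seg_kernel h g (p : T2 * T1) : R := \1_(`[0, h]%classic : set R) p.2 * g (shx p.2 p.1).

Lemma measurable_seg_kernel h g : mfun2 g -> measurable_fun [set: T2 * T1] (seg_kernel h g).
Proof.
move=> mg; apply: measurable_funM.
  have mI : measurable_fun [set: T1] (\1_(`[0, h]%classic) : T1 -> R) by exact: measurable_indic.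
  exact: (measurableT_comp mI measurable_snd).
exact: (measurableT_comp mg measurable_shx2).
Qed.

Lemma segE h g x : seg h g x = fine (\int[mu]_r (seg_kernel h g (x, r))%:E)%E.
Proof.
rewrite /seg /Rintegral integral_mkcond; congr fine; apply: eq_integral => r _.
by rewrite patchE /seg_kernel indicE; case: ifPn => /=; rewrite ?mul1r ?mul0r.
Qed.

Lemma mfun2_seg h g : mfun2 g -> mfun2 (seg h g).
Proof.
move=> mg; have -> : seg h g = fine \o (fun x => \int[mu]_r (seg_kernel h g (x, r))%:E)%E.
  by apply/funext => x; rewrite segE.
apply: (measurableT_comp (fine_measurable measurableT)).
have mk : measurable_fun [set: T2 * T1] (EFin \o seg_kernel h g).
  by apply/measurable_EFinP; exact: measurable_seg_kernel.
under eq_fun do rewrite integralE.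
apply: emeasurable_funB.
  have := @measurable_fun_fubini_tonelli_F _ _ T2 T1 R mu _ (measurable_funepos mk)
    (fun p => funepos_ge0 _ p).
  apply: eq_measurable_fun => x _; rewrite /fubini_F; apply: eq_integral => r _.
  by rewrite !funeposE.
have := @measurable_fun_fubini_tonelli_F _ _ T2 T1 R mu _ (measurable_funeneg mk)
  (fun p => funeneg_ge0 _ p).
apply: eq_measurable_fun => x _; rewrite /fubini_F; apply: eq_integral => r _.
by rewrite !funenegE.
Qed.

Lemma seg_Fubini h g w : 0 <= h -> sqint g -> sqint w ->
  integ (fun x => w x * seg h g x) /\
  (Int (fun x => w x * seg h g x))%:E =
    (\int[mu]_(r in `[0%R, h]) (Int (fun x => w x * g (shx r x)))%:E)%E.
Proof.
move=> h0 hg hw; have mg := sqint_mfun hg.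
pose K (p : T2 * T1) : R := w p.1 * seg_kernel h g p.
have mK : measurable_fun [set: T2 * T1] (EFin \o K).
  apply/measurable_EFinP; apply: measurable_funM; last exact: measurable_seg_kernel.
  exact: (measurableT_comp (sqint_mfun hw) measurable_fst).
pose D := Int (fun x => w x ^+ 2) + Int (fun x => g x ^+ 2).
have iwg r : integ (fun x => w x * g (shx r x)) by exact: (integ_mul hw (sqint_shx r hg)).
have KE x r : K (x, r) = \1_(`[0, h]%classic : set R) r * (w x * g (shx r x)).
  by rewrite /K /seg_kernel /= mulrCA.
have iK : (leb2s \x mu)%E.-integrable [set: T2 * T1] (EFin \o K).
  apply/(integrable21ltyP leb2s mu mK).
  apply: (@le_lt_trans _ _ (\int[mu]_r (\1_(`[0%R, h]%classic : set R) r * D)%:E)%E).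
    apply: ge0_le_integral => //.
    - by move=> r _; apply: integral_ge0.
    - have mA : measurable_fun [set: T2 * T1] (abse \o (EFin \o K)) by exact: measurableT_comp.
      exact: (@measurable_fun_fubini_tonelli_G _ _ T2 T1 R leb2s _ mA (fun p => abse_ge0 _)).
    - by apply/measurable_EFinP; apply: measurable_funM => //; exact: measurable_indic.
    move=> r _; have [rh|rh] := boolP (r \in (`[0, h]%classic : set R)); last first.
      rewrite (eq_integral (cst 0%E)) ?integral0; last first.
        by move=> x _ /=; rewrite KE indicE (negbTE rh) mul0r normr0.
      by rewrite lee_fin mulr_ge0// addr_ge0// Int_sqr_ge0.
    have -> : (\int[leb2s]_x `|(EFin \o K) (x, r)|)%E =
       (Int (fun x => `|w x * g (shx r x)|))%:E.
      rewrite EFin_Int; last exact: integ_abs.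
      by apply: eq_integral => x _ /=; rewrite KE indicE rh mul1r.
    rewrite lee_fin indicE rh mul1r /D.
    have g2 := sqint_sqr (sqint_shx r hg); have w2 := sqint_sqr hw.
    rewrite -(Int_shx r (sqint_sqr hg)) -IntD//.
    apply: Int_le; [exact: integ_abs|exact: integD|].
    move=> x /=; rewrite ler_norml.
    have := sqr_ge0 (w x - g (shx r x)); have := sqr_ge0 (w x + g (shx r x)).
    have := sqr_ge0 (w x); have := sqr_ge0 (g (shx r x)).
    by move=> *; apply/andP; split; nra.
  under eq_integral do rewrite EFinM.
  rewrite (_ : (\int[mu]_r _)%E = (\int[mu]_r (D%:E * (\1_(`[0%R, h]%classic : set R) r)%:E))%E); last first.
    by apply: eq_integral => r _; rewrite muleC.
  rewrite ge0_integralZl//; last 2 first.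
  - by apply/measurable_EFinP; exact: measurable_indic.
  - by rewrite lee_fin addr_ge0// Int_sqr_ge0.
  rewrite integral_indic// setIT.
  have mh : (mu (`[0%R, h]%classic : set T1) < +oo)%E.
    by rewrite lebesgue_measure_itv/=; case: ifP => _; rewrite ?ltry// -EFinB ltry.
  apply: lte_mul_pinfty => //; first by rewrite lee_fin addr_ge0// Int_sqr_ge0.
have aeK : {ae leb2, forall x, mu.-integrable setT (fun r => (EFin \o K) (x, r))}.
  exact: (ae_integrable1 iK).
have E : {ae leb2, forall x, fine (fubini_F mu (EFin \o K) x) = w x * seg h g x}.
  apply: ae2S aeK => x iKx; rewrite /fubini_F segE.
  have [w0|w0] := eqVneq (w x) 0.
    rewrite w0 mul0r (eq_integral (cst 0%E)) ?integral0// => r _ /=.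
    by rewrite /K /= w0 mul0r.
  have ik : mu.-integrable setT (fun r => (seg_kernel h g (x, r))%:E).
    have := integrableZl measurableT (w x)^-1 iKx.
    apply: eq_integrable => // r _ /=.
    by rewrite /= -EFinM /K /= mulKf.
  rewrite -[w x * _]/(fine ((w x)%:E) * _) -fineM//; last exact: integrable_fin_num.
  rewrite -integralZl//; congr fine; exact: eq_integral.
have iF := @integrable_fubini_F _ _ _ _ _ leb2s mu _ iK.
have ifF : integ (fine \o fubini_F mu (EFin \o K)).
  have mF := measurable_int _ iF.
  apply: (le_integrable measurableT _ _ iF).
    by apply/measurable_EFinP; exact: (measurableT_comp (fine_measurable measurableT)).
  move=> x _ /=; case: (fubini_F _ _ x) => [y| |] //=; by rewrite ?normr0 ?leey.
have mws : mfun2 (fun x => w x * seg h g x).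
  by apply: mfun2M; [exact: sqint_mfun|exact: mfun2_seg].
have iws : integ (fun x => w x * seg h g x) := aeeq_integ mws E ifF.
split=> //.
rewrite -(aeeq_Int (integ_mfun ifF) mws E) EFin_Int//.
transitivity (\int[leb2s]_x fubini_F mu (EFin \o K) x)%E.
  apply: ae_eq_integral => //; [exact: (measurable_int _ ifF)|exact: (measurable_int _ iF)|].
  have := integrable_ae measurableT iF; apply: ae2S => x /(_ I) Fx _ /=.
  by rewrite fineK.
rewrite integral12_prod_meas1// -integral21_prod_meas1// /fubini_G.
rewrite [RHS]integral_mkcond; apply: eq_integral => r _; rewrite patchE.
case: ifPn => rh.
  rewrite EFin_Int//; apply: eq_integral => x _ /=.
  by rewrite KE indicE rh mul1r.
rewrite (eq_integral (cst 0%E)) ?integral0// => x _ /=.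
by rewrite KE indicE (negbTE rh) mul0r.
Qed.

(** Both sides have the same integral against every test function, by the
   fundamental theorem of calculus in the length of the shift and Fubini. *)
Lemma shift_seg v g h : 0 < h -> sqint v -> sqint g -> weak_partial false v g ->
  aeeq (fun x => v (shx h x)) (fun x => v x + seg h g x).
Proof.
move=> h0 hv hg wg; have h0' := ltW h0.
have hvh := sqint_shx h hv.
have iD M : integ (fun x => \1_(box M) x * (v (shx h x) - v x - seg h g x)).
  have [i1 _] := seg_Fubini h0' hg (sqint_indic_box M).
  have i2 := integ_mul (sqint_indic_box M) (sqintB hvh hv).
  have := integB i2 i1.
  suff -> : (fun x => \1_(box M) x * ((v \o shx h) x - v x) - \1_(box M) x * seg h g x) =
    (fun x => \1_(box M) x * (v (shx h x) - v x - seg h g x)) by [].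
  by apply/funext => x; rewrite -mulrBr.
have mD : mfun2 (fun x => v (shx h x) - v x - seg h g x).
  apply: mfun2B; last exact: (mfun2_seg h (sqint_mfun hg)).
  exact: (sqint_mfun (sqintB hvh hv)).
have := ae_eq0_bump_loc mD iD.
move=> /(_ _)H; apply: ae2S (H _) => {H} [x /eqP|n a b c d].
  by rewrite subr_eq0 subr_eq addrC => /eqP.
have tt := test_bump n a b c d; set t := box_bump n a b c d.
have [i1 E] := seg_Fubini h0' hg (test_sqint tt).
have E2 : Int (fun x => t x * seg h g x) =
    Int (fun x => v (shx h x) * t x) - Int (fun x => v x * t x).
  apply: EFin_inj; rewrite EFinB -(shift_FTC h0 hv hg tt wg) E.
  by apply: eq_integral => r _; congr (_%:E); apply: eq_Int => x; rewrite mulrC.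
have i2 := test_integ_mul hv tt; have i3 := test_integ_mul hvh tt.
rewrite (@eq_Int _ _ (fun x => (v (shx h x) * t x - v x * t x) - t x * seg h g x)); last first.
  by move=> x; rewrite !mulrBl [seg h g x * _]mulrC.
by rewrite IntB// ?IntB//; [rewrite -E2 subrr|exact: integB].
Qed.
End Line_integral.

(** * Square integrals over horizontal lines *)

Section Ladyzhenskaya.
Context {R : realType}.
Implicit Types (f v t w : R * R -> R) (g : bool -> R * R -> R) (M c d e s r h : R) (x z : R * R).
Local Notation T1 := (measurableTypeR R).
Local Notation T2 := (measurableTypeR R * measurableTypeR R)%type.
Local Notation mu := (@lebesgue_measure R).

Lemma measurable_addr c : measurable_fun [set: T1] (fun r : T1 => (r + c : R) : T1).
Proof. exact: measurable_funD. Qed.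

Lemma measurable_addl c : measurable_fun [set: T1] (fun r : T1 => (c + r : R) : T1).
Proof. exact: measurable_funD. Qed.

Lemma integral_shift (F : T1 -> \bar R) c : measurable_fun [set: T1] F ->
  (forall r, 0 <= F r)%E -> (\int[mu]_r F (r + c)%R = \int[mu]_r F r)%E.
Proof.
move=> mF profile_moment; pose phi (r : T1) : T1 := (r + c)%R.
have mphi : measurable_fun [set: T1] phi by exact: measurable_addr.
transitivity (\int[pushforward mu phi]_r F r)%E.
  by rewrite (ge0_integral_pushforward mphi _ measurableT)// preimage_setT.
by apply: eq_measure_integral => A mA _; exact: mu_shift.
Qed.

(** The square integral over the horizontal line at height y; it may be
   infinite for exceptional y. *)
Definition line_sqr f (y : R) : \bar R := (\int[mu]_s (f (s, y) ^+ 2)%:E)%E.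

Lemma line_sqr_ge0 f y : (0 <= line_sqr f y)%E.
Proof. by apply: integral_ge0 => s _; rewrite lee_fin sqr_ge0. Qed.

Lemma measurable_sqrE f : mfun2 f -> measurable_fun [set: T2] (fun x => (f x ^+ 2)%:E).
Proof. by move=> mf; apply/measurable_EFinP; exact: (mfun2X 2 mf). Qed.

Lemma measurable_line_sqr f : mfun2 f -> measurable_fun [set: T1] (line_sqr f).
Proof.
move=> mf; have f0 (x : T2) : (0 <= (f x ^+ 2)%:E)%E by rewrite lee_fin sqr_ge0.
exact: (@measurable_fun_fubini_tonelli_G _ _ T1 T1 R mu _ (measurable_sqrE mf) f0).
Qed.

Lemma integral_line_sqr f : sqint f ->
  (\int[mu]_y line_sqr f y = (Int (fun x => f x ^+ 2))%:E)%E.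
Proof.
move=> hf; rewrite EFin_Int; last exact: sqint_sqr.
have f0 (x : T2) : (0 <= (f x ^+ 2)%:E)%E by rewrite lee_fin sqr_ge0.
by rewrite (@fubini_tonelli2 _ _ T1 T1 R mu mu _ (measurable_sqrE (sqint_mfun hf)) f0).
Qed.

Lemma measurable_row f y : mfun2 f -> measurable_fun [set: T1] (fun s : T1 => f (s, y)).
Proof. by move=> mf; apply: (measurableT_comp mf); exact: pair2_measurable. Qed.

Lemma line_sqr_shift f x : mfun2 f ->
  (\int[mu]_r (f (shx r x) ^+ 2)%:E = line_sqr f x.2)%E.
Proof.
move=> mf; rewrite /line_sqr -(@integral_shift (fun s => (f (s, x.2) ^+ 2)%:E) x.1).
- by apply: eq_integral => r _; rewrite /shx addrC.
- by apply/measurable_EFinP; apply: measurable_funX; exact: measurable_row.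
- by move=> r; rewrite lee_fin sqr_ge0.
Qed.

(** Cauchy-Schwarz on a segment of length at most 1, done by hand: integrate 2
   c f - c^2 <= f^2 with c the integral of f. *)
Lemma seg_sqr h f x : 0 <= h -> h <= 1 -> mfun2 f ->
  ((seg h f x ^+ 2)%:E <= line_sqr f x.2)%E.
Proof.
move=> h0 h1 mf; rewrite -line_sqr_shift//.
have mr : measurable_fun [set: T1] (fun r : T1 => f (shx r x)).
  apply: (measurableT_comp mf); apply: measurable_fun_pair => //.
  exact: measurable_addl.
have [->|fin] := eqVneq (\int[mu]_r (f (shx r x) ^+ 2)%:E)%E +oo%E; first exact: leey.
have i2 : mu.-integrable setT (EFin \o (fun r => f (shx r x) ^+ 2)).
  apply/integrableP; split; first by apply/measurable_EFinP; exact: measurable_funX.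
  rewrite ltey; move: fin; apply: contra => /eqP <-; apply/eqP.
  by apply: eq_integral => r _ /=; rewrite ger0_norm// sqr_ge0.
pose I : T1 -> R := \1_(`[0, h]%classic).
have iI : mu.-integrable setT (EFin \o I) by exact: integrable_indic_itv.
have mI : measurable_fun [set: T1] I by exact: measurable_indic.
have ik : mu.-integrable setT (EFin \o (fun r => I r * f (shx r x))).
  apply: (le_integrable measurableT _ _ (integrableD measurableT iI i2)).
    by apply/measurable_EFinP; exact: measurable_funM.
  move=> r _; rewrite /I /= indicE; case: (_ \in _); rewrite ?mul1r ?mul0r ?normr0 ?lee_fin//=.
  rewrite [leRHS]ger0_norm ?addr_ge0 ?sqr_ge0//.
  have E : f (shx r x) ^+ 2 = `|f (shx r x)| ^+ 2 by rewrite real_normK ?num_real.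
  by rewrite E; have := sqr_ge0 (`|f (shx r x)| - 1); have := sqr_ge0 `|f (shx r x)|; nra.
set c := seg h f x.
have cE : c = \int[mu]_r (I r * f (shx r x)) by rewrite /c segE.
have iIc : mu.-integrable setT (EFin \o (fun r => 2 * c * (I r * f (shx r x)) - c ^+ 2 * I r)).
  have := integrableB measurableT (integrableZl measurableT (2 * c) ik)
    (integrableZl measurableT (c ^+ 2) iI).
  by apply: eq_integrable.
have le1 : \int[mu]_r (2 * c * (I r * f (shx r x)) - c ^+ 2 * I r) <=
    \int[mu]_r (f (shx r x) ^+ 2).
  apply: le_Rintegral => // r _; rewrite /I indicE; case: (_ \in _); rewrite ?mul1r ?mul0r ?mulr0 ?mulr1 ?subr0 ?sqr_ge0//.
  by have := sqr_ge0 (f (shx r x) - c); lra.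
have mh : \int[mu]_r I r <= h.
  rewrite /Rintegral /I integral_indic// setIT.
  have E : mu `[0, h]%classic = h%:E.
    have /= -> := lebesgue_measure_itv `[0, h]; rewrite lte_fin.
    by case: ltgtP h0 => //= [_ _|<- _]; rewrite ?oppr0 ?adde0.
  by rewrite [X in fine X]E.
have le2 : c ^+ 2 <= \int[mu]_r (f (shx r x) ^+ 2).
  apply: le_trans le1; rewrite RintegralB//; last 2 first.
  - by have := integrableZl measurableT (2 * c) ik; apply: eq_integrable.
  - by have := integrableZl measurableT (c ^+ 2) iI; apply: eq_integrable.
  rewrite RintegralZl// RintegralZl// -cE.
  move: mh (sqr_ge0 c) h1; set II := Rintegral _ _ _.
  clear; move=> mh c2 h1; clearbody c II.
  have : c ^+ 2 * II <= c ^+ 2 * 1 by rewrite ler_wpM2l// (le_trans mh).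
  lra.
apply: le_trans (_ : ((\int[mu]_r (f (shx r x) ^+ 2))%:E <= _)%E); first by rewrite lee_fin.
by rewrite /Rintegral fineK//; exact: (integrable_fin_num measurableT i2).
Qed.

Definition line_bound v f (y : R) : \bar R := (2%:E * (line_sqr v y + line_sqr f y))%E.

Lemma measurable_line_bound v f : mfun2 v -> mfun2 f -> measurable_fun [set: T1] (line_bound v f).
Proof.
move=> mv mf; apply: measurable_funeM; apply: emeasurable_funD; exact: measurable_line_sqr.
Qed.

Lemma line_bound_ge0 v f y : (0 <= line_bound v f y)%E.
Proof. by rewrite mule_ge0// adde_ge0// line_sqr_ge0. Qed.

Lemma Int_le0_ae f : integ f -> (forall x, 0 <= f x) -> Int f <= 0 -> aeeq f (fun=> 0).
Proof.
move=> hf f0 I0.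
have /ae_eq_integral_abs : (\int[@leb2 R]_x `|(EFin \o f) x| = 0)%E.
  transitivity ((Int f)%:E).
    by rewrite EFin_Int//; apply: eq_integral => x _ /=; rewrite ger0_norm.
  by apply/eqP; rewrite eqe eq_le I0 Int_ge0.
move=> /(_ measurableT (measurable_int _ hf)).
by apply: ae2S => x /(_ I) [].
Qed.

Lemma integral_cst01 (G : \bar R) : (\int[mu]_(r in `]0%R, 1%R]) G = G)%E.
Proof.
rewrite integral_cst//.
have E : (mu `]0%R, 1%R]%classic = 1)%E.
  by have /= -> := lebesgue_measure_itv `]0%R, 1%R]; rewrite lte_fin ltr01 oppr0 adde0.
by transitivity (G * 1)%E; [rewrite -E|rewrite mule1].
Qed.

(** Write v(x) as v(x + h) minus the integral of f over the segment, square,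
   and average over h in ]0, 1]. The average is taken after integration over
   the exceptional set, so that Tonelli's theorem applies. *)
Lemma line_bound_ae v f : sqint v -> sqint f -> weak_partial false v f ->
  {ae leb2, forall x, ((v x ^+ 2)%:E <= line_bound v f x.2)%E}.
Proof.
move=> hv hf wf; have mv := sqint_mfun hv; have mf := sqint_mfun hf.
have mB : measurable_fun [set: T2] (fun x : T2 => line_bound v f x.2).
  exact: (measurableT_comp (measurable_line_bound mv mf) measurable_snd).
have mG : measurable_fun [set: T2] (fun x : T2 => line_sqr f x.2).
  exact: (measurableT_comp (measurable_line_sqr mf) measurable_snd).
have mV : measurable_fun [set: T2] (fun x : T2 => line_sqr v x.2).
  exact: (measurableT_comp (measurable_line_sqr mv) measurable_snd).
pose A : set T2 := [set x | (line_bound v f x.2 < (v x ^+ 2)%:E)%E].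
have mA : measurable A.
  have := emeasurable_fun_lt measurableT mB (measurable_sqrE mv).
  by rewrite setTI.
have step h : 0 < h -> h <= 1 -> (\int[leb2]_(x in A) (v x ^+ 2)%:E <=
    2%:E * \int[leb2]_(x in A) (v (shx h x) ^+ 2)%:E + 2%:E * \int[leb2]_(x in A) line_sqr f x.2)%E.
  move=> h0 h1.
  rewrite -!ge0_integralZl//; first last.
  - by move=> x _; rewrite lee_fin sqr_ge0.
  - apply: measurable_funTS; exact: (measurable_sqrE (sqint_mfun (sqint_shx h hv))).
  - by move=> x _; exact: line_sqr_ge0.
  - exact: measurable_funTS.
  rewrite -ge0_integralD//; first last.
  - by apply: measurable_funeM; exact: measurable_funTS.
  - by move=> x _; rewrite mule_ge0// line_sqr_ge0.
  - apply: measurable_funeM; apply: measurable_funTS; exact: (measurable_sqrE (sqint_mfun (sqint_shx h hv))).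
  - by move=> x _; rewrite mule_ge0// lee_fin sqr_ge0.
  apply: ae_ge0_le_integral => //.
  - by move=> x _; rewrite lee_fin sqr_ge0.
  - by apply: measurable_funTS; exact: measurable_sqrE.
  - by move=> x _; rewrite adde_ge0// mule_ge0// ?line_sqr_ge0// lee_fin sqr_ge0.
  - apply: emeasurable_funD; apply: measurable_funeM; apply: measurable_funTS => //.
    exact: (measurable_sqrE (sqint_mfun (sqint_shx h hv))).
  apply: ae2S (shift_seg h0 hv hf wf) => x E _.
  apply: (@le_trans _ _ (2 * v (shx h x) ^+ 2 + 2 * seg h f x ^+ 2)%:E).
    rewrite lee_fin; have -> : v x = v (shx h x) - seg h f x by rewrite E addrK.
    by have := sqr_ge0 (v (shx h x) + seg h f x); lra.
  by rewrite EFinD !EFinM leeD2l// lee_pmul2l// seg_sqr// ltW.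
have leA : (\int[leb2]_(x in A) (v x ^+ 2)%:E <= \int[leb2]_(x in A) line_bound v f x.2)%E.
  pose J : T1 -> R := \1_(`]0, 1]%classic).
  have mJ : measurable_fun [set: T1] J by exact: measurable_indic.
  have mvh : measurable_fun [set: T2 * T1] (fun p : T2 * T1 => (\1_A p.1 * (J p.2 * v (shx p.2 p.1) ^+ 2))%:E).
    apply/measurable_EFinP; apply: measurable_funM.
      exact: (measurableT_comp (measurable_indic mA) measurable_fst).
    apply: measurable_funM; first exact: (measurableT_comp mJ measurable_snd).
    apply: measurable_funX; exact: (measurableT_comp mv measurable_shx2).
  have vh0 (p : T2 * T1) : (0 <= (\1_A p.1 * (J p.2 * v (shx p.2 p.1) ^+ 2))%:E)%E.
    by rewrite lee_fin; apply: mulr_ge0; [|apply: mulr_ge0; [rewrite /J|exact: sqr_ge0]]; rewrite indicE.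
  have TT := Tonelli_line mvh vh0.
  apply: (@le_trans _ _ (2%:E * (\int[leb2]_x \int[mu]_r (\1_A x * (J r * v (shx r x) ^+ 2))%:E) +
     2%:E * \int[leb2]_(x in A) line_sqr f x.2)%E).
    rewrite TT.
    have -> : (\int[leb2]_(x in A) (v x ^+ 2)%:E = \int[mu]_(r in `]0%R, 1%R]) \int[leb2]_(x in A) (v x ^+ 2)%:E)%E.
      by rewrite integral_cst01.
    set G := (2%:E * \int[leb2]_(x in A) line_sqr f x.2)%E.
    have G0 : (0 <= G)%E by rewrite mule_ge0// integral_ge0// => x _; exact: line_sqr_ge0.
    have -> : G = (\int[mu]_(r in `]0%R, 1%R]) G)%E.
      by rewrite integral_cst01.
    have mr : measurable_fun [set: T1] (fun r => \int[leb2]_x (\1_A x * (J r * v (shx r x) ^+ 2))%:E)%E.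
      exact: (@measurable_fun_fubini_tonelli_G _ _ T2 T1 R leb2s _ mvh vh0).
    have r0 r : (0 <= \int[leb2]_x (\1_A x * (J r * v (shx r x) ^+ 2))%:E)%E.
      by apply: integral_ge0 => x _; exact: (vh0 (x, r)).
    have -> : (\int[mu]_r \int[leb2]_x (\1_A x * (J r * v (shx r x) ^+ 2))%:E =
       \int[mu]_(r in `]0%R, 1%R]) \int[leb2]_(x in A) (v (shx r x) ^+ 2)%:E)%E.
      rewrite [RHS]integral_mkcond; apply: eq_integral => r _; rewrite patchE.
      rewrite /J indicE; case: ifPn => rJ.
        rewrite [RHS]integral_mkcond; apply: eq_integral => x _; rewrite patchE indicE.
        by case: ifP => _; rewrite !mul1r ?mul0r.
      by rewrite (eq_integral (cst 0%E)) ?integral0// => x _; rewrite mul0r mulr0.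
    have mr' : measurable_fun (`]0%R, 1%R]%classic : set T1) (fun r : T1 => \int[leb2]_(x in A) (v (shx r x) ^+ 2)%:E)%E.
      apply: (eq_measurable_fun (fun r : T1 => \int[leb2]_x (\1_A x * (J r * v (shx r x) ^+ 2))%:E)%E).
        move=> r rJ; rewrite [RHS]integral_mkcond; apply: eq_integral => x _; rewrite patchE /J !indicE rJ.
        by case: ifP => _; rewrite !mul1r ?mul0r.
      exact: measurable_funTS.
    rewrite -ge0_integralZl//; last by move=> r _; apply: integral_ge0 => x _; rewrite lee_fin sqr_ge0.
    rewrite -ge0_integralD//; first last.
    - exact: measurable_funeM.
    - by move=> r _; rewrite mule_ge0// integral_ge0// => x _; rewrite lee_fin sqr_ge0.
    apply: ge0_le_integral => //.
    - by move=> r _; apply: integral_ge0 => x _; rewrite lee_fin sqr_ge0.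
    - apply: emeasurable_funD => //; exact: measurable_funeM.
    - by move=> r; rewrite /= in_itv/= => /andP[? ?]; exact: step.
  rewrite /line_bound ge0_integralZl//; first last.
  - by move=> x _; rewrite adde_ge0// line_sqr_ge0.
  - by apply: emeasurable_funD; exact: measurable_funTS.
  rewrite ge0_integralD//; first last.
  - exact: measurable_funTS.
  - by move=> x _; exact: line_sqr_ge0.
  - exact: measurable_funTS.
  - by move=> x _; exact: line_sqr_ge0.
  rewrite [leRHS]ge0_muleDr; [|by apply: integral_ge0 => x _; exact: line_sqr_ge0..].
  rewrite leeD2r// lee_pmul2l// [leRHS]integral_mkcond; apply: ge0_le_integral => //.
  - by move=> x _; apply: integral_ge0 => r _; exact: (vh0 (x, r)).
  - exact: (@measurable_fun_fubini_tonelli_F _ _ T2 T1 R mu _ mvh vh0).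
  - by apply/(measurable_restrictT _ mA); exact: measurable_funTS.
  move=> x _; rewrite patchE indicE; case: ifP => xA; last first.
    by rewrite (eq_integral (cst 0%E)) ?integral0// => r _; rewrite mul0r.
  rewrite -line_sqr_shift//; apply: ge0_le_integral => //.
  - by move=> r _; rewrite lee_fin mul1r mulr_ge0// ?sqr_ge0// /J indicE.
  - apply/measurable_EFinP; under eq_fun do rewrite mul1r; apply: measurable_funM => //.
    apply: measurable_funX; apply: (measurableT_comp mv); apply: measurable_fun_pair => //.
    exact: measurable_addl.
  - apply/measurable_EFinP; apply: measurable_funX; apply: (measurableT_comp mv); apply: measurable_fun_pair => //.
    exact: measurable_addl.
  - move=> r _; rewrite mul1r lee_fin ler_piMl ?sqr_ge0// /J indicE.
    by case: (_ \in _).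
pose f1 x : R := \1_A x * v x ^+ 2.
pose f2 x : R := \1_A x * fine (line_bound v f x.2).
have finA x : A x -> line_bound v f x.2 \is a fin_num.
  move=> Ax; rewrite ge0_fin_numE ?line_bound_ge0//.
  exact: lt_trans Ax (ltry _).
have f21 x : f2 x <= f1 x.
  rewrite /f1 /f2 indicE; case: (boolP (x \in A)) => [/set_mem Ax|]; last by rewrite !mul0r.
  by rewrite !mul1r -lee_fin fineK ?finA// ltW.
have f20 x : 0 <= f2 x by rewrite mulr_ge0// ?indicE// fine_ge0// line_bound_ge0.
have i1 : integ f1 by exact: integ_indicM mA (sqint_sqr hv).
have m2 : mfun2 f2.
  apply: mfun2M; first exact: mfun2_indic.
  exact: (measurableT_comp (fine_measurable measurableT) mB).
have i2 : integ f2 by apply: (integ_le m2 _ i1) => x; rewrite ger0_norm.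
have I12 : Int f1 <= Int f2.
  rewrite -lee_fin !EFin_Int//; move: leA; rewrite !(integral_mkcond A).
  congr (_ <= _)%E; apply: eq_integral => x _; rewrite patchE /f1 /f2 indicE.
    by case: ifP => _; rewrite ?mul1r ?mul0r.
  by case: ifPn => [/set_mem xA|_]; rewrite ?mul1r ?mul0r// fineK// finA.
have := @Int_le0_ae (fun x => f1 x - f2 x) (integB i1 i2).
move=> /(_ _ _) H; apply: ae2S (H _ _) => {H} [x| |].
- rewrite /f1 /f2 indicE; case: (boolP (x \in A)) => [/set_mem Ax|nA _]; last first.
    by rewrite leNgt; apply: contraNN nA => xA; exact: mem_set.
  rewrite !mul1r => /eqP; rewrite subr_eq0 => /eqP E; exfalso.
  by move: (Ax); rewrite /A/= E fineK ?finA// ltxx.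
- by move=> x; rewrite subr_ge0.
- by rewrite IntB// subr_le0.
Qed.
End Ladyzhenskaya.

(** * Ladyzhenskaya's inequality *)

Section Quartic.
Context {R : realType}.
Implicit Types (f v t w : R * R -> R) (g : bool -> R * R -> R) (M c d e s r h : R) (x z : R * R).
Local Notation T1 := (measurableTypeR R).
Local Notation T2 := (measurableTypeR R * measurableTypeR R)%type.
Local Notation mu := (@lebesgue_measure R).

Lemma preserves_swap : preserves 1 (@swap2 R).
Proof.
have ms : measurable_fun [set: T2] (@swap2 R : T2 -> T2).
  by apply: measurable_fun_pair; [exact: measurable_snd|exact: measurable_fst].
split=> // A mA; rewrite mul1e (leb2_ysection mA) /leb2.
transitivity (\int[mu]_x mu (xsection (@swap2 R @^-1` A) x))%E; first by [].
by apply: eq_integral => y _; congr (mu _).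
Qed.

Lemma is_derive_swap t i x d : is_derive (swap2 x) (basis_vec (~~ i)) t d ->
  is_derive x (basis_vec i) (t \o swap2) d.
Proof.
move=> H; apply/is_derive_lineP; move/is_derive_lineP: H.
suff -> : (fun s : R => t (s *: basis_vec (~~ i) + swap2 x)) =
  (fun s : R => (t \o swap2) (s *: basis_vec i + x)) by [].
by apply/funext => s /=; congr t; rewrite /swap2; case: i.
Qed.

Lemma partial_swap t i : Cn 1 t -> partial i (t \o swap2) = partial (~~ i) t \o swap2.
Proof.
move=> Ct; apply/funext => x; apply: derive_val; apply: is_derive_swap.
exact: (Cn_derive (~~ i) (swap2 x) Ct).
Qed.

Lemma test_swap t : test_function t -> test_function (t \o swap2).
Proof.
move=> /test_functionP[st [M vt]]; apply/test_functionP; split.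
  by move=> k; exact: Cn_swap.
by exists M => x Mx; apply: vt; rewrite /swap2/= prod_normE/= maxC -[X in Num.max X _]/(`|x.1|) -prod_normE.
Qed.

Lemma sqint_swap v : sqint v -> sqint (v \o swap2).
Proof.
have P := preserves_swap; have [_ ms _] := P => -[mv v2]; split.
  exact: (measurableT_comp mv ms).
exact: (preserves_integ P v2).
Qed.

Lemma Int_swap f : integ f -> Int (f \o swap2) = Int f.
Proof. by move=> hf; rewrite -(preserves_Int preserves_swap hf) mul1r. Qed.

Lemma weak_partial_swap v f i : sqint v -> sqint f -> weak_partial i v f ->
  weak_partial (~~ i) (v \o swap2) (f \o swap2).
Proof.
move=> hv hf /weak_partialE wf; apply/weak_partialE => t tt.
have ts := test_swap tt.
have := wf _ ts; rewrite (partial_swap _ (test_smooth 1 tt)).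
rewrite -Int_swap; last first.
  rewrite -(partial_swap _ (test_smooth 1 tt)).
  by apply: test_integ_mul => //; exact: test_partial.
rewrite -[Int (fun x => f x * _)]Int_swap; last exact: test_integ_mul.
move=> H; transitivity (Int ((fun x => v x * (partial (~~ i) t \o swap2) x) \o swap2)).
  by apply: eq_Int => x /=; congr (_ * partial _ t _); case: x.
by rewrite H; congr (- _); apply: eq_Int => x /=; congr (_ * t _); case: x.
Qed.

Lemma integral_line_bound v f : sqint v -> sqint f ->
  (\int[mu]_y line_bound v f y =
    (2 * (Int (fun x => v x ^+ 2)%R + Int (fun x => f x ^+ 2)%R))%:E)%E.
Proof.
move=> hv hf; have mv := sqint_mfun hv; have mf := sqint_mfun hf.
rewrite /line_bound ge0_integralZl//; first last.
- by move=> x _; rewrite adde_ge0// line_sqr_ge0.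
- by apply: emeasurable_funD; exact: measurable_line_sqr.
rewrite ge0_integralD//; first last.
- exact: measurable_line_sqr.
- by move=> x _; exact: line_sqr_ge0.
- exact: measurable_line_sqr.
- by move=> x _; exact: line_sqr_ge0.
by rewrite !integral_line_sqr.
Qed.

(** v^2 is bounded by a function of x.2 alone and by a function of x.1 alone;
   the integral of the product of the two bounds is the product of their
   integrals. *)
Lemma Ladyzhenskaya v g : sqint v -> has_grad v g ->
  integ (fun x => v x ^+ 4) /\
  Int (fun x => v x ^+ 4) <= 4 *
   ((Int (fun x => v x ^+ 2) + Int (fun x => g false x ^+ 2)) *
    (Int (fun x => v x ^+ 2) + Int (fun x => g true x ^+ 2))).
Proof.
move=> hv hg; have [h0 w0] := hg false; have [h1 w1] := hg true.
have mv := sqint_mfun hv; have hs := sqint_swap hv; have hs1 := sqint_swap h1.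
have b0 := line_bound_ae hv h0 w0.
have b1 : {ae leb2, forall x, ((v x ^+ 2)%:E <= line_bound (v \o swap2) (g true \o swap2) x.1)%E}.
  have := preserves_ae preserves_swap (line_bound_ae hs hs1 (weak_partial_swap hv h1 w1)).
  by apply: ae2S => -[x y].
set A := line_bound v (g false) in b0; set B := line_bound _ _ in b1.
have mA : measurable_fun [set: T1] A by apply: measurable_line_bound; exact: sqint_mfun.
have mB : measurable_fun [set: T1] B by apply: measurable_line_bound; exact: sqint_mfun.
have A0 y : (0 <= A y)%E by exact: line_bound_ge0.
have B0 y : (0 <= B y)%E by exact: line_bound_ge0.
have mAB : measurable_fun [set: T2] (fun x : T2 => A x.2 * B x.1)%E.
  apply: emeasurable_funM.
    exact: (measurableT_comp mA measurable_snd).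
  exact: (measurableT_comp mB measurable_fst).
have AB0 (x : T2) : (0 <= A x.2 * B x.1)%E by exact: mule_ge0.
have m4 : measurable_fun [set: T2] (fun x => (v x ^+ 4)%:E).
  by apply/measurable_EFinP; exact: (mfun2X 4 mv).
have p4 (x : T2) : 0 <= v x ^+ 4 by rewrite (_ : 4 = 2 * 2)%N// exprM sqr_ge0.
have le4 : (\int[leb2]_x (v x ^+ 4)%:E <= \int[leb2]_x (A x.2 * B x.1))%E.
  apply: ae_ge0_le_integral => //.
  - by move=> x _; rewrite lee_fin.
  - apply: ae2S2 b0 b1 => x lA lB _.
    by rewrite (_ : 4 = 2 + 2)%N// exprD EFinM lee_pmul// lee_fin sqr_ge0.
have E : (\int[leb2]_x (A x.2 * B x.1) = (\int[mu]_y A y) * (\int[mu]_y B y))%E.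
  rewrite (@fubini_tonelli1 _ _ T1 T1 R mu mu _ mAB AB0).
  rewrite /fubini_F -ge0_integralZl//; last exact: integral_ge0.
  apply: eq_integral => x _; transitivity (\int[mu]_y (B x * A y))%E.
    by apply: eq_integral => y _; rewrite muleC.
  by rewrite ge0_integralZl// muleC.
rewrite E !integral_line_bound// in le4.
have i4 : integ (fun x => v x ^+ 4).
  apply/integrableP; split => //.
  apply: le_lt_trans (ltry _).
  apply: le_trans le4; rewrite le_eqVlt; apply/orP; left; apply/eqP.
  by apply: eq_integral => x _ /=; rewrite ger0_norm.
split=> //; rewrite -lee_fin EFin_Int//; apply: (le_trans le4).
rewrite -EFinM lee_fin.
rewrite (_ : Int (fun x => (v \o swap2) x ^+ 2) = Int (fun x => v x ^+ 2)); last first.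
  exact: (Int_swap (sqint_sqr hv)).
rewrite (_ : Int (fun x => (g true \o swap2) x ^+ 2) = Int (fun x => g true x ^+ 2)); last first.
  exact: (Int_swap (sqint_sqr h1)).
by rewrite mulrACA (_ : 2 * 2 = 4)// -natrM.
Qed.
End Quartic.

(** * Inequalities for real powers *)

Section Power_inequalities.
Context {R : realType}.
Implicit Types (x y w p q r th : R) (f v : R * R -> R) (g : bool -> R * R -> R).

Lemma powR_nat x p n : 0 <= x -> p = n%:R -> x `^ p = x ^+ n.
Proof. by move=> x0 ->; exact: powR_mulrn. Qed.

Lemma powR_between x p q r : 0 <= x -> p <= q -> q <= r -> 0 < p ->
  x `^ q <= x `^ p + x `^ r.
Proof.
move=> x0 pq qr p0; have [x1|/ltW x1] := leP 1 x.
  by rewrite ler_wpDl ?powR_ge0// ler_powR.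
move: x0; rewrite le_eqVlt => /orP[/eqP <-|x0].
  by rewrite powR0 ?addr_ge0 ?powR_ge0// lt0r_neq0// (lt_le_trans p0).
by rewrite ler_wpDr ?powR_ge0// ger_powR// x0.
Qed.

Lemma powR_le_sqr_quartic x q : 0 <= x -> 0 <= q -> q <= 2 -> x `^ (q + 2) <= x ^+ 2 + x ^+ 4.
Proof.
move=> x0 q0 q2; rewrite -!powR_mulrn//; apply: powR_between => //.
- by rewrite lerDr.
- by lra.
Qed.

Lemma powR_le_lin_cube x q : 0 <= x -> 0 <= q -> q <= 2 -> x `^ (q + 1) <= x + x ^+ 3.
Proof.
move=> x0 q0 q2; rewrite -[X in _ <= X + _]powRr1// -powR_mulrn//; apply: powR_between => //.
- by rewrite lerDr.
- by lra.
Qed.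

(** On small x the first term dominates because q >= 1, on large x the second
   because q <= 2. *)
Lemma powR_le_small x q th : 0 <= x -> 1 <= q -> q <= 2 -> 0 < th -> th <= 1 ->
  x `^ (q + 2) <= th * x ^+ 2 + th^-1 * x ^+ 4.
Proof.
move=> x0 q1 q2 th0 th1; rewrite le_eqVlt in x0.
case/orP: x0 => [/eqP <-|x0]; first by rewrite powR0 ?expr0n ?mulr0 ?addr0// lt0r_neq0//; lra.
rewrite powRD ?(gt_eqF x0) ?implybT// (powR_nat (ltW x0) (erefl (2%:R))).
suff H : x `^ q <= th + th^-1 * x ^+ 2.
  have -> : th * x ^+ 2 + th^-1 * x ^+ 4 = (th + th^-1 * x ^+ 2) * x ^+ 2 by ring.
  by rewrite ler_wpM2r// sqr_ge0.
have thx : 0 <= th^-1 * x ^+ 2 by rewrite mulr_ge0 ?sqr_ge0// invr_ge0 ltW.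
have [x1|x1] := leP x 1.
  have lx : x `^ q <= x by rewrite -[leRHS]powRr1 ?(ltW x0)// ger_powR// x0.
  have [xth|/ltW thx'] := leP x th; first by rewrite (le_trans lx)// ler_wpDr.
  apply: (le_trans lx); rewrite ler_wpDl ?(ltW th0)// expr2 mulrA ler_peMl ?(ltW x0)//.
  by rewrite mulrC ler_pdivlMr ?mul1r.
apply: (@le_trans _ _ (x ^+ 2)).
  by rewrite -powR_mulrn ?(ltW x0)// ler_powR// ltW.
rewrite ler_wpDl ?(ltW th0)// ler_peMl ?sqr_ge0//.
by rewrite invf_ge1.
Qed.

(** Young's inequality with the conjugate exponents p and p / (p - 1): the
   graph of a convex power lies above its tangent at w >= 0. *)
Lemma powR_tangent p w y : 1 < p -> 0 <= w ->
  w `^ p + p * w `^ (p - 1) * (y - w) <= `|y| `^ p.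
Proof.
move=> p1 w0; have p0 : 0 < p by lra.
have [->|wN] := eqVneq w 0.
  by rewrite powR0 ?gt_eqF// powR0 ?subr_eq0 ?(gt_eqF p1)// mulr0 mul0r addr0 powR_ge0.
have w1 : 0 < w by rewrite lt_neqAle eq_sym wN.
have p10 : 0 < p - 1 by rewrite subr_gt0.
have cj : p^-1 + (p / (p - 1))^-1 = 1.
  by rewrite invfM invrK; field; rewrite ?(gt_eqF p10) ?(gt_eqF p0).
have := conjugate_powR (normr_ge0 y) (powR_ge0 w (p - 1)) p0 (divr_gt0 p0 p10) cj.
rewrite -powRrM mulrC [(p - 1) * _]mulrC divfK ?gt_eqF// => Y.
have E : w `^ p = w * w `^ (p - 1).
  by rewrite -[X in X * _](@powRr1 _ w)// -powRD ?wN ?implybT//; congr (_ `^ _); lra.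
have c0 := powR_ge0 w (p - 1).
have Y' : p * (w `^ (p - 1) * `|y|) <= `|y| `^ p + (p - 1) * w `^ p.
  have -> : `|y| `^ p + (p - 1) * w `^ p = p * (`|y| `^ p / p + w `^ p / (p / (p - 1))).
    by field; rewrite ?(gt_eqF p10) ?(gt_eqF p0).
  by rewrite ler_wpM2l ?(ltW p0)//.
have yy : p * (w `^ (p - 1) * y) <= p * (w `^ (p - 1) * `|y|).
  by rewrite ler_wpM2l ?(ltW p0)// ler_wpM2l// ler_norm.
move: (le_trans yy Y'); rewrite E; set c := w `^ (p - 1); set Z := `|y| `^ p; lra.
Qed.

Lemma powR_neg_Bernoulli y r : 0 < y -> 0 <= r -> 1 - r * (y - 1) <= y `^ (- r).
Proof.
move=> y0 r0; rewrite /powR (gt_eqF y0).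
apply: le_trans (expR_ge1Dx _); rewrite lerD2l mulNr lerN2 ler_wpM2l//.
have := @le_ln1Dx _ (y - 1); have -> : 1 + (y - 1) = y by lra.
  by apply; lra.
Qed.
End Power_inequalities.

(** * Integrability of the nonlinear terms *)

Section Moments.
Context {R : realType}.
Implicit Types (p q r th M : R) (f v w t : R * R -> R) (g : bool -> R * R -> R).

Lemma mfun2_abs_powR v q : mfun2 v -> mfun2 (fun x => `|v x| `^ q).
Proof. by move=> mv; apply: mfun2_powR; exact: mfun2_abs. Qed.

Lemma norm_even v n x : ~~ odd n -> `|v x| ^+ n = v x ^+ n.
Proof. by move=> e; rewrite -normrX ger0_norm// exprn_even_ge0. Qed.

Lemma H1_integ_quartic v g : sqint v -> has_grad v g -> integ (fun x => v x ^+ 4).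
Proof. by move=> hv hg; have [] := Ladyzhenskaya hv hg. Qed.

Lemma integ_moment v g q : sqint v -> has_grad v g -> 0 <= q -> q <= 2 ->
  integ (fun x => `|v x| `^ (q + 2)).
Proof.
move=> hv hg q0 q2.
apply: (@integ_le _ _ (fun x => v x ^+ 2 + v x ^+ 4)).
- by apply: mfun2_abs_powR; exact: sqint_mfun.
- move=> x; rewrite ger0_norm ?powR_ge0//.
  by have := powR_le_sqr_quartic (normr_ge0 (v x)) q0 q2; rewrite !norm_even.
- by apply: integD; [exact: sqint_sqr|exact: H1_integ_quartic hg].
Qed.

Lemma abs_cube_le x : `|x : R| ^+ 3 <= x ^+ 2 + x ^+ 4.
Proof.
have -> : x ^+ 4 = `|x| ^+ 4 by rewrite -normrX ger0_norm// exprn_even_ge0.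
have -> : x ^+ 2 = `|x| ^+ 2 by rewrite real_normK ?num_real.
have := sqr_ge0 (`|x| * (`|x| - 1)); have := sqr_ge0 `|x|; have := sqr_ge0 (`|x| ^+ 2); nra.
Qed.

Lemma integ_cube v g : sqint v -> has_grad v g -> integ (fun x => `|v x| ^+ 3).
Proof.
move=> hv hg; apply: (@integ_le _ _ (fun x => v x ^+ 2 + v x ^+ 4)).
- by apply: mfun2X; apply: mfun2_abs; exact: sqint_mfun.
- by move=> x; rewrite ger0_norm ?exprn_ge0//; exact: abs_cube_le.
- by apply: integD; [exact: sqint_sqr|exact: H1_integ_quartic hg].
Qed.

Lemma integ_moment_test w g t q : sqint w -> has_grad w g -> test_function t -> 0 <= q -> q <= 2 ->
  integ (fun x => `|w x| `^ (q + 1) * t x).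
Proof.
move=> hw hg tt q0 q2.
have [M vt] := (proj2 (proj1 (test_functionP t) tt)).
have [C C0 tC] := cont_vanishes_bounded (test_cont tt) vt.
apply: (@integ_le _ _ (fun x => `|w x * t x| + C * (`|w x| ^+ 3))).
- apply: mfun2M; first by apply: mfun2_abs_powR; exact: sqint_mfun.
  by apply: cont_mfun2; exact: test_cont.
- move=> x; rewrite normrM ger0_norm ?powR_ge0// normrM.
  apply: (@le_trans _ _ ((`|w x| + `|w x| ^+ 3) * `|t x|)).
    by rewrite ler_wpM2r// powR_le_lin_cube.
  by rewrite mulrDl lerD2l mulrC ler_wpM2r// exprn_ge0.
- apply: integD; first by apply: integ_abs; exact: test_integ_mul.
  by apply: integZ; exact: integ_cube hg.
Qed.
End Moments.

(** * The energy in blow-up variables *)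

Section Rescaled_energy.
Context {R : realType}.
Implicit Types (a c q e s : R) (f u v w t V : R * R -> R) (g gv gw : bool -> R * R -> R) (x z : R * R).

Definition dirichlet g : R := Int (gsq g).
Definition potential V e z v : R := Int (fun x => V (affmap e z x) * v x ^+ 2).
Definition moment q v : R := Int (fun x => `|v x| `^ (q + 2)).

(** Up to the factor e^-2 and for a suitable c, the energy in the variables y
   = (x - z) / e. *)
Definition functional V q c e z v g : R :=
  dirichlet g + e ^+ 2 * potential V e z v - c * moment q v.

Definition finite_potential V e z v := integ (fun x => V (affmap e z x) * v x ^+ 2).

(** The centre z' of a competitor is free, since a translate of the blow-up
   comes from an admissible function as well. *)
Definition rescaled_minimizer V q c e z w gw :=
  [/\ sqint w, has_grad w gw, Int (fun x => w x ^+ 2) = 1, finite_potential V e z w &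
      forall v gv z', sqint v -> has_grad v gv -> finite_potential V e z' v ->
        Int (fun x => v x ^+ 2) = 1 ->
        functional V q c e z w gw <= functional V q c e z' v gv].

(** The inverse of the blow-up at z. *)
Definition unscale e z v x : R := e^-1 * v (affmap e^-1 (- (e^-1 *: z)) x).

Lemma dirichlet_ge0 g : 0 <= dirichlet g.
Proof. by apply: Int_ge0 => x; rewrite /gsq addr_ge0 ?sqr_ge0. Qed.

Lemma potential_ge0 V e z v : (forall x, 0 <= V x) -> 0 <= potential V e z v.
Proof. by move=> V0; apply: Int_ge0 => x; rewrite mulr_ge0 ?sqr_ge0. Qed.

Lemma moment_ge0 q v : 0 <= moment q v.
Proof. by apply: Int_ge0 => x; exact: powR_ge0. Qed.

Lemma dirichlet_unique u g g' : has_grad u g -> has_grad u g' -> dirichlet g = dirichlet g'.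
Proof.
move=> hg hg'; apply: aeeq_Int; last exact: gsq_unique hg hg'.
- exact: integ_mfun (gsq_integ hg).
- exact: integ_mfun (gsq_integ hg').
Qed.

Lemma unscale_rescale e z u : 0 < e -> unscale e z (rescale e u z) = u.
Proof.
move=> e0; apply/funext => x; rewrite /unscale /rescale mulrA mulVf ?gt_eqF// mul1r.
congr u; rewrite /affmap scalerDr scalerN !scalerA divff ?gt_eqF// !scale1r addrNK//.
Qed.

Lemma affmapKV e z x : e != 0 -> affmap e z (affmap e^-1 (- (e^-1 *: z)) x) = x.
Proof.
by move=> e0; rewrite /affmap scalerDr scalerN !scalerA divff// !scale1r addrNK.
Qed.

Section Unscale.
Variables (V v : R * R -> R) (gv : bool -> R * R -> R) (e : R) (z : R * R).
Hypotheses (e0 : 0 < e) (hv : sqint v) (hgv : has_grad v gv).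
Let T := affmap e^-1 (- (e^-1 *: z)).
Let ei : 0 < e^-1. Proof. by rewrite invr_gt0. Qed.
Let PT : preserves (e^-1 ^+ 2) T. Proof. exact: preserves_affine. Qed.

Lemma sqint_unscale : sqint (unscale e z v).
Proof. by apply: sqintZ; exact: sqint_affine. Qed.

Lemma has_grad_unscale : has_grad (unscale e z v) (fun i x => e^-1 * (e^-1 * gv i (T x))).
Proof.
by apply: has_gradZ; [exact: sqint_affine|exact: has_grad_affine].
Qed.

Lemma Int_sqr_unscale : Int (fun x => unscale e z v x ^+ 2) = Int (fun x => v x ^+ 2).
Proof.
transitivity (e^-1 ^+ 2 * Int ((fun x => v x ^+ 2) \o T)); last first.
  exact: (preserves_Int PT (sqint_sqr hv)).
rewrite -IntZ; first by apply: eq_Int => x; rewrite /unscale exprMn.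
exact: (preserves_integ PT (sqint_sqr hv)).
Qed.

Lemma dirichlet_unscale :
  dirichlet (fun i x => e^-1 * (e^-1 * gv i (T x))) = e^-1 ^+ 2 * dirichlet gv.
Proof.
have ig := gsq_integ hgv.
rewrite -[dirichlet gv](preserves_Int PT ig) -IntZ; last exact: preserves_integ PT ig.
rewrite /dirichlet -IntZ; last by apply: integZ; exact: preserves_integ PT ig.
by apply: eq_Int => x; rewrite /gsq /=; ring.
Qed.

Lemma integ_V_unscale : finite_potential V e z v ->
  integ (fun x => V x * unscale e z v x ^+ 2) /\
  Int (fun x => V x * unscale e z v x ^+ 2) = potential V e z v.
Proof.
move=> fv; have E : (fun x => V x * unscale e z v x ^+ 2) =
    (fun x => e^-1 ^+ 2 * ((fun x => V (affmap e z x) * v x ^+ 2) \o T) x).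
  apply/funext => x; rewrite /= affmapKV ?gt_eqF// /unscale exprMn -/T; ring.
rewrite E; split; first by apply: integZ; exact: (preserves_integ PT fv).
rewrite IntZ; last exact: (preserves_integ PT fv).
exact: (preserves_Int PT fv).
Qed.

Lemma moment_unscale q : 0 < q -> q <= 2 ->
  moment q (unscale e z v) = e^-1 `^ q * moment q v.
Proof.
move=> q0 q2; have im := integ_moment hv hgv (ltW q0) q2.
rewrite -[moment q v](preserves_Int PT im) -IntZ; last exact: preserves_integ PT im.
rewrite -IntZ; last by apply: integZ; exact: preserves_integ PT im.
apply: eq_Int => x; rewrite /unscale normrM (gtr0_norm ei) powRM ?(ltW ei)//.
rewrite powRD ?(gt_eqF ei) ?implybT// (powR_nat (ltW ei) (erefl 2%:R)) -mulrA//.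
Qed.

Lemma energy_unscale a q : 0 < q -> q <= 2 -> finite_potential V e z v ->
  energy V a q (unscale e z v) =
    e^-1 ^+ 2 * functional V q (2 * a / (q + 2) * e `^ (2 - q)) e z v gv.
Proof.
move=> q0 q2 fv; have [iV EV] := integ_V_unscale fv.
have hU := has_grad_unscale.
have HU : H1 (unscale e z v).
  by apply/H1P; split; [exact: sqint_unscale|exists (fun i x => e^-1 * (e^-1 * gv i (T x)))].
have iG : integ (grad_sq (unscale e z v)).
  have -> : grad_sq (unscale e z v) = gsq (wpartial^~ (unscale e z v)).
    by apply/funext => x; rewrite grad_sqE.
  exact: gsq_integ (wpartialP HU).
have EG : Int (grad_sq (unscale e z v)) = e^-1 ^+ 2 * dirichlet gv.
  rewrite -dirichlet_unscale -(dirichlet_unique (wpartialP HU) hU).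
  by apply: eq_Int => x; rewrite grad_sqE.
have -> : energy V a q (unscale e z v) =
  Int (fun x => grad_sq (unscale e z v) x + V x * unscale e z v x ^+ 2) -
  2 * a / (q + 2) * moment q (unscale e z v) by [].
rewrite IntD// EG EV moment_unscale// /functional.
have eN : e != 0 by rewrite gt_eqF.
have -> : e^-1 `^ q = e^-1 ^+ 2 * e `^ (2 - q).
  rewrite powRD ?eN ?implybT// (powR_nat (ltW e0) (erefl 2%:R)) powRN mulrA -exprMn mulVf//.
  by rewrite expr1n mul1r -powR_inv1 ?(ltW e0)// -powRrM mulN1r powRN.
by field; rewrite eN andbT gt_eqF//; lra.
Qed.
End Unscale.

Lemma minimizer_le V a q u v : minimizer V a q u -> H1 v ->
  integ (fun x => V x * v x ^+ 2) -> Int (fun x => v x ^+ 2) = 1 ->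
  energy V a q u <= energy V a q v.
Proof.
move=> [_ uE] Hv iV v1; rewrite -lee_fin uE; apply: ereal_inf_lbound.
exists v => //; split=> //; split=> //.
by rewrite -EFin_Int// ltry.
Qed.

Lemma minimizer_integ V a q u : continuous V -> (forall x, 0 <= V x) -> minimizer V a q u ->
  integ (fun x => V x * u x ^+ 2).
Proof.
move=> cV V0 [[[/H1P[hu _] uV] _] _]; apply/integrableP; split.
  apply/measurable_EFinP; apply: mfun2M; first exact: cont_mfun2.
  exact: (mfun2X 2 (sqint_mfun hu)).
apply: le_lt_trans uV; rewrite le_eqVlt; apply/orP; left; apply/eqP.
by apply: eq_integral => x _ /=; rewrite ger0_norm// mulr_ge0 ?sqr_ge0.
Qed.

(** All terms of the energy are homogeneous under the blow-up, and the
   constant c collects the powers of e. *)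
Lemma minimizer_rescaled V a q u e z gw : continuous V -> (forall x, 0 <= V x) ->
  0 < q -> q <= 2 -> 0 < e -> minimizer V a q u -> has_grad (rescale e u z) gw ->
  rescaled_minimizer V q (2 * a / (q + 2) * e `^ (2 - q)) e z (rescale e u z) gw.
Proof.
move=> cV V0 q0 q2 e0 mu hgw.
have iV := minimizer_integ cV V0 mu.
have [[[/H1P[hu [g hg]] _] u1] _] := mu.
have hw : sqint (rescale e u z) by apply: sqintZ; exact: (sqint_affine z e0 hu).
have PT := preserves_affine z e0.
have fw : finite_potential V e z (rescale e u z).
  rewrite /finite_potential; have -> : (fun x => V (affmap e z x) * rescale e u z x ^+ 2) =
     (fun x => e ^+ 2 * ((fun x => V x * u x ^+ 2) \o affmap e z) x).
    by apply/funext => x; rewrite /rescale /= exprMn /affmap mulrCA.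
  by apply: integZ; exact: (preserves_integ PT iV).
split=> //.
  by rewrite -(Int_sqr_unscale z e0 hw) unscale_rescale.
move=> v gv z' hv hgv fv v1.
have := energy_unscale e0 hw hgw a q0 q2 fw; rewrite unscale_rescale// => Eu.
have Ev := energy_unscale e0 hv hgv a q0 q2 fv.
have [iVv _] := integ_V_unscale e0 fv.
have : energy V a q u <= energy V a q (unscale e z' v).
  apply: minimizer_le => //; last by rewrite Int_sqr_unscale.
  apply/H1P; split; first exact: sqint_unscale.
  by exists (fun i x => e^-1 * (e^-1 * gv i (affmap e^-1 (- (e^-1 *: z')) x))); exact: has_grad_unscale.
by rewrite Eu Ev ler_pM2l// exprn_gt0// invr_gt0.
Qed.
End Rescaled_energy.

(** * The Euler-Lagrange equation *)

Section Euler_Lagrange.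
Context {R : realType}.
Implicit Types (a c q e s M : R) (f u v w t V : R * R -> R) (g gv gw : bool -> R * R -> R) (x z : R * R).

(** The Lagrange multiplier of the mass constraint. *)
Definition multiplier V q c e z w g : R :=
  dirichlet g + e ^+ 2 * potential V e z w - c * (q + 2) / 2 * moment q w.

(** Minimality against a competitor of arbitrary mass, after normalisation.
   The power of the mass in front of the nonlinear term is bounded below by
   Bernoulli's inequality. *)
Lemma minimality_linear V q c e z w gw v gv z' : rescaled_minimizer V q c e z w gw ->
  0 < q -> q <= 2 -> 0 <= c ->
  sqint v -> has_grad v gv -> finite_potential V e z' v -> 0 < Int (fun x => v x ^+ 2) ->
  functional V q c e z w gw * Int (fun x => v x ^+ 2) <=
    dirichlet gv + e ^+ 2 * potential V e z' v
    - c * moment q v * (1 - q / 2 * (Int (fun x => v x ^+ 2) - 1)).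
Proof.
move=> [_ _ _ _ wmin] q0 q2 c0 hv hgv fv; set N := Int _ => N0.
pose s := (Num.sqrt N)^-1.
have s0 : 0 < s by rewrite invr_gt0 sqrtr_gt0.
have s2 : s ^+ 2 = N^-1 by rewrite exprVn sqr_sqrtr// ltW.
have hsv := sqintZ s hv; have hsg := has_gradZ s hv hgv.
have Es : (fun x => V (affmap e z' x) * (s * v x) ^+ 2) =
    (fun x => N^-1 * (V (affmap e z' x) * v x ^+ 2)).
  by apply/funext => x; rewrite exprMn s2 mulrCA.
have fsv : finite_potential V e z' (fun x => s * v x) by rewrite /finite_potential Es; exact: integZ.
have sN : Int (fun x => (s * v x) ^+ 2) = 1.
  rewrite (@eq_Int _ _ (fun x => s ^+ 2 * v x ^+ 2)); last by move=> x; rewrite exprMn.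
  by rewrite IntZ ?s2 ?mulVf ?gt_eqF//; exact: sqint_sqr.
have := wmin _ _ z' hsv hsg fsv sN.
set F := functional _ _ _ _ _ w _; rewrite /functional.
have -> : dirichlet (fun i x => s * gv i x) = N^-1 * dirichlet gv.
  rewrite /dirichlet -IntZ; last exact: gsq_integ hgv.
  by apply: eq_Int => x; rewrite /gsq !exprMn s2 mulrDr.
have -> : potential V e z' (fun x => s * v x) = N^-1 * potential V e z' v.
  by rewrite /potential Es IntZ.
have sq : s `^ q = N `^ (- (q / 2)).
  have -> : s = N `^ (- 2^-1) by rewrite powRN powR12_sqrt ?(ltW N0).
  by rewrite -powRrM; congr (_ `^ _); lra.
have -> : moment q (fun x => s * v x) = N^-1 * N `^ (- (q / 2)) * moment q v.
  rewrite -IntZ; last exact: (integ_moment hv hgv (ltW q0) q2).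
  apply: eq_Int => x; rewrite normrM (gtr0_norm s0) powRM ?(ltW s0)//.
  by rewrite powRD ?(gt_eqF s0) ?implybT// (powR_nat (ltW s0) (erefl 2%:R)) s2 sq [N^-1 * _]mulrC.
move=> H; have {}H : F * N <= dirichlet gv + e ^+ 2 * potential V e z' v - c * moment q v * N `^ (- (q / 2)).
  have NN : N != 0 by rewrite gt_eqF.
  rewrite -ler_pdivlMr//; apply: (le_trans H); rewrite le_eqVlt; apply/orP; left; apply/eqP.
  by field.
apply: (le_trans H); rewrite lerD2l lerN2 ler_wpM2l ?mulr_ge0 ?moment_ge0//.
by apply: powR_neg_Bernoulli => //; rewrite divr_ge0// ltW.
Qed.

Lemma linear_coef_eq0 (s0 A1 A2 A3 : R) : 0 < s0 ->
  (forall s, `|s| <= s0 -> 0 <= s * A1 + s ^+ 2 * A2 + s ^+ 3 * A3) -> A1 = 0.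
Proof.
move=> s00 H; apply/eqP; apply: contraT => A10.
have a0 : 0 < `|A1| by rewrite normr_gt0.
pose D := `|A2| + `|A1| * `|A3| + 1.
have D0 : 0 < D by rewrite ltr_wpDl// addr_ge0// mulr_ge0.
pose k := Num.min 1 (Num.min (s0 / `|A1|) (2 * D)^-1).
have k0 : 0 < k by rewrite !lt_min ltr01 divr_gt0//= invr_gt0 mulr_gt0.
have k1 : k <= 1 by rewrite /k ge_min lexx.
have ks : k * `|A1| <= s0 by rewrite -ler_pdivlMr// /k !ge_min lexx !orbT.
have kD : k * D <= 2^-1.
  by rewrite -ler_pdivlMr// -invfM /k !ge_min lexx !orbT.
have := H (- (k * A1)); rewrite normrN normrM (gtr0_norm k0) => /(_ ks).
have le2 : A2 <= `|A2| by exact: ler_norm.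
have le3 : - (A1 * A3) <= `|A1| * `|A3| by rewrite -normrM -normrN ler_norm.
have E : - (k * A1) * A1 + (- (k * A1)) ^+ 2 * A2 + (- (k * A1)) ^+ 3 * A3 =
  k * A1 ^+ 2 * (k * (A2 + k * - (A1 * A3)) - 1) by ring.
rewrite E; have P0 : 0 < k * A1 ^+ 2 by rewrite mulr_gt0// exprn_even_gt0.
rewrite pmulr_rge0// leNgt => /negP[].
rewrite subr_lt0; apply: (@le_lt_trans _ _ (k * D)); last by lra.
rewrite ler_wpM2l ?(ltW k0)// /D ler_wpDr// lerD//.
have [n|/ltW p] := leP 0 (- (A1 * A3)).
  by apply: le_trans le3; rewrite ler_piMl.
by apply: (@le_trans _ _ 0); [rewrite pmulr_rle0|rewrite mulr_ge0].
Qed.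

Definition lap t x : R := partial false (partial false t) x + partial true (partial true t) x.

Lemma test_lap t : test_function t -> test_function (lap t).
Proof.
move=> tt; have h i := test_partial i (test_partial i tt).
have /test_functionP[s0 [M0 v0]] := h false; have /test_functionP[s1 [M1 v1]] := h true.
apply/test_functionP; split; first by move=> k; exact: (CnD (s0 k) (s1 k)).
exists (Num.max M0 M1) => x; rewrite gt_max => /andP[x0 x1].
by rewrite /lap v0// v1// addr0.
Qed.

Lemma Int_grad_test w g t : sqint w -> has_grad w g -> test_function t ->
  Int (fun x => g false x * partial false t x + g true x * partial true t x) = - Int (fun x => w x * lap t x).
Proof.
move=> hw hg tt.
have ii i : integ (fun x => g i x * partial i t x).
  by apply: test_integ_mul; [exact: has_grad_sqint hg|exact: test_partial].
have jj i : integ (fun x => w x * partial i (partial i t) x).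
  by apply: test_integ_mul => //; do 2 apply: test_partial.
have E i : Int (fun x => g i x * partial i t x) = - Int (fun x => w x * partial i (partial i t) x).
  have [_ /weak_partialE wi] := hg i.
  by rewrite (wi _ (test_partial i tt)) opprK.
rewrite IntD// !E -opprD -IntD//; congr (- _); apply: eq_Int => x; rewrite /lap mulrDr//.
Qed.

Lemma integ_V_mul V e z w t : continuous V -> sqint w -> test_function t ->
  integ (fun x => V (affmap e z x) * (w x * t x)).
Proof.
move=> cV hw tt; have [M vt] := (proj2 (proj1 (test_functionP t) tt)).
have cVt : continuous (fun x => V (affmap e z x) * t x).
  apply: contM; last exact: test_cont.
  by move=> x; apply: continuous_comp; [exact: affmap_cont|exact: cV].
have hVt : sqint (fun x => V (affmap e z x) * t x).
  by apply: (csupp_cont_sqint (M := M) cVt) => x Mx; rewrite vt// mulr0.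
by have := integ_mul hw hVt; under eq_fun do rewrite mulrCA.
Qed.

(** The first variation: t is added to w with a small factor s of either sign,
   and the s-linear coefficient of the resulting cubic inequality in s must
   vanish. As w is nonnegative, the nonlinear term is bounded below by its
   tangent, so it need not be differentiated. *)
Lemma Euler_Lagrange V q c e z w gw t : continuous V -> 0 < q -> q <= 2 -> 0 <= c ->
  rescaled_minimizer V q c e z w gw -> {ae leb2, forall x, 0 <= w x} -> test_function t ->
  - Int (fun x => w x * lap t x) + e ^+ 2 * Int (fun x => V (affmap e z x) * (w x * t x))
   - c * (q + 2) / 2 * Int (fun x => `|w x| `^ (q + 1) * t x) =
  multiplier V q c e z w gw * Int (fun x => w x * t x).
Proof.
move=> cV q0 q2 c0 wm w0 tt; have [hw hg w1 fw _] := wm.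
have ht := test_sqint tt; have hgt := has_grad_test tt.
set L1 := Int (fun x => w x * lap t x); set L2 := Int (fun x => V _ * (w x * t x)).
set P := Int (fun x => _ `^ _ * _); set S := Int (fun x => w x * t x).
pose TT := Int (fun x => t x ^+ 2); pose Dt := dirichlet (partial^~ t).
pose Vt := potential V e z t.
have iVwt : integ (fun x => V (affmap e z x) * (w x * t x)) by exact: integ_V_mul.
have iVtt : integ (fun x => V (affmap e z x) * t x ^+ 2).
  by have := integ_V_mul e z cV ht tt; under eq_fun do rewrite -expr2.
have TT0 : 0 <= TT by exact: Int_sqr_ge0.
have hv s := sqintD hw (sqintZ s ht).
have hgv s := has_gradD hw (sqintZ s ht) hg (has_gradZ s ht hgt).
have Nv s : Int (fun x => (w x + s * t x) ^+ 2) = 1 + (2 * s * S + s ^+ 2 * TT).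
  by rewrite Int_sqrD// w1 addrA.
have Dv s : dirichlet (fun i x => gw i x + s * partial i t x) =
    dirichlet gw - 2 * s * L1 + s ^+ 2 * Dt.
  pose J i := Int (fun x => gw i x * partial i t x).
  pose D0 i := Int (fun x => gw i x ^+ 2); pose D1 i := Int (fun x => partial i t x ^+ 2).
  have E0 i : Int (fun x => (gw i x + s * partial i t x) ^+ 2) = D0 i + 2 * s * J i + s ^+ 2 * D1 i.
    by rewrite Int_sqrD//; [exact: has_grad_sqint hg|exact: has_grad_sqint hgt].
  have sp g u : has_grad u g -> dirichlet g = Int (fun x => g false x ^+ 2) + Int (fun x => g true x ^+ 2).
    move=> h; rewrite /dirichlet /gsq IntD//; apply: sqint_sqr; exact: has_grad_sqint h.
  have iJ i : integ (fun x => gw i x * partial i t x).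
    by apply: test_integ_mul; [exact: has_grad_sqint hg|exact: test_partial].
  have HL : L1 = - (J false + J true).
    by rewrite /L1 -[LHS]opprK -(Int_grad_test hw hg tt) IntD.
  rewrite (sp _ _ (hgv s)) !E0 (sp _ _ hg) /Dt (sp _ _ hgt) -/(D0 false) -/(D0 true) -/(D1 false) -/(D1 true) HL.
  move: (J false) (J true) (D0 false) (D0 true) (D1 false) (D1 true) => j0 j1 a0 a1 b0 b1.
  clear; ring.
have fpE s : (fun x => V (affmap e z x) * (w x + s * t x) ^+ 2) =
   (fun x => V (affmap e z x) * w x ^+ 2 + (2 * s * (V (affmap e z x) * (w x * t x)) +
     s ^+ 2 * (V (affmap e z x) * t x ^+ 2))).
  by apply/funext => x; ring.
have i2 s : integ (fun x => 2 * s * (V (affmap e z x) * (w x * t x)) +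
     s ^+ 2 * (V (affmap e z x) * t x ^+ 2)) by apply: integD; exact: integZ.
have fv s : finite_potential V e z (fun x => w x + s * t x).
  by rewrite /finite_potential fpE; apply: integD.
have Pv s : potential V e z (fun x => w x + s * t x) = potential V e z w + (2 * s * L2 + s ^+ 2 * Vt).
  by rewrite /potential fpE IntD// IntD ?IntZ//; exact: integZ.
have iP := integ_moment_test hw hg tt (ltW q0) q2.
have iB := integ_moment hw hg (ltW q0) q2.
have Bv s : moment q w + (q + 2) * s * P <= moment q (fun x => w x + s * t x).
  rewrite -IntZ// -IntD//; last exact: integZ.
  have i3 := integ_moment (hv s) (hgv s) (ltW q0) q2.
  have Ew : aeeq (fun x => Num.min (`|w x| `^ (q + 2) + (q + 2) * s * (`|w x| `^ (q + 1) * t x))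
      (`|w x + s * t x| `^ (q + 2))) (fun x => `|w x| `^ (q + 2) + (q + 2) * s * (`|w x| `^ (q + 1) * t x)).
    apply: ae2S w0 => x wx; apply/min_idPl.
    have := @powR_tangent _ (q + 2) (w x) (w x + s * t x) _ wx.
    rewrite (ger0_norm wx); have -> : q + 2 - 1 = q + 1 by ring.
    rewrite addrAC subrr add0r => H; apply: le_trans (H _); last by lra.
    by rewrite lerD2l le_eqVlt; apply/orP; left; apply/eqP; ring.
  have mm : mfun2 (fun x => `|w x| `^ (q + 2) + (q + 2) * s * (`|w x| `^ (q + 1) * t x)).
    by apply: integ_mfun; apply: integD => //; exact: integZ.
  have mmin : mfun2 (fun x => Num.min (`|w x| `^ (q + 2) + (q + 2) * s * (`|w x| `^ (q + 1) * t x))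
      (`|w x + s * t x| `^ (q + 2))).
    by apply: (measurable_minr mm); exact: integ_mfun i3.
  rewrite -(aeeq_Int mmin mm Ew); apply: Int_le => //.
    apply: (aeeq_integ mmin (aeeq_sym Ew)); by apply: integD => //; exact: integZ.
  by move=> x; rewrite ge_min lexx orbT.
set F := functional V q c e z w gw.
pose y s := 2 * s * S + s ^+ 2 * TT.
(* For such s the mass differs from 1 by at most 1/2, so the linearised power
   stays nonnegative. *)
pose s0 := (4 * (`|S| + TT + 1))^-1.
have d0 : 0 < `|S| + TT + 1 by rewrite ltr_wpDl// addr_ge0.
have s00 : 0 < s0 by rewrite invr_gt0 mulr_gt0.
have ys s : `|s| <= s0 -> `|y s| <= 2^-1.
  move=> ss; have s01 : s0 <= 4^-1.
    by rewrite /s0 invfM ler_piMr// invf_le1// ler_wpDl// addr_ge0.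
  apply: (@le_trans _ _ (2 * `|s| * (`|S| + TT))).
    rewrite mulrDr (le_trans (ler_normD _ _))// lerD//.
      by rewrite !normrM (@ger0_norm _ 2).
    rewrite normrM (ger0_norm TT0) ler_wpM2r// normrX expr2 ler_wpM2r//.
    by move: (le_trans ss s01); move: `|s|; clear => k; lra.
  have : s0 * (`|S| + TT) <= 4^-1.
    rewrite /s0 invfM -mulrA ler_piMr// mulrC ler_pdivrMr// mul1r; lra.
  have : `|s| * (`|S| + TT) <= s0 * (`|S| + TT) by rewrite ler_wpM2r// addr_ge0.
  set A := `|S| + TT; move=> h1 h2; rewrite -mulrA; lra.
have ineq s : `|s| <= s0 -> F * (1 + y s) <= dirichlet gw - 2 * s * L1 + s ^+ 2 * Dt +
   e ^+ 2 * (potential V e z w + (2 * s * L2 + s ^+ 2 * Vt)) -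
   c * (moment q w + (q + 2) * s * P) * (1 - q / 2 * y s).
  move=> /ys ys'; have [y1 y2] : - 2^-1 <= y s /\ y s <= 2^-1 by apply/andP; rewrite -ler_norml.
  have N0 : 0 < Int (fun x => (w x + s * t x) ^+ 2).
    by rewrite Nv -/(y s); apply: (@lt_le_trans _ _ 2^-1); [rewrite invr_gt0|lra].
  have := minimality_linear wm q0 q2 c0 (hv s) (hgv s) (fv s) N0.
  rewrite Dv Pv Nv -/(y s) -/F => H; apply: (le_trans H).
  rewrite lerD2l lerN2 (_ : 1 + y s - 1 = y s); last by ring.
  rewrite ler_wpM2r//.
    have : q / 2 * y s <= q / 2 * 2^-1 by rewrite ler_wpM2l// divr_ge0// ltW.
    lra.
  by rewrite ler_wpM2l.
have := @linear_coef_eq0 s0 (- (2 * L1) + e ^+ 2 * (2 * L2) - c * (q + 2) * P + c * moment q w * (q / 2) * (2 * S) - F * (2 * S))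
  (Dt + e ^+ 2 * Vt + c * (q + 2) * P * (q / 2) * (2 * S) + c * moment q w * (q / 2) * TT - F * TT)
  (c * (q + 2) * P * (q / 2) * TT) s00.
have FE : F = dirichlet gw + e ^+ 2 * potential V e z w - c * moment q w by [].
move=> /(_ _) H; suff : 2 * (- L1 + e ^+ 2 * L2 - c * (q + 2) / 2 * P - multiplier V q c e z w gw * S) = 0.
  by move=> /eqP; rewrite mulf_eq0 pnatr_eq0/= subr_eq0 => /eqP.
have alg1 (d p m l1 l2 P' S' : R) :
    2 * (- l1 + e ^+ 2 * l2 - c * (q + 2) / 2 * P' - (d + e ^+ 2 * p - c * (q + 2) / 2 * m) * S') =
    - (2 * l1) + e ^+ 2 * (2 * l2) - c * (q + 2) * P' + c * m * (q / 2) * (2 * S') -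
      (d + e ^+ 2 * p - c * m) * (2 * S') by field.
have alg2 (s d p m l1 l2 P' S' T D' V' : R) :
    d - 2 * s * l1 + s ^+ 2 * D' + e ^+ 2 * (p + (2 * s * l2 + s ^+ 2 * V')) -
      c * (m + (q + 2) * s * P') * (1 - q / 2 * (2 * s * S' + s ^+ 2 * T)) -
      (d + e ^+ 2 * p - c * m) * (1 + (2 * s * S' + s ^+ 2 * T)) =
    s * (- (2 * l1) + e ^+ 2 * (2 * l2) - c * (q + 2) * P' + c * m * (q / 2) * (2 * S') -
      (d + e ^+ 2 * p - c * m) * (2 * S')) +
    s ^+ 2 * (D' + e ^+ 2 * V' + c * (q + 2) * P' * (q / 2) * (2 * S') + c * m * (q / 2) * T -
      (d + e ^+ 2 * p - c * m) * T) +
    s ^+ 3 * (c * (q + 2) * P' * (q / 2) * T) by field.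
rewrite -[RHS]H; first by rewrite FE; exact: alg1.
move=> s /ineq; rewrite -subr_ge0 => /le_trans; apply; rewrite le_eqVlt; apply/orP; left; apply/eqP.
by rewrite FE; exact: alg2.
Qed.
End Euler_Lagrange.

(** * Cutoffs and the quartic norm of a tail *)

Section Cutoff.
Context {R : realType}.
Implicit Types (a c q e s M r th rho k : R) (f h u v w t V : R * R -> R) (g gv gw : bool -> R * R -> R) (x z : R * R).
Local Notation T2 := (measurableTypeR R * measurableTypeR R)%type.

Definition off r x : R := (r < `|x|)%R%:R.

Lemma off_ge0 r x : 0 <= off r x. Proof. by rewrite /off ler0n. Qed.
Lemma off_le1 r x : off r x <= 1. Proof. by rewrite /off; case: (_ < _). Qed.

Lemma off_le r r' x : r' <= r -> off r x <= off r' x.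
Proof.
move=> rr; rewrite /off; have [h|h] := ltP r `|x|; last by rewrite ler0n.
by rewrite (le_lt_trans rr h).
Qed.

Lemma offE r : off r = \1_(~` box r).
Proof.
apply/funext => x; rewrite indicE /off; congr (_%:R); rewrite /box.
have [h|h] := ltP r `|x|; [rewrite mem_set//=|rewrite memNset//=].
  by apply/negP; rewrite -ltNge.
Qed.

Lemma mfun2_off r : mfun2 (off r).
Proof. by rewrite offE; apply: mfun2_indic; apply: measurableC; exact: box_measurable. Qed.

Lemma integ_off r f : integ f -> integ (fun x => off r x * f x).
Proof.
by apply: (@integM _ _ _ 1); [exact: mfun2_off|move=> x; rewrite ger0_norm ?off_ge0 ?off_le1].
Qed.

(** The H^1 mass outside the square of half-width r. *)
Definition tail r w g : R := Int (fun x => off r x * (w x ^+ 2 + gsq g x)).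

Lemma gsq_ge0 g x : 0 <= gsq g x. Proof. by rewrite /gsq addr_ge0 ?sqr_ge0. Qed.

Lemma H1density_ge0 w g x : 0 <= w x ^+ 2 + gsq g x.
Proof. by rewrite addr_ge0 ?sqr_ge0 ?gsq_ge0. Qed.

Lemma H1density_integ w g : sqint w -> has_grad w g -> integ (fun x => w x ^+ 2 + gsq g x).
Proof. by move=> hw hg; apply: integD; [exact: sqint_sqr|exact: gsq_integ hg]. Qed.

Lemma tail_ge0 r w g : 0 <= tail r w g.
Proof. by apply: Int_ge0 => x; rewrite mulr_ge0 ?off_ge0 ?H1density_ge0. Qed.

Lemma tail_le r r' w g : sqint w -> has_grad w g -> r' <= r -> tail r w g <= tail r' w g.
Proof.
move=> hw hg rr; apply: Int_le; [exact/integ_off/H1density_integ..|].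
by move=> x; rewrite ler_wpM2r ?H1density_ge0// off_le.
Qed.

Definition cutoff1 x : R := step (1 * x.1 + 2) * step (- 1 * x.1 + 2) * (step (1 * x.2 + 2) * step (- 1 * x.2 + 2)).
Definition cutoff r x : R := cutoff1 (affmap r^-1 0 x).

Lemma smooth_cutoff1 : smooth cutoff1.
Proof. by move=> k; do 2 apply: CnM; first [exact: Cn_step1|exact: Cn_step2|apply: CnM]; first [exact: Cn_step1|exact: Cn_step2]. Qed.

Lemma smooth_cutoff r : smooth (cutoff r).
Proof. by move=> k; exact: (Cn_affine r^-1 0 (smooth_cutoff1 k)). Qed.

Lemma cutoff1_ge0 x : 0 <= cutoff1 x.
Proof.
have m2 (s t : R) : 0 <= step s * step t by apply: mulr_ge0; exact: step_ge0.
exact: mulr_ge0 (m2 _ _) (m2 _ _).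
Qed.

Lemma cutoff1_le1 x : cutoff1 x <= 1.
Proof.
have m2 (s t : R) : 0 <= step s * step t by apply: mulr_ge0; exact: step_ge0.
have l2 (s t : R) : step s * step t <= 1.
  by apply: mulr_ile1; rewrite ?step_ge0 ?step_le1.
exact: mulr_ile1.
Qed.

Lemma cutoff_ge0 r x : 0 <= cutoff r x. Proof. exact: cutoff1_ge0. Qed.
Lemma cutoff_le1 r x : cutoff r x <= 1. Proof. exact: cutoff1_le1. Qed.

Lemma cutoff1_eq1 x : `|x| <= 1 -> cutoff1 x = 1.
Proof.
rewrite normp_le !ler_norml => /andP[/andP[a b] /andP[c d]].
by rewrite /cutoff1 !step_ge1 ?mulr1//; lra.
Qed.

Lemma cutoff1_eq0 x : 2 < `|x| -> cutoff1 x = 0.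
Proof.
move=> h; apply/eqP; apply: contraTT h => h; rewrite -leNgt normp_le !ler_norml.
have nz (s t : R) : s * t != 0 -> s != 0 /\ t != 0 by rewrite mulf_eq0 negb_or => /andP[].
have [/nz[a b] /nz[c d]] := nz _ _ h.
have st (s : R) : step s != 0 -> 0 < s by apply: contraNT; rewrite -leNgt => /step_le0 ->.
by move: (st _ a) (st _ b) (st _ c) (st _ d); clear; move: x.1 x.2 => s1 s2 *; apply/andP; split; apply/andP; split; lra.
Qed.

Lemma affmap0_norm r x : 0 < r -> `|affmap r^-1 0 x| = `|x| / r.
Proof.
by move=> r0; rewrite /affmap addr0 normrZ gtr0_norm ?invr_gt0// mulrC.
Qed.

Lemma cutoff_eq1 r x : 0 < r -> `|x| <= r -> cutoff r x = 1.
Proof. by move=> r0 xr; apply: cutoff1_eq1; rewrite affmap0_norm// ler_pdivrMr// mul1r. Qed.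

Lemma cutoff_eq0 r x : 0 < r -> 2 * r < `|x| -> cutoff r x = 0.
Proof. by move=> r0 xr; apply: cutoff1_eq0; rewrite affmap0_norm// ltr_pdivlMr. Qed.

Lemma partial_cutoff1_eq0 i x : `|x| < 1 -> partial i cutoff1 x = 0.
Proof.
move=> x1; rewrite /partial -[RHS](derive_cst (1 : R) x (basis_vec i)).
apply: near_eq_derive; have : open ((fun y : R * R => `|y|) @^-1` [set r : R | r < 1]).
  by apply: open_comp; [move=> y _; exact: norm_continuous|exact: open_lt].
rewrite openE => /(_ x x1); apply: filterS => y /= y1; apply: cutoff1_eq1; exact: ltW.
Qed.

Lemma cutoff_deriv : exists2 C, 0 <= C & forall r i x, 0 < r ->
  `|partial i (cutoff r) x| <= C / r * off (r / 2) x.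
Proof.
have v1 : vanishes_off 2 cutoff1 by move=> x; exact: cutoff1_eq0.
have b i : exists2 C, 0 <= C & forall x, `|partial i cutoff1 x| <= C.
  apply: cont_vanishes_bounded; last by apply: vanishes_partial v1; exact: smooth_cutoff1.
  exact: (Cn_cont (Cn_partial i (smooth_cutoff1 1))).
have [C0 c0 b0] := b false; have [C1 c1 b1] := b true.
exists (C0 + C1); first exact: addr_ge0.
move=> r i x r0.
have -> : partial i (cutoff r) x = r^-1 * partial i cutoff1 (affmap r^-1 0 x).
  by have := partial_affine i r^-1 0 (smooth_cutoff1 1) => ->.
rewrite /off; have [xr|xr] := ltP (r / 2) `|x|; last first.
  rewrite partial_cutoff1_eq0 ?mulr0 ?normr0// affmap0_norm// ltr_pdivrMr// mul1r.
  by apply: (le_lt_trans xr); rewrite ltr_pdivrMr//; lra.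
rewrite mulr1 normrM gtr0_norm ?invr_gt0// mulrC ler_wpM2r ?invr_ge0 ?(ltW r0)//.
by case: i; [rewrite (le_trans (b1 _))// lerDr|rewrite (le_trans (b0 _))// lerDl].
Qed.

Lemma mfun2_smooth h : smooth h -> mfun2 h.
Proof. by move=> sh; apply: cont_mfun2; exact: (Cn_cont (sh 0%N)). Qed.

Lemma has_gradM_bounded h w g (b0 b1 : R) : smooth h -> (forall x, `|h x| <= b0) ->
  (forall i x, `|partial i h x| <= b1) -> sqint w -> has_grad w g ->
  sqint (fun x => h x * w x) /\
  has_grad (fun x => h x * w x) (fun i x => h x * g i x + w x * partial i h x).
Proof.
move=> sh hb db hw hg; split; first by apply: sqintM hw; [exact: mfun2_smooth|exact: hb].
apply: has_gradM => // i; apply: sqintD.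
  by apply: (sqintM _ hb); [exact: mfun2_smooth|exact: has_grad_sqint hg].
have := sqintM (M := b1) (f := w) (g := partial i h) _ (db i) hw.
under eq_fun do rewrite mulrC; apply; apply: cont_mfun2.
exact: (Cn_cont (Cn_partial i (sh 1%N))).
Qed.

Lemma norm_le1_sqr (s : R) : 0 <= s -> s <= 1 -> s ^+ 2 <= s.
Proof. by move=> s0 s1; rewrite expr2 ler_piMl. Qed.

(** Ladyzhenskaya's inequality for the product of w with a function that is 0
   near the origin and 1 far away. The power 2 on the right makes the
   nonlinear term negligible where the tail is small. *)
Lemma tail_quartic : exists2 C, 0 <= C & forall w g rho, sqint w -> has_grad w g -> 1 <= rho ->
  Int (fun x => off (4 * rho) x * w x ^+ 4) <= C * tail rho w g ^+ 2.
Proof.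
have [C C0 dC] := cutoff_deriv.
pose A := 3 + 2 * C ^+ 2; exists (4 * A ^+ 2).
  by rewrite mulr_ge0// sqr_ge0.
move=> w g rho hw hg rho1; have rho0 : 0 < rho by lra.
pose h x : R := 1 + - 1 * cutoff (2 * rho) x.
have r2 : 0 < 2 * rho by lra.
have sh : smooth h by move=> k; apply: CnD; [exact: Cn_cst|apply: CnZ; exact: smooth_cutoff].
have h0 x : 0 <= h x by rewrite /h; have := cutoff_le1 (2 * rho) x; lra.
have hoff x : h x <= off rho x.
  rewrite /off; have [|xr] := ltP rho `|x|; last by rewrite /h cutoff_eq1//=; lra.
  by rewrite /h; have := cutoff_ge0 (2 * rho) x => /=; lra.
have h1 x : h x <= 1 by exact: le_trans (hoff x) (off_le1 _ _).
have dh i x : `|partial i h x| <= C * off rho x.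
  have -> : partial i h x = - partial i (cutoff (2 * rho)) x.
    rewrite /h partialD; [|exact: Cn_cst|apply: CnZ; exact: smooth_cutoff].
    rewrite partialM; [|exact: Cn_cst|exact: smooth_cutoff].
    have pc (k : R) : partial i (fun=> k) x = 0 by exact: derive_cst.
    by rewrite !pc mulr0 addr0 add0r mulN1r.
  rewrite normrN (le_trans (dC _ i x r2))//.
  rewrite (_ : 2 * rho / 2 = rho); last by field.
  rewrite ler_wpM2r ?off_ge0// ler_pdivrMr// ler_peMr//; lra.
have [hv hgv] := @has_gradM_bounded h w g 1 C sh
   (fun x => eq_ind_r (fun y => y <= 1) (h1 x) (ger0_norm (h0 x)))
   (fun i x => le_trans (dh i x) (ler_piMr C0 (off_le1 rho x))) hw hg.
have [_] := Ladyzhenskaya hv hgv; set I := Int _ => L.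
have iT := integ_off rho (H1density_integ hw hg).
have bnd : forall i, Int (fun x => (h x * w x) ^+ 2) + Int (fun x => (h x * g i x + w x * partial i h x) ^+ 2) <=
   A * tail rho w g.
  move=> i; rewrite -IntD -?IntZ//; [|exact: sqint_sqr|by apply: sqint_sqr; exact: has_grad_sqint hgv].
  apply: Int_le; [|exact: integZ|].
    by apply: integD; [exact: sqint_sqr|apply: sqint_sqr; exact: has_grad_sqint hgv].
  move=> x; have o0 := off_ge0 rho x.
  have gi : g i x ^+ 2 <= gsq g x by rewrite /gsq; case: i {hv hgv L I}; rewrite ?lerDl ?lerDr sqr_ge0.
  have hh : h x ^+ 2 <= off rho x.
    by apply: le_trans (hoff x); exact: norm_le1_sqr.
  have pp : partial i h x ^+ 2 <= C ^+ 2 * off rho x.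
    have -> : partial i h x ^+ 2 = `|partial i h x| ^+ 2 by rewrite real_normK ?num_real.
    apply: (@le_trans _ _ ((C * off rho x) ^+ 2)).
      by rewrite lerXn2r ?nnegrE ?mulr_ge0//.
    by rewrite exprMn ler_wpM2l ?sqr_ge0// norm_le1_sqr// off_le1.
  have e1 : (h x * w x) ^+ 2 <= off rho x * w x ^+ 2 by rewrite exprMn ler_wpM2r ?sqr_ge0.
  have e2 : (h x * g i x) ^+ 2 <= off rho x * gsq g x.
    by rewrite exprMn (le_trans (ler_wpM2r (sqr_ge0 _) hh))// ler_wpM2l.
  have e3 : (w x * partial i h x) ^+ 2 <= C ^+ 2 * (off rho x * w x ^+ 2).
    by rewrite exprMn [leRHS]mulrA [leLHS]mulrC ler_wpM2r ?sqr_ge0.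
  have e4 := sqr_ge0 (h x * g i x - w x * partial i h x).
  have e5 : 0 <= off rho x * gsq g x by rewrite mulr_ge0 ?gsq_ge0.
  have e6 : 0 <= off rho x * w x ^+ 2 by rewrite mulr_ge0 ?sqr_ge0.
  have e7 : 0 <= C ^+ 2 * (off rho x * gsq g x) by rewrite mulr_ge0 ?sqr_ge0.
  move: e1 e2 e3 e4 e5 e6 e7; rewrite /A.
  have -> : (3 + 2 * C ^+ 2) * (off rho x * (w x ^+ 2 + gsq g x)) =
    3 * (off rho x * w x ^+ 2) + 3 * (off rho x * gsq g x) +
    2 * (C ^+ 2 * (off rho x * w x ^+ 2)) + 2 * (C ^+ 2 * (off rho x * gsq g x)) by ring.
  move: (h x * w x) (h x * g i x) (w x * partial i h x) => a1 a2 a3.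
  set z1 := C ^+ 2 * (off rho x * gsq g x); set z2 := C ^+ 2 * _; set z3 := off rho x * gsq g x; set z4 := off rho x * _.
  move: z1 z2 z3 z4; clear; move=> z1 z2 z3 z4 *; lra.
apply: (@le_trans _ _ I).
  apply: Int_le; first by apply: integ_off; exact: H1_integ_quartic hg.
    exact: H1_integ_quartic hgv.
  have p4 (s : R) : 0 <= s ^+ 4 by rewrite exprn_even_ge0.
  move=> x; rewrite /off; have [xr|_] := ltP (4 * rho) `|x|; last by rewrite mul0r.
  have xr' : 2 * (2 * rho) < `|x| by rewrite mulrA -natrM.
  rewrite mul1r /h (cutoff_eq0 r2 xr').
  by rewrite mulr0 addr0 mul1r.
apply: (le_trans L); have -> : 4 * A ^+ 2 * tail rho w g ^+ 2 = 4 * ((A * tail rho w g) * (A * tail rho w g)) by ring.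
rewrite ler_wpM2l//; apply: ler_pM => //; by rewrite addr_ge0 ?Int_sqr_ge0.
Qed.
End Cutoff.

(** * The truncation estimate *)

Section Decay.
Context {R : realType}.
Implicit Types (a c q e s r th rho k tau : R) (f h u v w t V : R * R -> R) (g gv gw : bool -> R * R -> R) (x z : R * R).
Local Notation T2 := (measurableTypeR R * measurableTypeR R)%type.

Lemma moment_tail : exists2 C, 0 <= C & forall w g rho q th, sqint w -> has_grad w g ->
  1 <= rho -> 1 <= q -> q <= 2 -> 0 < th -> th <= 1 ->
  Int (fun x => off (4 * rho) x * `|w x| `^ (q + 2)) <=
    th * tail rho w g + th^-1 * (C * tail rho w g ^+ 2).
Proof.
have [C C0 H] := @tail_quartic R; exists C => // w g rho q th hw hg r1 q1 q2 th0 th1.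
have i2 := integ_off (4 * rho) (sqint_sqr hw).
have i4 := integ_off (4 * rho) (H1_integ_quartic hw hg).
have iq := integ_off (4 * rho) (integ_moment hw hg (le_trans ler01 q1) q2).
apply: (@le_trans _ _ (Int (fun x => th * (off (4 * rho) x * w x ^+ 2) + th^-1 * (off (4 * rho) x * w x ^+ 4)))).
  apply: Int_le => //; first by apply: integD; exact: integZ.
  move=> x; have := powR_le_small (normr_ge0 (w x)) q1 q2 th0 th1; rewrite !norm_even// => P.
  rewrite [th * _]mulrCA [th^-1 * _]mulrCA -mulrDr.
  by rewrite ler_wpM2l ?off_ge0.
rewrite IntD; [|exact: integZ..].
rewrite !IntZ// lerD// ler_wpM2l//; [exact: ltW| |by rewrite invr_ge0 ltW|exact: H].
apply: Int_le => //; first exact/integ_off/H1density_integ.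
move=> x; apply: ler_pM; rewrite ?off_ge0 ?sqr_ge0//; last by rewrite lerDl gsq_ge0.
by apply: off_le; lra.
Qed.

Lemma finite_potential_cutoff V e z w r : continuous V -> sqint w -> 0 < r ->
  finite_potential V e z (fun x => cutoff r x * w x).
Proof.
move=> cV hw r0.
have cVt : continuous (fun x => V (affmap e z x) * cutoff r x ^+ 2).
  apply: contM; first by move=> x; apply: continuous_comp; [exact: affmap_cont|exact: cV].
  have c := Cn_cont (smooth_cutoff r 0).
  exact: (contM c c).
have vt : vanishes_off (2 * r) (fun x => V (affmap e z x) * cutoff r x ^+ 2).
  by move=> x xr; rewrite cutoff_eq0// expr0n mulr0.
have [C C0 bC] := cont_vanishes_bounded cVt vt.
rewrite /finite_potential (_ : (fun x => _) = (fun x => V (affmap e z x) * cutoff r x ^+ 2 * w x ^+ 2)).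
  exact: (integM (cont_mfun2 cVt) bC (sqint_sqr hw)).
by apply/funext => x; rewrite exprMn mulrA.
Qed.

(** The mixed terms live where the cutoff varies, and its derivative there is
   of order 1/rho. *)
Lemma dirichlet_cutoff : exists2 C, 0 <= C & forall w g rho, sqint w -> has_grad w g -> 1 <= rho ->
  exists gv, [/\ sqint (fun x => cutoff (4 * rho) x * w x),
    has_grad (fun x => cutoff (4 * rho) x * w x) gv &
    dirichlet gv <= Int (fun x => cutoff (4 * rho) x ^+ 2 * gsq g x) + C / rho * tail rho w g].
Proof.
have [C C0 dC] := @cutoff_deriv R.
exists (C * (2 + 2 * C)); first by rewrite mulr_ge0//; lra.
move=> w g rho hw hg r1; have r0 : 0 < rho by lra.
have r4 : 0 < 4 * rho by lra.
pose b := C / rho; have b0 : 0 <= b by rewrite divr_ge0// ltW.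
have bC : b <= C by rewrite ler_pdivrMr// ler_peMr.
have db i x : `|partial i (cutoff (4 * rho)) x| <= b * off rho x.
  apply: (le_trans (dC _ i x r4)); apply: ler_pM; rewrite ?off_ge0//.
  - by rewrite divr_ge0// ltW.
  - by rewrite /b ler_wpM2l// lef_pV2 ?posrE//; lra.
  - by apply: off_le; lra.
have [hv hgv] := @has_gradM_bounded _ (cutoff (4 * rho)) w g 1 b (smooth_cutoff _)
   (fun x => eq_ind_r (fun y => y <= 1) (cutoff_le1 _ x) (ger0_norm (cutoff_ge0 _ x)))
   (fun i x => le_trans (db i x) (ler_piMr b0 (off_le1 rho x))) hw hg.
eexists; split; [exact: hv|exact: hgv|].
have ic : integ (fun x => cutoff (4 * rho) x ^+ 2 * gsq g x).
  apply: (@integM _ _ _ 1); last exact: gsq_integ hg.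
    by apply: (mfun2X 2); apply: mfun2_smooth; exact: smooth_cutoff.
  by move=> x; rewrite ger0_norm ?sqr_ge0// exprn_ile1 ?cutoff_ge0 ?cutoff_le1.
have iT := integ_off rho (H1density_integ hw hg).
rewrite -IntZ// -IntD//; last exact: integZ.
apply: Int_le; [exact: gsq_integ hgv|by apply: integD => //; exact: integZ|].
move=> x; set et := cutoff (4 * rho) x.
have e0 : 0 <= et by exact: cutoff_ge0. have e1 : et <= 1 by exact: cutoff_le1.
have o0 := off_ge0 rho x; have o1 := off_le1 rho x.
have K i : (et * g i x + w x * partial i (cutoff (4 * rho)) x) ^+ 2 <= et ^+ 2 * g i x ^+ 2 +
   off rho x * (b * (w x ^+ 2 + g i x ^+ 2) + C * b * w x ^+ 2).
  set d := partial _ _ _.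
  have dd : `|d| <= b * off rho x by exact: db.
  have d2 : d ^+ 2 <= C * b * off rho x.
    have -> : d ^+ 2 = `|d| ^+ 2 by rewrite real_normK ?num_real.
    apply: (@le_trans _ _ ((b * off rho x) ^+ 2)); first by apply: (lerXn2r 2 _ _ dd); rewrite nnegrE ?normr_ge0//; exact: mulr_ge0.
    rewrite exprMn; apply: ler_pM; rewrite ?sqr_ge0//.
      by rewrite expr2 ler_wpM2r.
    exact: norm_le1_sqr.
  have h1 : 2 * (et * g i x) * (w x * d) <= (w x ^+ 2 + g i x ^+ 2) * (b * off rho x).
    apply: (@le_trans _ _ ((w x ^+ 2 + g i x ^+ 2) * `|d|)); last first.
      by rewrite ler_wpM2l// addr_ge0 ?sqr_ge0.
    have -> : 2 * (et * g i x) * (w x * d) = (2 * g i x * w x) * (et * d) by ring.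
    apply: (le_trans (ler_norm _)); rewrite normrM; apply: ler_pM => //.
      rewrite ler_norml; have := sqr_ge0 (w x - g i x); have := sqr_ge0 (w x + g i x).
      by move: (w x) (g i x); clear => p q *; apply/andP; split; lra.
    by rewrite normrM (ger0_norm e0) ler_piMl.
  have h2 : w x ^+ 2 * d ^+ 2 <= w x ^+ 2 * (C * b * off rho x) by rewrite ler_wpM2l ?sqr_ge0.
  have -> : (et * g i x + w x * d) ^+ 2 = et ^+ 2 * g i x ^+ 2 + (2 * (et * g i x) * (w x * d) + w x ^+ 2 * d ^+ 2) by ring.
  rewrite lerD2l; apply: (le_trans (lerD h1 h2)); rewrite le_eqVlt; apply/orP; left; apply/eqP.
  by ring.
apply: (le_trans (lerD (K false) (K true))).
have -> : C * (2 + 2 * C) / rho = b * (2 + 2 * C) by rewrite /b; ring.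
rewrite /gsq; move: (K false) => _.
have f0 := sqr_ge0 (g false x); have f1 := sqr_ge0 (g true x).
have bo : 0 <= off rho x * b by exact: mulr_ge0.
have p1 : 0 <= (off rho x * b) * (g false x ^+ 2 + g true x ^+ 2) by rewrite mulr_ge0// addr_ge0.
have p2 : 0 <= C * ((off rho x * b) * (g false x ^+ 2 + g true x ^+ 2)) by rewrite mulr_ge0.
rewrite -subr_ge0; apply: (le_trans (addr_ge0 p1 (addr_ge0 p2 p2))).
rewrite le_eqVlt; apply/orP; left; apply/eqP; move: (off rho x) (g false x) (g true x) (w x).
by clear => o g0 g1 w'; ring.
Qed.

(** Compare w with its truncation, centred anywhere. Truncation removes the
   mass m and the Dirichlet energy far out; minimality bounds what is saved,
   that energy and m times minus the multiplier, by the potential energy at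
   the new centre and by errors that are small multiples of the tail. Both the
   decay of w (with z' = z) and the comparison of two zeros of the potential
   (with z' another zero) follow. *)
Lemma cut_estimate : exists2 C, 0 <= C & forall V q c e z w gw kap z' rho th,
  continuous V -> (forall x, 0 <= V x) -> rescaled_minimizer V q c e z w gw ->
  1 <= q -> q <= 2 -> 0 <= c -> 0 < kap -> kap <= 1 -> multiplier V q c e z w gw <= - kap ->
  1 <= rho -> 0 < th -> th <= 1 -> tail rho w gw < 1 ->
  kap * tail (8 * rho) w gw + e ^+ 2 * potential V e z w <=
    e ^+ 2 * potential V e z' (fun x => cutoff (4 * rho) x * w x) +
    C * (1 + c) * (rho^-1 + th + th^-1 * tail rho w gw) * tail rho w gw.
Proof.
have [C1 C10 H1] := moment_tail; have [C2 C20 H2] := dirichlet_cutoff.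
exists (C2 + 2 * (1 + C1)); first by lra.
move=> V q c e z w gw kap z' rho th cV V0 wm q1 q2 c0 kap0 kap1 mu r1 th0 th1 tl.
have [hw hg w1 fw _] := wm; have [gv [hv hgv DV]] := H2 w gw rho hw hg r1.
have r0 : 0 < rho by lra. have r4 : 0 < 4 * rho by lra. have q0 : 0 < q by lra.
pose et := cutoff (4 * rho).
have fv := finite_potential_cutoff e z' cV hw r4.
have met : mfun2 (fun x => et x ^+ 2) by apply: (mfun2X 2); apply: mfun2_smooth; exact: smooth_cutoff.
have et2 x : 0 <= et x ^+ 2 <= 1 by rewrite sqr_ge0 exprn_ile1 ?cutoff_ge0 ?cutoff_le1.
have ie f : integ f -> integ (fun x => et x ^+ 2 * f x).
  by apply: (@integM _ _ _ 1) => // x; have /andP[p0 p1] := et2 x; rewrite ger0_norm.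
have ie' f : integ f -> integ (fun x => (1 - et x ^+ 2) * f x).
  apply: (@integM _ _ _ 1).
    by under eq_fun do rewrite -mulN1r; apply: mfun2D; [exact: cont_mfun2 (Cn_cont (Cn_cst 0 1))|exact: mfun2Z].
  by move=> x; have /andP[p0 p1] := et2 x; rewrite ger0_norm; lra.
have spl f : integ f -> Int f = Int (fun x => et x ^+ 2 * f x) + Int (fun x => (1 - et x ^+ 2) * f x).
  move=> hf; rewrite -IntD; [|exact: ie|exact: ie'].
  by apply: eq_Int => x; ring.
have iw := sqint_sqr hw; have ig := gsq_integ hg.
pose m := Int (fun x => (1 - et x ^+ 2) * w x ^+ 2).
pose D1 := Int (fun x => et x ^+ 2 * gsq gw x).
pose D2 := Int (fun x => (1 - et x ^+ 2) * gsq gw x).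
have Nv : Int (fun x => (et x * w x) ^+ 2) = 1 - m.
  rewrite -w1 (spl _ iw) addrK; apply: eq_Int => x; by rewrite exprMn.
have DE : dirichlet gw = D1 + D2 by exact: spl.
have m0 : 0 <= m.
  by apply: Int_ge0 => x; rewrite mulr_ge0 ?sqr_ge0//; have /andP[_] := et2 x; rewrite subr_ge0.
have D20 : 0 <= D2.
  by apply: Int_ge0 => x; rewrite mulr_ge0 ?gsq_ge0//; have /andP[_] := et2 x; rewrite subr_ge0.
have eoff x : 1 - et x ^+ 2 <= off (4 * rho) x.
  rewrite /off; have [xr|xr] := ltP (4 * rho) `|x|.
    by have /andP[p _] := et2 x; rewrite /=; lra.
  by rewrite /et cutoff_eq1// expr1n subrr.
have offe x : off (8 * rho) x <= 1 - et x ^+ 2.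
  rewrite /off; have [xr|xr] := ltP (8 * rho) `|x|.
    by rewrite /et cutoff_eq0//; [rewrite expr0n subr0|lra].
  by have /andP[_ p] := et2 x; rewrite /=; lra.
have m1 : m < 1.
  apply: le_lt_trans tl; apply: Int_le; [exact: ie'|exact/integ_off/H1density_integ|].
  move=> x; apply: ler_pM; rewrite ?sqr_ge0//.
  - by have /andP[_] := et2 x; rewrite subr_ge0.
  - by apply: (le_trans (eoff x)); apply: off_le; lra.
  - by rewrite lerDl gsq_ge0.
have N0 : 0 < Int (fun x => (et x * w x) ^+ 2) by rewrite Nv subr_gt0.
have := minimality_linear wm q0 q2 c0 hv hgv fv N0; rewrite Nv.
set P' := potential V e z' _; set MV := moment q (fun x => cutoff (4 * rho) x * w x).
pose T := Int (fun x => off (4 * rho) x * `|w x| `^ (q + 2)).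
have T0 : 0 <= T by apply: Int_ge0 => x; rewrite mulr_ge0 ?off_ge0 ?powR_ge0.
have BT : moment q w - T <= MV.
  have iB := integ_moment hw hg (ltW q0) q2.
  rewrite -IntB//; last exact: integ_off.
  apply: Int_le; [by apply: integB => //; exact: integ_off|exact: integ_moment hv hgv (ltW q0) q2|].
  move=> x; rewrite /off; have [xr|xr] := ltP (4 * rho) `|x|.
    by rewrite mul1r subrr powR_ge0.
  by rewrite mul0r subr0 cutoff_eq1// mul1r.
have TE : T <= th * tail rho w gw + th^-1 * (C1 * tail rho w gw ^+ 2) by exact: H1.
have tE : tail (8 * rho) w gw <= m + D2.
  rewrite -IntD; [|exact: ie'..]; apply: Int_le.
  - exact/integ_off/H1density_integ.
  - by apply: integD; exact: ie'.
  - by move=> x; rewrite -mulrDr ler_wpM2r ?H1density_ge0.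
have t0 := tail_ge0 rho w gw; have t80 := tail_ge0 (8 * rho) w gw.
move: mu; rewrite /multiplier /functional DE.
set B := moment q w; set P := potential V e z w; set tl8 := tail (8 * rho) w gw.
move=> mu ineq.
set tr := tail rho w gw in DV TE t0 tl *.
have s1 : kap * tl8 <= kap * (m + D2) by rewrite ler_wpM2l// ltW.
have s2 : kap * D2 <= D2 by rewrite ler_piMl.
have s3 : m * kap <= m * - (D1 + D2 + e ^+ 2 * P - c * (q + 2) / 2 * B) by rewrite ler_wpM2l//; lra.
have y0 : 0 <= 1 - q / 2 * (1 - m - 1) <= 2.
  have -> : 1 - q / 2 * (1 - m - 1) = 1 + q / 2 * m by ring.
  apply/andP; split; first by rewrite addr_ge0// mulr_ge0// divr_ge0// ltW.
  rewrite (_ : 2 = 1 + 1)// lerD2l mulr_ile1 ?divr_ge0 ?(ltW q0) ?(ltW m1)//.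
  by rewrite ler_pdivrMr// mul1r.
have s4 : c * (B - T) * (1 - q / 2 * (1 - m - 1)) <= c * MV * (1 - q / 2 * (1 - m - 1)).
  by case/andP: y0 => y0 _; rewrite ler_wpM2r// ler_wpM2l.
have s5 : c * T * (1 - q / 2 * (1 - m - 1)) <= c * T * 2.
  by case/andP: y0 => _ y2; rewrite ler_wpM2l// mulr_ge0.
have s6 : c * T * 2 <= c * (th * tr + th^-1 * (C1 * tr ^+ 2)) * 2 by rewrite ler_wpM2r// ler_wpM2l.
have main : kap * tl8 + e ^+ 2 * P <= e ^+ 2 * P' + C2 / rho * tr + c * (th * tr + th^-1 * (C1 * tr ^+ 2)) * 2.
  have alg (e2 k' y dv X S b p p' mv t' d1 d2 m' t8 : R) : dv <= d1 + X ->
      (d1 + d2 + e2 * p - c * b) * (1 - m') <= dv + e2 * p' - c * mv * (1 - q / 2 * (1 - m' - 1)) ->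
      k' * t8 <= k' * (m' + d2) -> k' * d2 <= d2 ->
      m' * k' <= m' * - (d1 + d2 + e2 * p - c * (q + 2) / 2 * b) ->
      c * (b - t') * (1 - q / 2 * (1 - m' - 1)) <= c * mv * (1 - q / 2 * (1 - m' - 1)) ->
      c * t' * (1 - q / 2 * (1 - m' - 1)) <= c * t' * 2 -> c * t' * 2 <= S ->
      k' * t8 + e2 * p <= e2 * p' + X + S.
    by clear; lra.
  exact: (alg _ _ 0 _ _ _ _ _ _ _ _ _ _ _ _ DV ineq s1 s2 s3 s4 s5 s6).
apply: (le_trans main); rewrite -addrA lerD2l.
have ri0 : 0 <= rho^-1 by rewrite invr_ge0 ltW.
have ti0 : 0 <= th^-1 by rewrite invr_ge0 ltW.
rewrite -subr_ge0.
have alg (r' t t' T' : R) : (C2 + 2 * (1 + C1)) * (1 + c) * (r' + t + t' * T') * T' -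
   (C2 * r' * T' + c * (t * T' + t' * (C1 * T' ^+ 2)) * 2) =
   r' * T' * (C2 * c + 2 * (1 + C1) * (1 + c)) +
   t * T' * (C2 * (1 + c) + 2 * (1 + C1) + 2 * C1 * c) +
   t' * T' ^+ 2 * (C2 * (1 + c) + 2 * (1 + C1) + 2 * c) by ring.
rewrite alg.
have th0' := ltW th0.
by rewrite !addr_ge0// mulr_ge0// ?mulr_ge0// ?sqr_ge0// ?addr_ge0// ?mulr_ge0// ?addr_ge0// ?mulr_ge0.
Qed.
End Decay.

(** * Polynomial decay of the tails *)

Section Polynomial_decay.
Context {R : realType}.
Implicit Types (a c q e s r th rho k tau p L D : R) (f h u v w t V : R * R -> R) (g gv gw : bool -> R * R -> R) (x y z : R * R).
Local Notation T2 := (measurableTypeR R * measurableTypeR R)%type.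

Lemma potential_cutoff_le V e z w r : continuous V -> (forall x, 0 <= V x) -> sqint w -> 0 < r ->
  finite_potential V e z w -> potential V e z (fun x => cutoff r x * w x) <= potential V e z w.
Proof.
move=> cV V0 hw r0 fw; apply: Int_le => //; first exact: finite_potential_cutoff.
move=> x; rewrite ler_wpM2l// exprMn ler_piMl ?sqr_ge0//.
by rewrite exprn_ile1 ?cutoff_ge0 ?cutoff_le1.
Qed.

(** The error terms of the truncation estimate carry the factors 1/rho, th and
   tail/th, which are made small in turn. *)
Lemma tail_contracts (kap cmax : R) N : 0 < kap -> kap <= 1 -> 0 <= cmax ->
  exists rho1 del, [/\ 1 <= rho1, 0 < del & forall V q c e z w gw rho,
   continuous V -> (forall x, 0 <= V x) -> rescaled_minimizer V q c e z w gw ->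
   1 <= q -> q <= 2 -> 0 <= c -> c <= cmax -> multiplier V q c e z w gw <= - kap ->
   rho1 <= rho -> tail rho w gw <= del -> tail (8 * rho) w gw <= (8 ^+ N)^-1 * tail rho w gw].
Proof.
move=> kap0 kap1 cm0; have [C C0 H] := @cut_estimate R.
have n8 : 0 < (8 : R) ^+ N by rewrite exprn_gt0.
(* With th = 1/K, rho >= K and tail <= 1/(2 K^2) each of the three factors is
   at most 1/K. *)
pose K := 3 * C * (1 + cmax) * 8 ^+ N / kap + 1.
have A0 : 0 <= 3 * C * (1 + cmax) * 8 ^+ N / kap.
  by rewrite divr_ge0 ?(ltW kap0)// !mulr_ge0 ?(ltW n8)//; lra.
have K1 : 1 <= K by rewrite /K lerDr.
have K0 : 0 < K by lra.
have K10 : 0 < K^-1 by rewrite invr_gt0.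
have K11 : K^-1 <= 1 by rewrite invf_le1.
exists K, (K^-1 * K^-1 / 2); split => //; first by rewrite divr_gt0// mulr_gt0.
move=> V q c e z w gw rho cV V0 wm q1 q2 c0 cc mu r1 tl.
have [hw hg w1 fw _] := wm.
have r0 : 1 <= rho by lra.
have t0 := tail_ge0 rho w gw.
have d1 : K^-1 * K^-1 / 2 < 1.
  by rewrite ltr_pdivrMr// mul1r; apply: le_lt_trans (_ : 1 * 1 < 2); [apply: ler_pM => //; exact: ltW|lra].
have := H V q c e z w gw kap z rho K^-1 cV V0 wm q1 q2 c0 kap0 kap1 mu r0 K10 K11 (le_lt_trans tl d1).
rewrite invrK; set P := potential V e z w; set P' := potential V e z _; set t8 := tail (8 * rho) _ _; set tr := tail rho w gw in t0 tl *.
move=> main; have PP : e ^+ 2 * P' <= e ^+ 2 * P.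
  by rewrite ler_wpM2l ?sqr_ge0//; apply: potential_cutoff_le => //; lra.
have ri : rho^-1 <= K^-1 by rewrite lef_pV2 ?posrE//; lra.
have Kt : K * tr <= K^-1.
  apply: (@le_trans _ _ (K * (K^-1 * K^-1 / 2))); first by rewrite ler_wpM2l ?(ltW K0).
  by rewrite !mulrA divff ?gt_eqF// mul1r ler_pdivrMr// ler_peMr// ?(ltW K10)//; lra.
have b1 : C * (1 + c) * (rho^-1 + K^-1 + K * tr) * tr <= C * (1 + cmax) * (3 * K^-1) * tr.
  rewrite ler_wpM2r//; apply: ler_pM.
  - by rewrite mulr_ge0// addr_ge0.
  - have : 0 <= rho^-1 by rewrite invr_ge0; lra.
    have : 0 <= K * tr by rewrite mulr_ge0// ltW.
    by move: (ltW K10); move: rho^-1 K^-1 (K * tr); clear => x1 x2 x3; lra.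
  - by rewrite ler_wpM2l// lerD2l.
  - by move: ri Kt; move: rho^-1 K^-1 (K * tr); clear => x1 x2 x3; lra.
have b2 : C * (1 + cmax) * (3 * K^-1) <= kap * (8 ^+ N)^-1.
  have KE : 3 * C * (1 + cmax) * 8 ^+ N <= K * kap.
    have -> : K * kap = 3 * C * (1 + cmax) * 8 ^+ N / kap * kap + kap by rewrite /K [LHS]mulrDl mul1r.
    by rewrite divfK ?gt_eqF// lerDl ltW.
  have i0 : 0 <= K^-1 * (8 ^+ N)^-1 by rewrite mulr_ge0 ?(ltW K10)// invr_ge0 ltW.
  have KN : K != 0 by rewrite gt_eqF.
  have nN : (8 : R) ^+ N != 0 by rewrite gt_eqF.
  have := ler_wpM2r i0 KE.
  have -> : 3 * C * (1 + cmax) * 8 ^+ N * (K^-1 * (8 ^+ N)^-1) = C * (1 + cmax) * (3 * K^-1).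
    have alg (k n : R) : k != 0 -> n != 0 -> 3 * C * (1 + cmax) * n * (k^-1 * n^-1) = C * (1 + cmax) * (3 * k^-1).
      by move=> k0 n0; field; rewrite k0 n0.
    exact: alg.
  suff -> : K * kap * (K^-1 * (8 ^+ N)^-1) = kap * (8 ^+ N)^-1 by [].
  by rewrite mulrACA divff// mul1r.
rewrite -(ler_pM2l kap0) mulrA.
have b3 := ler_wpM2r t0 b2.
have alg (x1 x2 x3 x4 x5 x6 : R) : x1 + x2 <= x3 + x4 -> x3 <= x2 -> x4 <= x5 -> x5 <= x6 -> x1 <= x6.
  by clear; lra.
exact: (alg _ _ _ _ _ _ main PP b1 b3).
Qed.

(** A factor 8^-N at each multiplication of the radius by 8 is decay of order
   N. *)
Lemma tail_decay w gw N rho0 del : sqint w -> has_grad w gw -> 1 <= rho0 ->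
  (forall rho, rho0 <= rho -> tail (8 * rho) w gw <= (8 ^+ N)^-1 * tail rho w gw) ->
  tail rho0 w gw <= del ->
  forall r, rho0 <= r -> tail r w gw <= del * (8 * rho0) ^+ N / r ^+ N.
Proof.
move=> hw hg r01 step tl r rr.
have r00 : 0 < rho0 by lra.
have n8 : 0 < (8 : R) ^+ N by rewrite exprn_gt0.
have del0 : 0 <= del by apply: le_trans tl; exact: tail_ge0.
have [n] : exists n, r < 8 ^+ n * rho0.
  exists (Num.truncn r).+1; apply: (lt_le_trans (truncnS_gt r)).
  apply: (@le_trans _ _ (8 ^+ (Num.truncn r).+1)); last by rewrite ler_peMr ?exprn_ge0.
  rewrite -natrX ler_nat; apply: ltnW; exact: ltn_expl.
elim: n r rr => [|n IH] r rr; first by rewrite expr0 mul1r ltNge rr.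
move=> rn; have r0 : 0 < r by lra.
have [r8|r8] := ltP r (8 * rho0).
  apply: (@le_trans _ _ del); first exact: le_trans (tail_le hw hg rr) tl.
  rewrite -mulrA -expr_div_n ler_peMr// exprn_ege1// ler_pdivlMr// mul1r ltW//.
have r8' : rho0 <= r / 8 by rewrite ler_pdivlMr// mulrC.
have E : r = 8 * (r / 8) by rewrite [RHS]mulrC divfK.
have st := step _ r8'; rewrite -E in st.
apply: (le_trans st).
have {}IH := IH _ r8' _; apply: (@le_trans _ _ ((8 ^+ N)^-1 * (del * (8 * rho0) ^+ N / (r / 8) ^+ N))).
  rewrite ler_wpM2l ?invr_ge0 ?(ltW n8)//; apply: IH.
  by rewrite ltr_pdivrMr// mulrAC -exprSr.
rewrite expr_div_n invf_div le_eqVlt; apply/orP; left; apply/eqP.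
have n8' : (8 : R) ^+ N != 0 by rewrite gt_eqF.
have rN : r ^+ N != 0 by rewrite gt_eqF// exprn_gt0.
by field; rewrite rN n8'.
Qed.

Lemma enorm_ge0 x : 0 <= enorm x. Proof. exact: sqrtr_ge0. Qed.

Lemma normp_le_enorm x : `|x| <= enorm x.
Proof.
rewrite normp_le -!sqrtr_sqr; apply/andP; split; apply: ler_wsqrtr; by rewrite ?lerDl ?lerDr sqr_ge0.
Qed.

Lemma enorm_le_normp x : enorm x <= 2 * `|x|.
Proof.
have n0 : 0 <= 2 * `|x| by rewrite mulr_ge0.
rewrite -(ger0_norm n0) -sqrtr_sqr; apply: ler_wsqrtr.
have sq (s : R) : `|s| <= `|x| -> s ^+ 2 <= `|x| ^+ 2.
  by move=> h; rewrite -[s ^+ 2]real_normK ?num_real// lerXn2r ?nnegrE.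
have := sq _ (normp_ge1 x); have := sq _ (normp_ge2 x); rewrite exprMn.
have := sqr_ge0 `|x|; lra.
Qed.

Lemma enorm_cont : continuous (@enorm R).
Proof.
move=> x; apply: continuous_comp; last exact: sqrt_continuous.
exact: (cvgD (contM fst_cont fst_cont (x := x)) (contM snd_cont snd_cont (x := x))).
Qed.

Lemma enormZ e x : 0 <= e -> enorm (e *: x) = e * enorm x.
Proof.
move=> e0; rewrite /enorm /= /GRing.scale/= !exprMn -mulrDr sqrtrM ?sqr_ge0// sqrtr_sqr ger0_norm//.
Qed.

Lemma enormN x : enorm (- x) = enorm x.
Proof. by rewrite /enorm /= !sqrrN. Qed.

Lemma enorm_sqr x : enorm x ^+ 2 = x.1 ^+ 2 + x.2 ^+ 2.
Proof. by rewrite sqr_sqrtr// addr_ge0 ?sqr_ge0. Qed.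

Lemma enormD x y : enorm (x + y) <= enorm x + enorm y.
Proof.
rewrite -ler_sqr ?nnegrE ?addr_ge0 ?enorm_ge0// sqrrD !enorm_sqr /=.
suff : x.1 * y.1 + x.2 * y.2 <= enorm x * enorm y by lra.
apply: (le_trans (ler_norm _)); rewrite -ler_sqr ?nnegrE ?mulr_ge0 ?enorm_ge0//.
rewrite real_normK ?num_real// exprMn !enorm_sqr.
have := sqr_ge0 (x.1 * y.2 - x.2 * y.1); lra.
Qed.

Lemma mfun2_enorm_pow p : mfun2 (fun x => enorm x `^ p).
Proof. by apply: mfun2_powR; apply: cont_mfun2; exact: enorm_cont. Qed.

Definition on r x : R := 1 - off r x.

Lemma on_ge0 r x : 0 <= on r x. Proof. by rewrite subr_ge0 off_le1. Qed.
Lemma on_le1 r x : on r x <= 1. Proof. by have := off_ge0 r x; rewrite /on; lra. Qed.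
Lemma on_le r r' x : r <= r' -> on r x <= on r' x.
Proof. by move=> rr; rewrite /on lerD2l lerN2 off_le. Qed.
Lemma on1 r x : `|x| <= r -> on r x = 1.
Proof. by move=> xr; rewrite /on /off ltNge xr subr0. Qed.
Lemma on0 r x : r < `|x| -> on r x = 0.
Proof. by move=> xr; rewrite /on /off xr subrr. Qed.

Lemma mfun2_on r : mfun2 (on r).
Proof. by apply: mfun2B; [exact: cont_mfun2 (Cn_cont (Cn_cst 0 1))|exact: mfun2_off]. Qed.

Lemma enorm_pow_le p r x : 0 <= p -> `|x| <= r -> enorm x `^ p <= (2 * r) `^ p.
Proof.
move=> p0 xr; have r0 : 0 <= r by exact: le_trans xr.
apply: ge0_ler_powR => //; rewrite ?nnegrE ?enorm_ge0 ?mulr_ge0//.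
by apply: (le_trans (enorm_le_normp x)); rewrite ler_wpM2l.
Qed.

Lemma integ_on_weight p r f : 0 <= p -> integ f -> integ (fun x => on r x * (enorm x `^ p * f x)).
Proof.
move=> p0 hf; have E : (fun x => on r x * (enorm x `^ p * f x)) = (fun x => (on r x * enorm x `^ p) * f x).
  by apply/funext => x; rewrite mulrA.
rewrite E; apply: (@integM _ _ _ ((2 * r) `^ p)) => //.
  by apply: mfun2M; [exact: mfun2_on|exact: mfun2_enorm_pow].
move=> x; rewrite ger0_norm ?mulr_ge0 ?on_ge0 ?powR_ge0//.
have [xr|xr] := leP `|x| r; first by rewrite on1// mul1r enorm_pow_le.
by rewrite on0// mul0r powR_ge0.
Qed.

(** Summation over dyadic annuli; one unit of decay beyond p is left to sum
   the series. *)
Lemma weighted_tail w gw p N D L0 : sqint w -> has_grad w gw -> 0 <= p -> p + 1 <= N%:R -> 0 <= D -> 1 <= L0 ->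
  (forall r, L0 <= r -> tail r w gw <= D / r ^+ N) ->
  forall L r, L0 <= L -> Int (fun x => on r x * (enorm x `^ p * w x ^+ 2)) <=
    Int (fun x => on L x * (enorm x `^ p * w x ^+ 2)) + 2 * 4 `^ p * D / L.
Proof.
move=> hw hg p0 pN D0 L01 tl L r LL; have L1 : 1 <= L by lra.
have iw := sqint_sqr hw; have ion s := integ_on_weight s p0 iw.
have w0 x : 0 <= enorm x `^ p * w x ^+ 2 by rewrite mulr_ge0 ?powR_ge0 ?sqr_ge0.
have ring1 s : L <= s -> Int (fun x => on (2 * s) x * (enorm x `^ p * w x ^+ 2)) <=
    Int (fun x => on s x * (enorm x `^ p * w x ^+ 2)) + 4 `^ p * D / s.
  move=> Ls; have s1 : 1 <= s by lra.
  have s0 : 0 < s by lra.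
  have c0 : 0 <= (2 * (2 * s)) `^ p by exact: powR_ge0.
  have it := integ_off s (H1density_integ hw hg).
  apply: (@le_trans _ _ (Int (fun x => on s x * (enorm x `^ p * w x ^+ 2)) + (2 * (2 * s)) `^ p * tail s w gw)).
    rewrite -IntZ// -IntD//; last exact: integZ.
    apply: Int_le => //; first by apply: integD => //; exact: integZ.
    move=> x; have [xs|xs] := leP `|x| s.
      rewrite !on1//; last by lra.
      by rewrite lerDl mulr_ge0// mulr_ge0 ?off_ge0 ?H1density_ge0.
    rewrite (on0 xs) mul0r add0r /off xs mul1r.
    have [x2|x2] := leP `|x| (2 * s); last first.
      by rewrite (on0 x2) mul0r mulr_ge0 ?H1density_ge0.
    rewrite (on1 x2) mul1r; apply: ler_pM; rewrite ?powR_ge0 ?sqr_ge0 ?enorm_pow_le//.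
    by rewrite lerDl gsq_ge0.
  rewrite lerD2l mulrA -natrM powRM ?(ltW s0)// -!mulrA ler_wpM2l ?powR_ge0//.
  apply: (@le_trans _ _ (s `^ p * (D / s ^+ N))); first by rewrite ler_wpM2l ?powR_ge0// tl//; lra.
  rewrite mulrCA ler_wpM2l// ler_pdivrMr ?exprn_gt0//.
  rewrite -powR_mulrn ?(ltW s0)// -[s^-1]powR_inv1 ?(ltW s0)// -powRD ?(gt_eqF s0) ?implybT//.
  by rewrite ler_powR//; lra.
have A0 : 0 <= 4 `^ p * D / L by rewrite divr_ge0 ?mulr_ge0 ?powR_ge0//; lra.
have ind n : Int (fun x => on (2 ^+ n * L) x * (enorm x `^ p * w x ^+ 2)) <=
    Int (fun x => on L x * (enorm x `^ p * w x ^+ 2)) + 4 `^ p * D / L * (2 - 2 * (2 ^+ n)^-1).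
  elim: n => [|n IH]; first by rewrite expr0 invr1 mulr1 mul1r subrr mulr0 addr0.
  have pn : 1 <= (2 : R) ^+ n by rewrite exprn_ege1//; lra.
  have Ln : L <= 2 ^+ n * L by rewrite ler_peMl//; lra.
  have := ring1 _ Ln; rewrite mulrA -exprS => h; apply: (le_trans h).
  apply: (le_trans (lerD IH (lexx _))); rewrite -addrA lerD2l exprS !invfM.
  have alg (A l k : R) : A * l * (2 - 2 * k) + A * (k * l) = A * l * (2 - 2 * (2^-1 * k)) by field.
  by rewrite alg.
have [n rn] : exists n, r <= 2 ^+ n * L.
  exists (Num.truncn `|r|).+1; apply: (@le_trans _ _ `|r|); first exact: ler_norm.
  apply: (le_trans (ltW (truncnS_gt _))).
  apply: (@le_trans _ _ (2 ^+ (Num.truncn `|r|).+1)); last by rewrite ler_peMr ?exprn_ge0.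
  rewrite -natrX ler_nat; apply: ltnW; exact: ltn_expl.
apply: (@le_trans _ _ (Int (fun x => on (2 ^+ n * L) x * (enorm x `^ p * w x ^+ 2)))).
  by apply: Int_le => // x; rewrite ler_wpM2r// on_le.
apply: (le_trans (ind n)); rewrite lerD2l.
have -> : 2 * 4 `^ p * D / L = 4 `^ p * D / L * 2 by ring.
rewrite ler_wpM2l// gerBl mulr_ge0// invr_ge0 exprn_ge0//.
Qed.
End Polynomial_decay.

(** * Translating a radial weight *)

Section Radial_average.
Context {R : realType}.
Implicit Types (a c e s r k p B : R) (f h u v w t V : R * R -> R) (b x y z : R * R) (m : nat).
Local Notation T1 := (measurableTypeR R).
Local Notation T2 := (measurableTypeR R * measurableTypeR R)%type.
Local Notation mu := (@lebesgue_measure R).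

(** The square of x.1 + i x.2; iterates give the powers of order 2^m. *)
Definition csq x : R * R := (x.1 ^+ 2 - x.2 ^+ 2, 2 * x.1 * x.2).
Definition rot x y : R * R := (x.1 * y.1 - x.2 * y.2, x.2 * y.1 + x.1 * y.2).

Lemma csq_rot x y : csq (rot x y) = rot (csq x) (csq y).
Proof. by rewrite /csq /rot /=; congr (_, _); ring. Qed.

Lemma csqit_rot m x y : iter m csq (rot x y) = rot (iter m csq x) (iter m csq y).
Proof. by elim: m => //= m ->; exact: csq_rot. Qed.

Lemma enorm_csq x : enorm (csq x) = enorm x ^+ 2.
Proof.
rewrite enorm_sqr /enorm /csq /=.
have -> : (x.1 ^+ 2 - x.2 ^+ 2) ^+ 2 + (2 * x.1 * x.2) ^+ 2 = (x.1 ^+ 2 + x.2 ^+ 2) ^+ 2 by ring.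
by rewrite sqrtr_sqr ger0_norm// addr_ge0 ?sqr_ge0.
Qed.

Lemma enorm_csqit m x : enorm (iter m csq x) = enorm x ^+ (2 ^ m).
Proof. by elim: m => [|m IH]; rewrite ?expr1//= enorm_csq IH -exprM mulnC -expnS. Qed.

Lemma enorm_csqB x y : enorm (csq x - csq y) = enorm (x - y) * enorm (x + y).
Proof.
rewrite /enorm -sqrtrM ?addr_ge0 ?sqr_ge0//; congr Num.sqrt; rewrite /csq /=; ring.
Qed.

(** A rotation other than the half turn is a product of three shears. *)
Lemma preserves_rot x : enorm x = 1 -> x.1 != -1 -> preserves 1 (rot x).
Proof.
move=> x1 xN; have E : x.1 ^+ 2 + x.2 ^+ 2 = 1 by rewrite -enorm_sqr x1 expr1n.
have d0 : 1 + x.1 != 0 by apply: contraNneq xN => /eqP; rewrite addrC addr_eq0.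
(* Minus the tangent of half the angle. *)
pose s := - (x.2 / (1 + x.1)).
have -> : rot x = shear1 s \o (shear2 x.2 \o shear1 s).
  have E1 : x.2 * s = x.1 - 1.
    rewrite /s mulrN mulrA -expr2 (_ : x.2 ^+ 2 = (1 - x.1) * (1 + x.1)); last by rewrite -subr_sqr expr1n -E; ring.
    by rewrite mulfK// opprB.
  have E2 : s * x.1 = - x.2 - s by rewrite -[in LHS](addKr 1 x.1) mulrDr mulrN1 /s mulNr divfK// addrC.
  apply/funext => y; rewrite /rot /shear1 /shear2 /=; congr (_, _).
    have -> : y.1 + s * y.2 + s * (y.2 + x.2 * (y.1 + s * y.2)) =
       y.1 + s * y.2 + s * y.2 + (x.2 * s) * y.1 + s * (x.2 * s) * y.2 by ring.
    by rewrite E1 mulrBr E2; ring.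
  have -> : y.2 + x.2 * (y.1 + s * y.2) = y.2 + x.2 * y.1 + (x.2 * s) * y.2 by ring.
  by rewrite E1; ring.
have P1 := preserves_shear1 s; have P2 := preserves_shear2 x.2.
by have := preserves_comp P1 (preserves_comp P2 P1); rewrite !mulr1.
Qed.

Lemma enorm_rot x y : enorm x = 1 -> enorm (rot x y) = enorm y.
Proof.
move=> x1; have E : x.1 ^+ 2 + x.2 ^+ 2 = 1 by rewrite -enorm_sqr x1 expr1n.
rewrite /enorm /rot /=; congr Num.sqrt.
by rewrite -[RHS]mul1r -E; ring.
Qed.

(** Half-angle formulas: a square root of a point of the unit circle in the
   right half-plane. *)
Lemma root_of_minus_one m : exists x, [/\ enorm x = 1, 0 <= x.1 & iter m.+1 csq x = (-1, 0)].
Proof.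
elim: m => [|m [x [x1 x0 xm]]].
  exists (0, 1); split => //.
    by rewrite /enorm /= expr0n expr1n add0r sqrtr1.
  by rewrite /csq /= expr0n expr1n /= sub0r mulr0 mul0r.
have E : x.1 ^+ 2 + x.2 ^+ 2 = 1 by rewrite -enorm_sqr x1 expr1n.
pose c := Num.sqrt ((1 + x.1) / 2).
have d0 : 0 < (1 + x.1) / 2 by rewrite divr_gt0//; lra.
have c0 : 0 < c by rewrite sqrtr_gt0.
have cE : c ^+ 2 = (1 + x.1) / 2 by rewrite sqr_sqrtr// ltW.
pose s := x.2 / (2 * c).
have sE : s ^+ 2 = (1 - x.1) / 2.
  rewrite /s expr_div_n exprMn cE.
  have -> : x.2 ^+ 2 = (1 - x.1) * (1 + x.1) by rewrite -subr_sqr expr1n -E; ring.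
  by field; rewrite gt_eqF//; lra.
exists (c, s); split=> /=; last 2 first.
- exact: ltW.
- have -> : csq (iter m.+1 csq (c, s)) = iter m.+1 csq (csq (c, s)) by rewrite -iterSr.
  rewrite (_ : csq (c, s) = x)//; rewrite /csq /= cE sE [RHS]surjective_pairing; congr (_, _).
    by field.
  by rewrite /s; field; rewrite gt_eqF.
by rewrite /enorm /= cE sE (_ : _ + _ = 1) ?sqrtr1//; field.
Qed.

(** Multiplication by a root of -1 of order 2^m is a rotation that changes the
   sign of the power of order 2^m. *)
Lemma half_turn m : exists T, [/\ preserves 1 T, forall y, enorm (T y) = enorm y &
  forall y, iter m csq (T y) = - iter m csq y].
Proof.
case: m => [|m].
  have i1 : enorm ((0, 1) : R * R) = 1 by rewrite /enorm /= expr0n expr1n add0r sqrtr1.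
  have Pi : preserves 1 (rot (0, 1)) by apply: preserves_rot => //=; rewrite eq_sym oppr_eq0 oner_eq0.
  exists (rot (0, 1) \o rot (0, 1)); split.
  - by have := preserves_comp Pi Pi; rewrite mulr1.
  - by move=> y /=; rewrite !enorm_rot.
  - by move=> y; rewrite /rot /=; apply/pair_equal_spec; split; rewrite /=; ring.
have [x [x1 x0 xm]] := root_of_minus_one m.
exists (rot x); split.
- by apply: preserves_rot => //; rewrite gt_eqF// (lt_le_trans _ x0)// ltrN10.
- by move=> y; exact: enorm_rot.
- by move=> y; rewrite csqit_rot xm; apply/pair_equal_spec; split; rewrite /=; ring.
Qed.

Lemma enormB_ge x y : `|enorm x - enorm y| <= enorm (x - y).
Proof.
rewrite ler_norml; apply/andP; split.
  have := enormD (x - y) (- x); rewrite addrAC subrr add0r !enormN; lra.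
have := enormD (x - y) y; rewrite subrK; lra.
Qed.

Lemma csq_cont : continuous csq.
Proof.
apply: pair_cont.
  by move=> x; apply: cvgB; [exact: (contM fst_cont fst_cont)|exact: (contM snd_cont snd_cont)].
apply: contM; last exact: snd_cont.
by move=> x; apply: cvgM; [exact: cvg_cst|exact: fst_cont].
Qed.

Lemma csqit_cont m : continuous (iter m csq).
Proof. by elim: m => [|m IH] x; [exact: cvg_id|apply: continuous_comp; [exact: IH|exact: csq_cont]]. Qed.

Lemma twice_mul_le s r : 2 * (s * r) <= s ^+ 2 + r ^+ 2.
Proof. by have := sqr_ge0 (s - r); lra. Qed.

Lemma half_le s r : 2 * s <= r + r -> s <= r.
Proof. by lra. Qed.

Section Average.
Variables (p r : R) (f : R * R -> R).
Hypotheses (p0 : 0 < p) (f0 : forall x, 0 <= f x) (frad : radial f) (fi : integ f)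
  (fr : forall x, r < `|x| -> f x = 0).

(** Up to the exponent, the distance of y^(2^m) to b; for m = 0 it is the
   translated weight. *)
Definition phase m b y : R := enorm (iter m csq y - b) `^ (p / 2 ^+ m).

Lemma integ_cont_mul (h : R * R -> R) a : (forall x, 0 <= h x) -> continuous h -> 0 <= a ->
  integ (fun x => h x `^ a * f x).
Proof.
move=> h0 hc a0; have [C C0 hC] : exists2 C, 0 <= C & forall x, `|x| <= r -> h x <= C.
  have [r0|r0] := leP 0 r; last by exists 0 => // x xr; have := le_lt_trans xr r0; rewrite normr_lt0.
  have [C [_ HC]] : bounded_set (h @` box r).
    apply: compact_bounded; apply: continuous_compact; last exact: box_compact.
    exact: continuous_subspaceT.
  exists (`|C| + 1) => // x xr; apply: (le_trans (ler_norm _)); apply: (HC (`|C| + 1)); last by exists x.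
  by rewrite (le_lt_trans (ler_norm C))// ltrDl.
apply: (@integ_le _ _ (fun x => C `^ a * f x)); last exact: integZ.
  by apply: mfun2M; [apply: mfun2_powR; exact: cont_mfun2|exact: integ_mfun].
move=> x; rewrite ger0_norm ?mulr_ge0 ?powR_ge0//; have [xr|xr] := leP `|x| r; last by rewrite fr// !mulr0.
by rewrite ler_wpM2r// ge0_ler_powR ?nnegrE// hC.
Qed.

Lemma phase_integ m b : integ (fun y => phase m b y * f y).
Proof.
apply: (@integ_cont_mul (fun y => enorm (iter m csq y - b)) (p / 2 ^+ m)).
- by move=> x; exact: enorm_ge0.
- move=> x; apply: continuous_comp; last exact: enorm_cont.
  by apply: cvgB; [exact: csqit_cont|exact: cvg_cst].
- by rewrite divr_ge0 ?(ltW p0)// exprn_ge0.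
Qed.

(** The rotation that changes the sign of y^(2^m) preserves the integral, so
   one may average the distances of y^(2^m) to b and to -b; by the inequality
   of arithmetic and geometric means the average is at least the distance of
   the squares, to the power half as large. *)
Lemma phase_step m b : Int (fun y => phase m.+1 (csq b) y * f y) <= Int (fun y => phase m b y * f y).
Proof.
have [T [PT eT T2E]] := half_turn m.
have i0 := phase_integ m b; have iN := phase_integ m (- b); have i1 := phase_integ m.+1 (csq b).
have EN : Int (fun y => phase m (- b) y * f y) = Int (fun y => phase m b y * f y).
  rewrite -(preserves_Int PT i0) mul1r; apply: eq_Int => y /=.
  rewrite /phase T2E (frad (eT y)); congr (_ `^ _ * _).
  by rewrite -enormN opprB addrC.
have : Int (fun y => 2 * (phase m.+1 (csq b) y * f y)) <=
   Int (fun y => phase m b y * f y + phase m (- b) y * f y).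
  apply: Int_le; [exact: integZ|exact: integD|].
  have alg (s1 s2 s3 s : R) : 0 <= s -> 2 * s1 <= s2 + s3 -> 2 * (s1 * s) <= s2 * s + s3 * s.
    by move=> s0 le; rewrite mulrA -mulrDl ler_wpM2r.
  move=> y; apply: (alg _ _ _ _ (f0 y)).
  have -> : phase m.+1 (csq b) y = (enorm (iter m csq y - b) * enorm (iter m csq y + b)) `^ (p / 2 ^+ m.+1).
    by rewrite -enorm_csqB.
  rewrite {1 2}/phase opprK; move: (iter m csq y) => Y.
  set A := enorm (Y - b); set A' := enorm (Y + b).
  have A0 : 0 <= A by exact: enorm_ge0. have A'0 : 0 <= A' by exact: enorm_ge0.
  have kE (k : R) : k != 0 -> p / k = p / (2 * k) * 2%:R by move=> kN; field.
  have kN : (2 : R) ^+ m != 0 by rewrite expf_neq0.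
  rewrite exprS (kE _ kN); set a := p / (2 * _).
  rewrite (powRM _ A0 A'0) (powRrM A a) (powRrM A' a).
  rewrite (powR_mulrn 2 (powR_ge0 A a)) (powR_mulrn 2 (powR_ge0 A' a)).
  exact: twice_mul_le.
rewrite (IntD i0 iN) EN (IntZ 2 i1).
exact: half_le.
Qed.

Lemma phase_le m b : Int (fun y => phase m (iter m csq b) y * f y) <= Int (fun y => phase 0 b y * f y).
Proof.
elim: m => [|m IH]; first exact: lexx.
exact: (le_trans (phase_step m (iter m csq b)) IH).
Qed.

(** Each horizontal section of a circle has at most two points. *)
Lemma circle_null B : {ae @leb2 R, forall y, enorm y != B}.
Proof.
have mE : measurable ([set y | enorm y = B] : set T2).
  have -> : [set y | enorm y = B] = (@enorm R) @^-1` [set B] by [].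
  by rewrite -[X in measurable X]setTI; apply: (cont_mfun2 enorm_cont).
exists [set y | enorm y = B]; split => //; last by move=> y /= /negP; rewrite negbK => /eqP.
rewrite leb2_ysection//; apply: integral0_eq => s _.
apply: countable_lebesgue_measure0; apply: finite_set_countable.
apply: (@sub_finite_set _ _ [set Num.sqrt (B ^+ 2 - s ^+ 2); - Num.sqrt (B ^+ 2 - s ^+ 2)]).
  move=> x /ysectionP /= xB; have E : B ^+ 2 - s ^+ 2 = x ^+ 2 by rewrite -xB enorm_sqr /= addrK.
  rewrite E sqrtr_sqr; have [x0|x0] := leP 0 x; first by left; rewrite ger0_norm.
  by right; rewrite ltr0_norm// opprK.
by rewrite finite_setU; split; exact: finite_set1.
Qed.

(** The larger of A and B wins in |A^N - B^N|^(1/N). *)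
Lemma gap_cvg (A B : R) : 0 <= A -> 0 <= B -> A != B ->
  `|A ^+ (2 ^ m) - B ^+ (2 ^ m)| `^ (p / 2 ^+ m) @[m --> \oo] --> Num.max A B `^ p.
Proof.
wlog lt : A B / B < A.
  move=> H A0 B0 AB; move: (AB); rewrite neq_lt => /orP[lt|lt]; last exact: H.
  by rewrite maxC; under eq_fun do rewrite distrC; apply: H => //; rewrite eq_sym.
move=> A0 B0 _; have Ap : 0 < A by exact: le_lt_trans lt.
rewrite (max_idPl (ltW lt)).
pose k := 1 - B / A; have k0 : 0 < k by rewrite subr_gt0 ltr_pdivrMr// mul1r.
have k1 : k <= 1 by rewrite gerBl divr_ge0.
have tE m : 0 <= p / 2 ^+ m by rewrite divr_ge0 ?(ltW p0)// exprn_ge0.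
have AE m : (A ^+ (2 ^ m)) `^ (p / 2 ^+ m) = A `^ p.
  rewrite -powR_mulrn// -powRrM natrX mulrCA divff ?mulr1//; by rewrite gt_eqF// exprn_gt0.
apply: (@squeeze_cvgr _ _ _ _ (fun m => A `^ p * k `^ (p / 2 ^+ m)) (fun=> A `^ p)).
- apply: nearW => m.
  have BA : B ^+ (2 ^ m) <= A ^+ (2 ^ m) by rewrite lerXn2r ?nnegrE// ltW.
  rewrite ger0_norm ?subr_ge0//.
  have n0 : 0 <= A ^+ (2 ^ m) by rewrite exprn_ge0.
  apply/andP; split.
    have le : A ^+ (2 ^ m) * k <= A ^+ (2 ^ m) - B ^+ (2 ^ m).
      rewrite /k mulrBr mulr1 lerD2l lerN2.
      have -> : B ^+ (2 ^ m) = A ^+ (2 ^ m) * (B / A) ^+ (2 ^ m).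
        by rewrite expr_div_n mulrC divfK// gt_eqF// exprn_gt0.
      rewrite ler_wpM2l//; have q0 : 0 <= B / A by rewrite divr_ge0.
      have q1 : B / A <= 1 by rewrite ler_pdivrMr// mul1r ltW.
      rewrite -[leRHS]expr1; apply: ler_wiXn2l => //; exact: expn_gt0.
    rewrite -(AE m) -(powRM _ n0 (ltW k0)); apply: (ge0_ler_powR (tE m) _ _ le).
      by rewrite nnegrE mulr_ge0// ltW.
    by rewrite nnegrE subr_ge0.
  rewrite -[leRHS](AE m); apply: (ge0_ler_powR (tE m)); rewrite ?nnegrE ?subr_ge0//.
  by rewrite gerBl exprn_ge0.
- have -> : A `^ p = A `^ p * expR (0 * ln k) by rewrite mul0r expR0 mulr1.
  apply: cvgM; first by rewrite mul0r expR0 mulr1; exact: cvg_cst.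
  have -> : (fun m => k `^ (p / 2 ^+ m)) = (fun m => expR (p / 2 ^+ m * ln k)).
    by apply/funext => m; rewrite /powR (gt_eqF k0).
  apply: (@cvg_comp _ _ _ (fun m => p / 2 ^+ m * ln k) expR _ (nbhs (0 * ln k))); last exact: continuous_expR.
  apply: cvgM; last exact: cvg_cst.
  have -> : 0 = p * 0 :> R by rewrite mulr0.
  apply: cvgM; first exact: cvg_cst.
  have := @cvg_geometric R 1 2^-1; rewrite /geometric/=.
  under eq_fun do rewrite mul1r exprVn; apply.
  by rewrite ger0_norm ?invr_ge0// invf_lt1//; lra.
- exact: cvg_cst.
Qed.

(** This is the mean value inequality for the subharmonic function |.|^p,
   refined by the fact that the mean of log |y + b| over a circle equals the
   log of the larger radius. Iterating phase_step is averaging over 2^m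
   equidistributed rotations; then m tends to infinity. *)
Lemma radial_translate b :
  Int (fun y => Num.max (enorm y) (enorm b) `^ p * f y) <= Int (fun y => enorm (y + b) `^ p * f y).
Proof.
pose B := enorm b; have B0 : 0 <= B by exact: enorm_ge0.
pose h m y : R := `|enorm y ^+ (2 ^ m) - B ^+ (2 ^ m)| `^ (p / 2 ^+ m).
have -> : Int (fun y => enorm (y + b) `^ p * f y) = Int (fun y => phase 0 (- b) y * f y).
  by apply: eq_Int => y; rewrite /phase /= expr0 divr1 opprK.
have cmax : continuous (fun y : R * R => Num.max (enorm y) B).
  by move=> x; apply: continuous_max; [exact: enorm_cont|exact: cst_continuous].
have iM : integ (fun y => Num.max (enorm y) B `^ p * f y).
  apply: integ_cont_mul => //; last exact: ltW.
  by move=> x; rewrite le_max enorm_ge0.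
have mh m : mfun2 (h m).
  apply: mfun2_powR; apply: mfun2_abs; apply: mfun2B; last exact: cont_mfun2 (Cn_cont (Cn_cst 0 _)).
  by apply: mfun2X; apply: cont_mfun2; exact: enorm_cont.
have hM m y : 0 <= h m y <= Num.max (enorm y) B `^ p.
  rewrite powR_ge0 /=; set M := Num.max _ _.
  have M0 : 0 <= M by rewrite le_max enorm_ge0.
  have -> : M `^ p = (M ^+ (2 ^ m)) `^ (p / 2 ^+ m).
    rewrite -powR_mulrn// -powRrM natrX mulrCA divff ?mulr1//; by rewrite gt_eqF// exprn_gt0.
  apply: ge0_ler_powR; rewrite ?nnegrE ?exprn_ge0//; first by rewrite divr_ge0 ?(ltW p0)// exprn_ge0.
  have eM : enorm y ^+ (2 ^ m) <= M ^+ (2 ^ m) by rewrite lerXn2r ?nnegrE ?enorm_ge0// le_max lexx.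
  have bM : B ^+ (2 ^ m) <= M ^+ (2 ^ m) by rewrite lerXn2r ?nnegrE// le_max lexx orbT.
  have e0 : 0 <= enorm y ^+ (2 ^ m) by rewrite exprn_ge0// enorm_ge0.
  have b0 : 0 <= B ^+ (2 ^ m) by rewrite exprn_ge0.
  by move: eM bM e0 b0; move: (_ ^+ _) (_ ^+ _) (_ ^+ _) => s1 s2 s3 *; rewrite ler_norml; apply/andP; split; lra.
pose d y : R := (enorm y != B)%:R.
have md : mfun2 d.
  have -> : d = \1_(~` [set y | enorm y = B]).
    apply/funext => y; rewrite indicE /d; have [yB|yB] := eqVneq (enorm y) B.
      by rewrite memNset//= => /(_ yB).
    by rewrite mem_set//= => yB'; rewrite yB' eqxx in yB.
  apply: mfun2_indic; apply: measurableC.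
  rewrite -[X in measurable X]setTI; exact: (cont_mfun2 enorm_cont measurableT (measurable_set1 B)).
have mM : mfun2 (fun y => Num.max (enorm y) B `^ p * f y) by exact: integ_mfun.
have <- : Int (fun y => d y * (Num.max (enorm y) B `^ p * f y)) = Int (fun y => Num.max (enorm y) B `^ p * f y).
  apply: aeeq_Int => //; first exact: mfun2M.
  by apply: ae2S (circle_null B) => y yB; rewrite /d yB mul1r.
have c : Int (fun y => h m y * f y) @[m --> \oo] --> Int (fun y => d y * (Num.max (enorm y) B `^ p * f y)).
  apply: (@Int_dominated _ _ _ (fun y => Num.max (enorm y) B `^ p * f y)) => //.
  - by move=> m; apply: mfun2M => //; exact: integ_mfun.
  - exact: mfun2M.
  - move=> y; rewrite /d; have [yB|yB] := eqVneq (enorm y) B.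
      rewrite mul0r /h; under eq_fun do rewrite yB subrr normr0.
      apply: cvg_near_cst; apply: nearW => m; rewrite powR0 ?mul0r//.
      by rewrite mulf_neq0 ?gt_eqF// invr_gt0 exprn_gt0.
    rewrite mul1r; apply: cvgM; last exact: cvg_cst.
    by apply: gap_cvg => //; exact: enorm_ge0.
  - move=> m y; have /andP[h0 h1] := hM m y.
    by rewrite ger0_norm ?mulr_ge0// ler_wpM2r.
apply: (cvgr_to_le c); apply: nearW => m; apply: le_trans (phase_le m (- b)).
apply: Int_le; [|exact: phase_integ|].
  apply: integ_le iM; first by apply: mfun2M => //; exact: integ_mfun.
  by move=> y; have /andP[h0 h1] := hM m y; rewrite ger0_norm ?mulr_ge0// ler_wpM2r.
move=> y; rewrite ler_wpM2r// /h /phase; apply: ge0_ler_powR; rewrite ?nnegrE ?enorm_ge0//.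
  by rewrite divr_ge0 ?(ltW p0)// exprn_ge0.
apply: le_trans (enormB_ge _ _); rewrite !enorm_csqit enormN//.
Qed.
End Average.
End Radial_average.

(** * Bumps far away and a fixed competitor *)

Section Positivity.
Context {R : realType}.
Implicit Types (a b c d e r s A L : R) (f h u v w t V : R * R -> R) (g gv gw : bool -> R * R -> R) (x y z : R * R).
Local Notation T2 := (measurableTypeR R * measurableTypeR R)%type.
Local Notation mu := (@lebesgue_measure R).

Definition rect a b c d : set (R * R) := `]a, b]%classic `*` `]c, d]%classic.

Lemma measurable_rect a b c d : measurable (rect a b c d : set T2).
Proof. by apply: measurableX; exact: measurable_itv. Qed.

Lemma leb2_rect a b c d : a <= b -> c <= d -> leb2 (rect a b c d) = ((b - a) * (d - c))%:E.
Proof.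
move=> ab cd; rewrite leb2_prod; [|exact: measurable_itv|exact: measurable_itv].
have E (s r : R) : s <= r -> mu (`]s, r]%classic) = (r - s)%:E.
  move=> sr; have /= -> := lebesgue_measure_itv `]s, r]; rewrite lte_fin.
  by case: ltgtP sr => //= -> _; rewrite subrr.
by rewrite EFinM -!E.
Qed.

Lemma rect_integ a b c d : a <= b -> c <= d -> integ (\1_(rect a b c d)).
Proof.
by move=> ab cd; apply: integ_indic; [exact: measurable_rect|rewrite leb2_rect ?ltry].
Qed.

Lemma Int_rect a b c d : a <= b -> c <= d -> Int (\1_(rect a b c d)) = (b - a) * (d - c).
Proof.
move=> ab cd; rewrite /Int /Rintegral integral_indic//; last exact: measurable_rect.
by rewrite setIT [X in fine X](leb2_rect ab cd).
Qed.

Lemma Int_gt0 f a b c d : integ f -> (forall x, 0 <= f x) -> a < b -> c < d ->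
  (forall x, rect a b c d x -> 0 < f x) -> 0 < Int f.
Proof.
move=> hf f0 ab cd pf; rewrite ltNge; apply/negP => I0.
have Z := Int_le0_ae hf f0 I0.
have : Int (\1_(rect a b c d)) = 0.
  rewrite -[RHS](@Int0 R); apply: aeeq_Int.
  - by apply: mfun2_indic; exact: measurable_rect.
  - exact: integ_mfun (@integ0 R).
  - apply: ae2S Z => x fx; rewrite indicE memNset// => /pf; by rewrite fx ltxx.
rewrite Int_rect ?ltW// => /eqP; rewrite mulf_eq0 !subr_eq0.
by rewrite !gt_eqF.
Qed.

Lemma Int_ge0_ae f : mfun2 f -> {ae leb2, forall x, 0 <= f x} -> 0 <= Int f.
Proof.
move=> mf f0; rewrite (@aeeq_Int _ f (fun x => `|f x|))//.
- by apply: Int_ge0.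
- exact: mfun2_abs.
- by apply: ae2S f0 => x /ger0_norm ->.
Qed.

(** Otherwise the square of w would be bounded below on rectangles of
   arbitrarily large measure. *)
Lemma small_far w A L : sqint w -> 0 < A -> exists x, L < `|x| /\ `|w x| < A.
Proof.
move=> hw A0; apply: contrapT => /forallNP H.
have big x : L < `|x| -> A <= `|w x|.
  by move=> Lx; rewrite leNgt; apply/negP => ?; exact: (H x).
have A2 : 0 < A ^+ 2 by rewrite exprn_gt0.
pose n := (Num.truncn (Int (fun x => w x ^+ 2) / A ^+ 2)).+1.
have ln : `|L| <= `|L| + n%:R by rewrite lerDl ler0n.
have := rect_integ ln ler01 => ir.
have : A ^+ 2 * Int (\1_(rect `|L| (`|L| + n%:R) 0 1)) <= Int (fun x => w x ^+ 2).
  rewrite -IntZ//; apply: Int_le; [exact: integZ|exact: sqint_sqr|move=> x].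
  rewrite indicE; have [/set_mem [/=]|_] := boolP (x \in _); last by rewrite mulr0 sqr_ge0.
  rewrite in_itv/= => /andP[xL _] _; rewrite mulr1 -[leRHS]real_normK ?num_real//.
  rewrite lerXn2r ?nnegrE ?(ltW A0)//; apply: big.
  apply: (le_lt_trans (ler_norm L)); apply: (lt_le_trans xL); apply: (le_trans (ler_norm _)).
  exact: normp_ge1.
rewrite Int_rect// subr0 mulr1 addrAC subrr add0r -ler_pdivlMl// mulrC leNgt => /negP; apply.
exact: truncnS_gt.
Qed.

(** A test function on whose support w is as small as required, far from the
   origin. *)
Lemma far_bump w L A : continuous w -> sqint w -> (forall x, 0 < w x) -> 0 < A ->
  exists t, [/\ test_function t, forall x, 0 <= t x,
    forall x, t x != 0 -> L < `|x| /\ w x <= A & 0 < Int (fun x => w x * t x)].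
Proof.
move=> cw hw w0 A0; have [x0 [Lx wx]] := small_far L hw A0.
have : nbhs x0 [set x | L < `|x| /\ w x < A].
  apply: filterI.
    have : open ((fun y : R * R => `|y|) @^-1` [set r | L < r]).
      by apply: open_comp; [move=> y _; exact: norm_continuous|exact: open_gt].
    by rewrite openE => /(_ _ Lx).
  have : open (w @^-1` [set r | r < A]).
    by apply: open_comp; [move=> y _; exact: cw|exact: open_lt].
  by rewrite openE => /(_ x0); apply; rewrite /= (le_lt_trans (ler_norm _) wx).
move=> /nbhs_ballP [r /= r0 br].
have k0 : 0 < r / 4 by rewrite divr_gt0.
pose t := cutoff (r / 4) \o affmap 1 (- x0).
have tE x : t x = cutoff (r / 4) (x - x0) by rewrite /t /= /affmap scale1r.
have tt : test_function t.
  apply: test_affine => //; apply/test_functionP; split; first exact: smooth_cutoff.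
  by exists (2 * (r / 4)) => x; exact: cutoff_eq0.
exists t; split=> //.
- by move=> x; exact: cutoff_ge0.
- move=> x; rewrite tE => tx; have xr : `|x - x0| <= 2 * (r / 4).
    by rewrite leNgt; apply: contraNN tx => h; rewrite cutoff_eq0.
  have : ball x0 r x.
    by rewrite -ball_normE /= distrC; apply: (le_lt_trans xr); lra.
  by move=> /br [? /ltW ?].
apply: (@Int_gt0 _ (x0.1 - r / 4) x0.1 (x0.2 - r / 4) x0.2).
- exact: test_integ_mul.
- by move=> x; rewrite mulr_ge0 ?cutoff_ge0// ltW.
- by rewrite gtrBl.
- by rewrite gtrBl.
move=> x [/=]; rewrite !in_itv/= => /andP[h1 h2] /andP[h3 h4]; rewrite tE cutoff_eq1 ?mulr1//.
rewrite normp_le /= !ler_norml; apply/andP; split; apply/andP; split; lra.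
Qed.

Lemma trial_rearrange (k D P B B' D' P' : R) : 0 <= B' ->
  D + k * P - B <= k * D' + k * P' - B' -> D + k * P <= (D' + P') * k + B.
Proof. by lra. Qed.

Lemma scaled_gsq e a b :
  (e * (e * a)) ^+ 2 + (e * (e * b)) ^+ 2 = e ^+ 2 * (e ^+ 2 * (a ^+ 2 + b ^+ 2)).
Proof. ring. Qed.

(** One fixed competitor, blown down to every scale, has energy at most of
   order e^2 in the blow-up variables. *)
Lemma trial_bound V : continuous V -> (forall x, 0 <= V x) ->
  exists2 C, 0 <= C & forall q c e z w gw, 0 < q -> q <= 2 -> 0 <= c -> 0 < e ->
    rescaled_minimizer V q c e z w gw ->
    dirichlet gw + e ^+ 2 * potential V e z w <= C * e ^+ 2 + c * moment q w.
Proof.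
move=> cV V0.
have tt : test_function (@cutoff1 R).
  by apply/test_functionP; split; [exact: smooth_cutoff1|exists 2; exact: cutoff1_eq0].
have ht := test_sqint tt; have hgt := has_grad_test tt.
pose N := Int (fun x => @cutoff1 R x ^+ 2).
have N0 : 0 < N.
  apply: (@Int_gt0 _ 0 1 0 1); [exact: sqint_sqr|by move=> x; exact: sqr_ge0|exact: ltr01|exact: ltr01|].
  move=> x [/=]; rewrite !in_itv/= => /andP[h1 h2] /andP[h3 h4]; rewrite cutoff1_eq1 ?expr1n//.
  by rewrite normp_le !ler_norml; apply/andP; split; apply/andP; split; lra.
pose s := (Num.sqrt N)^-1; pose f x := s * @cutoff1 R x.
have hf : sqint f := sqintZ s ht.
pose gf i x := s * partial i (@cutoff1 R) x.
have hgf : has_grad f gf := has_gradZ s ht hgt.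
have f1 : Int (fun x => f x ^+ 2) = 1.
  rewrite (@eq_Int _ _ (fun x => s ^+ 2 * cutoff1 x ^+ 2)); last by move=> x; rewrite exprMn.
  rewrite IntZ; last exact: sqint_sqr.
  by rewrite exprVn sqr_sqrtr ?(ltW N0)// mulVf// gt_eqF.
have iVf : integ (fun x => V x * f x ^+ 2).
  have := integ_V_mul 1 0 cV ht tt.
  have -> : (fun x => V (affmap 1 0 x) * (cutoff1 x * cutoff1 x)) = (fun x => V x * cutoff1 x ^+ 2).
    by apply/funext => x; rewrite /affmap scale1r addr0 expr2.
  move=> /(integZ (s ^+ 2)); congr (_.-integrable _ _).
  by apply/funext => x /=; rewrite /f [in RHS](exprMn 2 s) mulrCA.
exists (dirichlet gf + Int (fun x => V x * f x ^+ 2)).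
  by rewrite addr_ge0 ?dirichlet_ge0//; apply: Int_ge0 => x; rewrite mulr_ge0 ?sqr_ge0.
move=> q c e z w gw q0 q2 c0 e0 [hw hg w1 fw wmin].
have PT := preserves_affine (0 : R * R) e0.
have ha := sqint_affine 0 e0 hf; have hga := has_grad_affine 0 e0 hf hgf.
have hv := sqintZ e ha; have hgv := has_gradZ e ha hga.
have PE : (fun x => V (affmap e 0 x) * (e * (f \o affmap e 0) x) ^+ 2) =
    (fun x => e ^+ 2 * ((fun x => V x * f x ^+ 2) \o affmap e 0) x).
  by apply/funext => x; rewrite /= exprMn mulrCA.
have iVa := preserves_integ PT iVf.
have fv : finite_potential V e 0 (fun x => e * (f \o affmap e 0) x).
  by rewrite /finite_potential PE; exact: integZ.
have v1 : Int (fun x => (e * (f \o affmap e 0) x) ^+ 2) = 1.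
  rewrite (@eq_Int _ _ (fun x => e ^+ 2 * ((fun x => f x ^+ 2) \o affmap e 0) x)); last by move=> x; rewrite exprMn.
  rewrite IntZ; last exact: (preserves_integ PT (sqint_sqr hf)).
  by rewrite (preserves_Int PT (sqint_sqr hf)).
have := wmin _ _ 0 hv hgv fv v1; rewrite /functional.
have -> : potential V e 0 (fun x => e * (f \o affmap e 0) x) = Int (fun x => V x * f x ^+ 2).
  by rewrite /potential PE IntZ// (preserves_Int PT iVf).
have -> : dirichlet (fun i x => e * (e * gf i (affmap e 0 x))) = e ^+ 2 * dirichlet gf.
  have ig := gsq_integ hgf; have iga := preserves_integ PT ig.
  rewrite -[dirichlet gf](preserves_Int PT ig) -IntZ//.
  rewrite /dirichlet -IntZ; last exact: integZ.
  by apply: eq_Int => x; exact: scaled_gsq.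
have := mulr_ge0 c0 (moment_ge0 q (fun x => e * (f \o affmap e 0) x)).
exact: trial_rearrange.
Qed.
End Positivity.

(** * Elementary inequalities between constants *)

Section Rearrangements.
Context {R : realType}.

Lemma limit_gap_gt0 (M k1 S0 I : R) : 0 < S0 -> I <= k1 * S0 ->
  0 < (M + 5 * M + k1 + 1 - M) * S0 - M * (5 * S0 + 0) - I.
Proof. by lra. Qed.

Lemma large_scale_absurd (A M ss S P al ek I1 I2 mm S0 ok : R) :
  0 <= A -> 0 <= M -> 0 <= ss -> 0 <= S -> 0 <= P -> 0 <= al -> ss <= ek ->
  - I1 + ek * I2 - al * P = mm * S -> A * S <= I2 ->
  0 < (ss * A - M) * S - M * (5 * S0 + ok) - I1 ->
  al <= M -> `|mm| <= M -> P <= 5 * S0 + ok -> False.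
Proof.
move=> A0 M0 s0 S0' P0 al0 ss_ek EL VL Gk alM muM Pb.
have b1 : mm * S <= M * S by rewrite ler_wpM2r// (le_trans (ler_norm _)).
have b2 : al * P <= M * (5 * S0 + ok) by apply: ler_pM.
have b3 : ss * (A * S) <= ek * I2 by apply: ler_pM => //; exact: mulr_ge0.
by move: b1 b2 b3 EL Gk; rewrite mulrBl mulrA; lra.
Qed.

Lemma fraction_le (K X : R) : 0 <= K -> 0 <= X -> K / (16 * (X + 1)) * X <= K / 16.
Proof.
move=> K0 X0; have X1 : 0 < X + 1 by rewrite ltr_wpDl.
rewrite mulrAC ler_pdivrMr ?mulr_gt0// mulrA divfK//.
by rewrite ler_wpM2l// lerDl.
Qed.

Lemma limit_negative (k1 k2 dd S0 I : R) : k2 * I <= k2 * dd * S0 -> k2 * dd * S0 <= k1 / 4 * S0 ->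
  0 < k1 * S0 -> k1 * S0 / 8 < k1 * S0 - k2 * I - k1 / 2 * S0.
Proof. by lra. Qed.

Lemma small_multiplier_absurd (k1 S0 ee I I1 al P mm S : R) :
  - I1 + ee * I - al * P = mm * S -> 0 <= P -> ee * I <= k1 * S0 / 16 ->
  k1 * S0 / 8 < I1 - k1 / 2 * S -> 0 < S -> - (k1 / 2) < mm -> 0 <= al -> 0 < k1 * S0 -> False.
Proof.
move=> EL P0 eV Gk Sp mu al0 Kp.
have b1 : - (k1 / 2) * S <= mm * S by rewrite ler_wpM2r ?(ltW Sp)// ltW.
have b2 : 0 <= al * P by exact: mulr_ge0.
by move: EL eV Gk b1 b2 Kp; lra.
Qed.
Lemma error_budget (lam s s1 t F E : R) : s1 * (F + 2) <= s / 4 -> (lam + 1) * t <= s / 8 ->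
  E <= s / 4 -> s1 * t <= s1 -> 0 < s1 -> 0 < t -> 0 < s ->
  (lam + s1) * (F + 2 * t) + E <= lam * F + s.
Proof. by lra. Qed.
End Rearrangements.

(** * Asymptotics of a concentrating sequence *)

Section Concentration.
Context {R : realType}.
Local Notation T2 := (measurableTypeR R * measurableTypeR R)%type.
Variables (V : R * R -> R) (a : R) (q c e : nat -> R) (z : nat -> R * R) (y0 : R * R).
Variables (w d : nat -> R * R -> R) (g gd : nat -> bool -> R * R -> R).
Variables (w0 : R * R -> R) (g0 : bool -> R * R -> R) (k1 k2 : R).
Hypotheses (cV : continuous V) (V0 : forall x, 0 <= V x) (Vinf : tends_to_infinity V).
Hypotheses (zc : z k @[k --> \oo] --> y0) (q1 : forall k, 1 <= q k) (q2 : forall k, q k <= 2).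
Hypotheses (e0 : forall k, 0 < e k) (a0 : 0 < a).
Hypothesis cE : forall k, c k = 2 * a / (q k + 2) * e k `^ (2 - q k).
Hypothesis wm : forall k, rescaled_minimizer V (q k) (c k) (e k) (z k) (w k) (g k).
Hypothesis wpos : forall k, {ae leb2, forall x, 0 <= w k x}.
Hypotheses (hw0 : sqint w0) (hg0 : has_grad w0 g0) (C2w0 : Cn 2 w0) (w0p : forall x, 0 < w0 x).
Hypotheses (k1p : 0 < k1) (k2p : 0 <= k2).
Hypothesis eqw0 : forall x, lap w0 x = k1 * w0 x - k2 * w0 x ^+ 3.
Hypotheses (hd : forall k, sqint (d k)) (hgd : forall k, has_grad (d k) (gd k)).
Hypothesis wE : forall k x, w k x = w0 x + d k x.
Hypothesis gE : forall k i x, g k i x = g0 i x + gd k i x.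
Let h k := Int (fun x => d k x ^+ 2) + dirichlet (gd k).
Hypothesis hc : h k @[k --> \oo] --> (0 : R).

Let hw k : sqint (w k). Proof. by have [] := wm k. Qed.
Let hg k : has_grad (w k) (g k). Proof. by have [] := wm k. Qed.
Let w1 k : Int (fun x => w k x ^+ 2) = 1. Proof. by have [] := wm k. Qed.
Let fw k : finite_potential V (e k) (z k) (w k). Proof. by have [] := wm k. Qed.
Let q0 k : 0 < q k. Proof. exact: lt_le_trans ltr01 (q1 k). Qed.

Lemma c_ge0 k : 0 <= c k.
Proof.
rewrite cE mulr_ge0 ?powR_ge0// divr_ge0 ?mulr_ge0 ?(ltW a0)// addr_ge0// ltW//.
Qed.

Lemma sqr_d_le k : Int (fun x => d k x ^+ 2) <= h k.
Proof. by rewrite lerDl dirichlet_ge0. Qed.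

Lemma sqrt_h_cvg : Num.sqrt (h k) @[k --> \oo] --> (0 : R).
Proof. by rewrite -sqrtr0; apply: (cvg_comp _ _ hc); exact: sqrt_continuous. Qed.

Lemma sqint_abs (f : R * R -> R) : sqint f -> sqint (fun x => `|f x|).
Proof. by move=> hf; apply: (sqint_le _ _ hf); [apply: mfun2_abs; exact: sqint_mfun|move=> x; rewrite normr_id]. Qed.

Lemma d_small t : sqint t -> Int (fun x => `|d k x| * `|t x|) @[k --> \oo] --> (0 : R).
Proof.
move=> ht; apply: (@squeeze_cvgr _ _ _ _ (fun=> 0) (fun k => Num.sqrt (h k) * Num.sqrt (Int (fun x => t x ^+ 2)))).
- apply: nearW => k; apply/andP; split; first by apply: Int_ge0 => x; rewrite mulr_ge0.
  apply: (le_trans (ler_norm _)); apply: (le_trans (Cauchy_Schwarz_sqrt (sqint_abs (hd k)) (sqint_abs ht))).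
  have E (f : R * R -> R) : Int (fun x => `|f x| ^+ 2) = Int (fun x => f x ^+ 2).
    by apply: eq_Int => x; rewrite real_normK ?num_real.
  by rewrite !E ler_wpM2r ?sqrtr_ge0// ler_wsqrtr// sqr_d_le.
- exact: cvg_cst.
- have -> : 0 = 0 * Num.sqrt (Int (fun x => t x ^+ 2)) by rewrite mul0r.
  by apply: cvgM; [exact: sqrt_h_cvg|exact: cvg_cst].
Qed.

Lemma w_cvg t : sqint t -> Int (fun x => w k x * t x) @[k --> \oo] --> Int (fun x => w0 x * t x).
Proof.
move=> ht; have E k : Int (fun x => w k x * t x) = Int (fun x => w0 x * t x) + Int (fun x => d k x * t x).
  rewrite -IntD; [|exact: integ_mul|exact: integ_mul].
  by apply: eq_Int => x; rewrite wE mulrDl.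
suff dc : Int (fun x => d k x * t x) @[k --> \oo] --> (0 : R).
  rewrite (_ : (fun k => _) = (fun k => Int (fun x => w0 x * t x) + Int (fun x => d k x * t x))); last first.
    by apply/funext => k; rewrite E.
  rewrite -[X in _ --> X](addr0 (Int _)); apply: cvgD => //; exact: cvg_cst.
apply: norm_cvg0; apply: (@squeeze_cvgr _ _ _ _ (fun=> 0) (fun k => Int (fun x => `|d k x| * `|t x|))).
- apply: nearW => k; rewrite normr_ge0 /=; apply: Int_abs_le; [exact: integ_mul| |by move=> x; rewrite normrM].
  by apply: integ_mul; exact: sqint_abs.
- exact: cvg_cst.
- exact: d_small.
Qed.

Lemma sqr_sum_le (s r : R) : (s + r) ^+ 2 <= 2 * s ^+ 2 + 2 * r ^+ 2.
Proof. by have := sqr_ge0 (s - r); lra. Qed.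

Lemma density_le k x : w k x ^+ 2 + gsq (g k) x <= 2 * (w0 x ^+ 2 + gsq g0 x) + 2 * (d k x ^+ 2 + gsq (gd k) x).
Proof.
rewrite /gsq wE !gE.
have := sqr_sum_le (w0 x) (d k x); have := sqr_sum_le (g0 false x) (gd k false x).
have := sqr_sum_le (g0 true x) (gd k true x); lra.
Qed.

Lemma tail_w k r : tail r (w k) (g k) <= 2 * tail r w0 g0 + 2 * h k.
Proof.
have i0 := H1density_integ hw0 hg0; have i1 := H1density_integ (hd k) (hgd k).
have -> : h k = Int (fun x => d k x ^+ 2 + gsq (gd k) x).
  by rewrite /h IntD//; [exact: sqint_sqr|exact: gsq_integ].
rewrite -!IntZ//; [|exact: integ_off].
rewrite -IntD; [|by apply: integZ; exact: integ_off|exact: integZ].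
apply: Int_le; [by apply: integ_off; exact: H1density_integ| |].
  by apply: integD; apply: integZ => //; exact: integ_off.
move=> x; have := density_le k x; have := H1density_ge0 (d k) (gd k) x.
have := off_ge0 r x; have := off_le1 r x; set o := off r x.
set A := w k x ^+ 2 + _; set B := w0 x ^+ 2 + _; set C := d k x ^+ 2 + _ => o1 o0 C0 le.
apply: (le_trans (ler_wpM2l o0 le)); rewrite mulrDr mulrCA lerD2l mulrCA ler_wpM2l//.
exact: ler_piMl.
Qed.

Lemma dirichlet_w k : dirichlet (g k) <= 2 * dirichlet g0 + 2 * h k.
Proof.
have ig := gsq_integ (hgd k); have ig0 := gsq_integ hg0.
apply: (@le_trans _ _ (2 * dirichlet g0 + 2 * dirichlet (gd k))); last first.
  by rewrite lerD2l ler_wpM2l// lerDr Int_sqr_ge0.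
rewrite /dirichlet -!IntZ// -IntD; [|exact: integZ|exact: integZ].
apply: Int_le; [exact: gsq_integ (hg k)|by apply: integD; exact: integZ|].
move=> x; rewrite /gsq !gE; have := sqr_sum_le (g0 false x) (gd k false x).
have := sqr_sum_le (g0 true x) (gd k true x); lra.
Qed.

Lemma z_near : \forall k \near \oo, enorm (z k) < enorm y0 + 1.
Proof.
have zE : enorm (z k) @[k --> \oo] --> enorm y0 by apply: (cvg_comp _ _ zc); exact: enorm_cont.
by apply: (cvgr_lt _ zE); rewrite ltrDl.
Qed.

Lemma h_near s : 0 < s -> \forall k \near \oo, h k < s.
Proof. by move=> s0; apply: (cvgr_lt (0 : R)). Qed.

Lemma moment_bound : exists2 B, 0 <= B & \forall k \near \oo, moment (q k) (w k) <= B.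
Proof.
pose D := 2 * dirichlet g0 + 2; have D0 : 0 <= D by rewrite addr_ge0// mulr_ge0// dirichlet_ge0.
exists (1 + 4 * ((1 + D) * (1 + D))).
  by rewrite addr_ge0// mulr_ge0// mulr_ge0// addr_ge0.
near=> k; have hk : h k < 1 by near: k; exact: h_near.
have [i4 L] := Ladyzhenskaya (hw k) (hg k).
apply: (@le_trans _ _ (Int (fun x => w k x ^+ 2) + Int (fun x => w k x ^+ 4))).
  rewrite -IntD//; last exact: sqint_sqr.
  apply: Int_le; [exact: integ_moment (hw k) (hg k) (ltW (q0 k)) (q2 k)|by apply: integD => //; exact: sqint_sqr|].
  by move=> x; have := powR_le_sqr_quartic (normr_ge0 (w k x)) (ltW (q0 k)) (q2 k); rewrite !norm_even.
rewrite w1 lerD2l; apply: (le_trans L); rewrite ler_wpM2l// w1.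
have DW : dirichlet (g k) <= D by apply: (le_trans (dirichlet_w k)); rewrite /D lerD2l; lra.
have sp i : Int (fun x => g k i x ^+ 2) <= dirichlet (g k).
  apply: Int_le; [by apply: sqint_sqr; exact: has_grad_sqint (hg k)|exact: gsq_integ (hg k)|].
  by move=> x; rewrite /gsq; case: i; rewrite ?lerDl ?lerDr sqr_ge0.
by apply: ler_pM; rewrite ?addr_ge0 ?Int_sqr_ge0// lerD2l; exact: le_trans (sp _) DW.
Unshelve. all: by end_near. Qed.

Lemma alpha_le k : c k * (q k + 2) / 2 <= a * (1 + e k).
Proof.
have -> : c k * (q k + 2) / 2 = a * e k `^ (2 - q k).
  by rewrite cE; have := q1 k; move: (q k) (_ `^ _) => s r s1; field; rewrite gt_eqF//; lra.
rewrite ler_wpM2l ?(ltW a0)//; have ep := e0 k.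
have q10 := q1 k; have q20 := q2 k.
have [e1|/ltW e1] := leP (e k) 1.
  apply: (@le_trans _ _ 1); last by rewrite lerDl ltW.
  rewrite -[leRHS](powRr0 (e k)); apply: ger_powR; first by rewrite ep.
  by rewrite subr_ge0; exact: q2.
apply: (@le_trans _ _ (e k)); last by rewrite lerDr.
by rewrite -[leRHS]powRr1 ?(ltW ep)//; apply: ler_powR => //; lra.
Qed.

Lemma alpha_ge0 k : 0 <= c k * (q k + 2) / 2.
Proof. by rewrite divr_ge0// mulr_ge0 ?c_ge0// addr_ge0// ltW. Qed.

Lemma c_le_alpha k : c k <= c k * (q k + 2) / 2.
Proof.
rewrite -mulrA ler_peMr ?c_ge0// ler_pdivlMr// mul1r lerDr; exact: ltW.
Qed.

(** Some mass stays away from the origin, where V is large if e k is; this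
   contradicts trial_bound. *)
Lemma e_bounded : exists2 E, 0 < E & \forall k \near \oo, e k <= E.
Proof.
have [C C0 tr] := trial_bound cV V0; have [B B0 mB] := moment_bound.
pose m0 := Int (fun x => off 1 x * w0 x ^+ 2).
have m0p : 0 < m0.
  apply: (@Int_gt0 _ _ 1 2 0 1); [exact/integ_off/sqint_sqr| | |exact: ltr01|].
  - by move=> x; rewrite mulr_ge0 ?off_ge0 ?sqr_ge0.
  - by rewrite ltr1n.
  move=> x [/=]; rewrite !in_itv/= => /andP[x1 _] _.
  rewrite /off (lt_le_trans x1) ?mul1r ?exprn_gt0//.
  by apply: le_trans (normp_ge1 x); exact: ler_norm.
pose A := 4 / m0 * (C + 2 * a * B) + 1.
have [rho HA] := Vinf A.
pose Z := enorm y0 + 1.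
have A0 : 0 < A.
  by rewrite ltr_wpDl// mulr_ge0 ?divr_ge0 ?(ltW m0p)// addr_ge0// mulr_ge0// mulr_ge0// ltW.
exists (Num.max 1 (`|rho| + Z)); first by rewrite lt_max ltr01.
near=> k; rewrite leNgt; apply/negP; rewrite gt_max => /andP[e1 eZ].
have hk : h k < m0 / 4 by near: k; apply: h_near; rewrite divr_gt0.
have zk : enorm (z k) < Z by near: k; exact: z_near.
have mBk : moment (q k) (w k) <= B by near: k.
have ek := e0 k.
have iw := sqint_sqr (hw k); have id := sqint_sqr (hd k); have iw0 := sqint_sqr hw0.
have mass : m0 / 4 <= Int (fun x => off 1 x * w k x ^+ 2).
  have : m0 <= 2 * Int (fun x => off 1 x * w k x ^+ 2) + 2 * Int (fun x => d k x ^+ 2).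
    have io := integ_off 1 iw.
    rewrite -!IntZ// -IntD; [|exact: integZ|exact: integZ].
    apply: Int_le; [exact: integ_off|by apply: integD; exact: integZ|].
    move=> x; have := sqr_sum_le (w k x) (- d k x).
    have -> : w k x - d k x = w0 x by rewrite wE addrK.
    rewrite sqrrN => le; have o0 := off_ge0 1 x; have o1 := off_le1 1 x.
    apply: (le_trans (ler_wpM2l o0 le)); rewrite mulrDr mulrCA lerD2l mulrCA ler_wpM2l//.
    by rewrite ler_piMl ?sqr_ge0.
  have := sqr_d_le k; move: hk; set I1 := Int _; set I2 := Int _.
  move: I1 I2 => I1 I2; lra.
have big x : off 1 x * A <= V (affmap (e k) (z k) x) * off 1 x.
  rewrite /off; have [x1|_] := ltP 1 `|x|; last by rewrite mul0r mulr0.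
  rewrite mul1r mulr1; apply: ltW; apply: HA.
  apply: (le_lt_trans (ler_norm rho)).
  have : enorm (e k *: x) <= enorm (affmap (e k) (z k) x) + enorm (z k).
    have {1}-> : e k *: x = affmap (e k) (z k) x + - z k by rewrite /affmap addrK.
    by rewrite (le_trans (enormD _ _))// enormN.
  rewrite enormZ ?(ltW ek)// => le.
  have : e k * 1 <= e k * enorm x.
    by rewrite ler_wpM2l ?(ltW ek)// (le_trans (ltW x1))// normp_le_enorm.
  rewrite mulr1; lra.
have PE : A * (m0 / 4) <= potential V (e k) (z k) (w k).
  apply: (@le_trans _ _ (A * Int (fun x => off 1 x * w k x ^+ 2))); first by rewrite ler_wpM2l ?(ltW A0).
  have io := integ_off 1 iw; rewrite -IntZ//; apply: Int_le; [exact: integZ|exact: fw|].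
  move=> x; rewrite mulrA ler_wpM2r ?sqr_ge0// mulrC (le_trans (big x))//.
  by rewrite ler_piMr ?off_le1.
have := tr _ _ _ _ _ _ (q0 k) (q2 k) (c_ge0 k) ek (wm k).
have D0 := dirichlet_ge0 (g k).
have cB : c k * moment (q k) (w k) <= a * (1 + e k) * B.
  apply: ler_pM; rewrite ?c_ge0 ?moment_ge0//.
  exact: le_trans (c_le_alpha k) (alpha_le k).
have e2 : 0 < e k ^+ 2 by rewrite exprn_gt0.
have ee : a * (1 + e k) * B <= 2 * a * B * e k ^+ 2.
  have -> : 2 * a * B * e k ^+ 2 = a * (2 * e k ^+ 2) * B by ring.
  rewrite ler_wpM2r// ler_wpM2l ?(ltW a0)//.
  have : e k * 1 <= e k ^+ 2 by rewrite expr2 ler_wpM2l ?(ltW ek)// ltW.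
  lra.
have eP : e k ^+ 2 * (A * (m0 / 4)) <= e k ^+ 2 * potential V (e k) (z k) (w k) by rewrite ler_wpM2l// ltW.
have Am : A * (m0 / 4) = C + 2 * a * B + m0 / 4.
  by rewrite /A mulrDl mul1r mulrAC mulrACA; congr (_ + _); field; rewrite gt_eqF.
rewrite Am in eP; have pos : 0 < e k ^+ 2 * (m0 / 4) by rewrite mulr_gt0// divr_gt0.
move: D0 cB ee eP pos; set DD := dirichlet _; set P := potential _ _ _ _; set cM := c k * _.
set X := a * (1 + e k) * B; move: DD P cM X => DD P cM X; lra.
Unshelve. all: by end_near. Qed.

Lemma multiplier_bounded : exists2 M, 0 <= M & \forall k \near \oo,
  c k * (q k + 2) / 2 <= M /\ `|multiplier V (q k) (c k) (e k) (z k) (w k) (g k)| <= M.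
Proof.
have [C C0 tr] := trial_bound cV V0; have [B B0 mB] := moment_bound; have [E Ep eE] := e_bounded.
pose al := a * (1 + E).
have al0 : 0 <= al by rewrite mulr_ge0 ?(ltW a0)// addr_ge0// ltW.
exists (C * E ^+ 2 + 2 * (al * B) + al).
  by apply: addr_ge0 => //; apply: addr_ge0; apply: mulr_ge0 => //; [exact: sqr_ge0|exact: mulr_ge0].
near=> k; have mBk : moment (q k) (w k) <= B by near: k.
have eEk : e k <= E by near: k.
have alk : c k * (q k + 2) / 2 <= al.
  by apply: (le_trans (alpha_le k)); rewrite ler_wpM2l ?(ltW a0)// lerD2l.
have aB : c k * (q k + 2) / 2 * moment (q k) (w k) <= al * B.
  by apply: ler_pM; rewrite ?alpha_ge0 ?moment_ge0.
have cB : c k * moment (q k) (w k) <= al * B.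
  by apply: ler_pM; rewrite ?c_ge0 ?moment_ge0// (le_trans (c_le_alpha k)).
have aB0 : 0 <= c k * (q k + 2) / 2 * moment (q k) (w k) by rewrite mulr_ge0 ?alpha_ge0 ?moment_ge0.
have e2 : C * e k ^+ 2 <= C * E ^+ 2 by rewrite ler_wpM2l// lerXn2r ?nnegrE ?(ltW (e0 k))// ltW.
have K0 : 0 <= dirichlet (g k) + e k ^+ 2 * potential V (e k) (z k) (w k).
  by rewrite addr_ge0 ?dirichlet_ge0// mulr_ge0 ?sqr_ge0 ?potential_ge0.
have CE0 : 0 <= C * E ^+ 2 by rewrite mulr_ge0 ?sqr_ge0.
have aB1 : 0 <= al * B by rewrite mulr_ge0.
have := tr _ _ _ _ _ _ (q0 k) (q2 k) (c_ge0 k) (e0 k) (wm k).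
rewrite /multiplier; move: alk aB cB aB0 e2 K0 CE0 aB1 al0.
set K := dirichlet _ + _; set m1 := _ * moment _ _; set m2 := c k * moment _ _; set alk := c k * _ / 2.
set x1 := C * _; set x2 := C * _; set x3 := al * B.
move: K m1 m2 alk x1 x2 x3 => K m1 m2 alk x1 x2 x3 *; split; first lra.
by rewrite ler_norml; apply/andP; split; lra.
Unshelve. all: by end_near. Qed.

(** Integrating by parts twice moves the Laplacian onto the smooth function
   w0, where the equation is available. *)
Lemma lap_w0 t : test_function t ->
  Int (fun x => w0 x * lap t x) = k1 * Int (fun x => w0 x * t x) - k2 * Int (fun x => w0 x ^+ 3 * t x).
Proof.
move=> tt; have [M vt] := (proj2 (proj1 (test_functionP t) tt)).
have C1w0 : Cn 1 w0 := Cn_pred C2w0.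
have E i : Int (fun x => w0 x * partial i (partial i t) x) = Int (fun x => partial i (partial i w0) x * t x).
  rewrite (@integration_by_parts2 _ M); [|exact: C1w0|exact: test_smooth 1 (test_partial i tt)|]; last first.
    by apply: vanishes_partial => //; exact: test_smooth.
  rewrite (@integration_by_parts2 _ M) ?opprK//; [exact: Cn_partial C2w0|exact: test_smooth].
have cw : continuous w0 := Cn_cont C1w0; have ct := test_cont tt.
have ip i : integ (fun x => partial i (partial i w0) x * t x).
  apply: (@csupp_cont_integ _ M); last by move=> x xM; rewrite vt// mulr0.
  by apply: contM => //; exact: (Cn_cont (Cn_partial i (Cn_partial i C2w0))).
have i1 : integ (fun x => w0 x * t x) by exact: test_integ_mul.
have i3 : integ (fun x => w0 x ^+ 3 * t x).
  apply: (@csupp_cont_integ _ M); last by move=> x xM; rewrite vt// mulr0.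
  apply: contM => //; exact: (contM cw (contM cw cw)).
have it i : integ (fun x => w0 x * partial i (partial i t) x).
  by apply: test_integ_mul => //; do 2 apply: test_partial.
rewrite -!IntZ// -IntB; [|exact: integZ|exact: integZ].
have L : Int (fun x => w0 x * lap t x) = Int (fun x => w0 x * partial false (partial false t) x) +
    Int (fun x => w0 x * partial true (partial true t) x).
  rewrite -(IntD (it false) (it true)); apply: eq_Int => x; exact: mulrDr.
apply: (etrans L); apply: (etrans (f_equal2 +%R (E false) (E true))).
apply: (etrans (esym (IntD (ip false) (ip true)))); apply: eq_Int => x.
transitivity (lap w0 x * t x); first by rewrite /lap mulrDl.
by rewrite eqw0 mulrBl -!mulrA.
Qed.

Lemma cube_sum_le (s r : R) : 0 <= s -> 0 <= r -> (s + r) ^+ 3 <= 4 * s ^+ 3 + 4 * r ^+ 3.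
Proof.
move=> s0 r0; rewrite -subr_ge0.
have -> : 4 * s ^+ 3 + 4 * r ^+ 3 - (s + r) ^+ 3 = 3 * ((s + r) * (s - r) ^+ 2) by ring.
by rewrite mulr_ge0// mulr_ge0 ?addr_ge0 ?sqr_ge0.
Qed.

Lemma quartic_d k : integ (fun x => d k x ^+ 4) /\ Int (fun x => d k x ^+ 4) <= 4 * h k ^+ 2.
Proof.
have [i4 L] := Ladyzhenskaya (hd k) (hgd k); split=> //; apply: (le_trans L).
rewrite ler_wpM2l// expr2.
have sp i : Int (fun x => d k x ^+ 2) + Int (fun x => gd k i x ^+ 2) <= h k.
  rewrite lerD2l; apply: Int_le; [by apply: sqint_sqr; exact: has_grad_sqint (hgd k)|exact: gsq_integ (hgd k)|].
  by move=> x; rewrite /gsq; case: i; rewrite ?lerDl ?lerDr sqr_ge0.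
by apply: ler_pM; rewrite ?addr_ge0 ?Int_sqr_ge0// sp.
Qed.

Lemma power_bound_pointwise (s r t T p : R) : 0 <= s -> 0 <= t -> t <= T -> (t != 0 -> s <= 1) ->
  1 <= p -> p <= 2 ->
  `|s + r| `^ (p + 1) * t <= 5 * (s * t) + `|r| * `|t| + 4 * T * (r ^+ 2 + r ^+ 4).
Proof.
move=> s0 t0 tT st p1 p2; have pos : 0 <= r ^+ 2 + r ^+ 4 by rewrite addr_ge0 ?exprn_even_ge0.
have T0 : 0 <= T by exact: le_trans tT.
have [->|tN] := eqVneq t 0.
  by rewrite normr0 !mulr0 !add0r mulr_ge0// mulr_ge0.
have s1 := st tN; rewrite (ger0_norm t0).
have p0 : 0 <= p by lra.
have A := powR_le_lin_cube (normr_ge0 (s + r)) p0 p2.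
have B : `|s + r| <= s + `|r| by rewrite (le_trans (ler_normD _ _))// ger0_norm.
have C : `|s + r| ^+ 3 <= (s + `|r|) ^+ 3 by rewrite lerXn2r ?nnegrE ?addr_ge0.
have D := cube_sum_le s0 (normr_ge0 r).
have E := abs_cube_le r.
have F : s ^+ 3 <= s by rewrite exprS ler_piMr// exprn_ile1.
have G : `|s + r| `^ (p + 1) <= 5 * s + `|r| + 4 * (r ^+ 2 + r ^+ 4).
  have alg (m m1 m3 n n3 s3 p3 e2 : R) : m <= m1 + m3 -> m1 <= s + n -> m3 <= p3 ->
     p3 <= 4 * s3 + 4 * n3 -> n3 <= e2 -> s3 <= s -> m <= 5 * s + n + 4 * e2 by lra.
  exact: (alg _ _ _ _ _ _ _ _ A B C D E F).
apply: (le_trans (ler_wpM2r t0 G)); move: pos; move: (r ^+ 2 + r ^+ 4) => X X0.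
rewrite mulrDl mulrDl -(mulrA 5) lerD2l [leRHS]mulrAC.
by rewrite ler_wpM2l// mulr_ge0.
Qed.

(** An upper bound linear in w0 is what the test of the Euler-Lagrange
   equation calls for; it holds because the test function lives where w0 <= 1.
   *)
Lemma power_bound t : test_function t -> (forall x, 0 <= t x) -> (forall x, t x != 0 -> w0 x <= 1) ->
  exists o : nat -> R, o k @[k --> \oo] --> (0 : R) /\
   forall k, Int (fun x => `|w k x| `^ (q k + 1) * t x) <= 5 * Int (fun x => w0 x * t x) + o k.
Proof.
move=> tt t0 tw; have [M vt] := (proj2 (proj1 (test_functionP t) tt)).
have [T T0 tT] := cont_vanishes_bounded (test_cont tt) vt.
have ht := test_sqint tt.
exists (fun k => Int (fun x => `|d k x| * `|t x|) + 4 * T * (h k + 4 * (h k * h k))); split.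
  have hh : h k * h k @[k --> \oo] --> (0 : R) by rewrite -[X in _ --> X](mulr0 0); exact: cvgM.
  have h4 : h k + 4 * (h k * h k) @[k --> \oo] --> (0 : R).
    rewrite -[X in _ --> X](addr0 0) -[X in _ + X](mulr0 4); apply: cvgD => //.
    by apply: cvgM => //; exact: cvg_cst.
  rewrite -[X in _ --> X](addr0 0) -[X in _ + X](mulr0 (4 * T)); apply: cvgD; first exact: d_small.
  by apply: cvgM => //; exact: cvg_cst.
move=> k; have [i4 L4] := quartic_d k.
have i2 := sqint_sqr (hd k); have i24 := integD i2 i4.
have i0 : integ (fun x => w0 x * t x) by exact: test_integ_mul.
have i1 : integ (fun x => `|d k x| * `|t x|) by apply: integ_mul; exact: sqint_abs.
have i5 := integZ 5 i0; have i6 := integZ (4 * T) i24.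
apply: (@le_trans _ _ (Int (fun x => 5 * (w0 x * t x) + `|d k x| * `|t x| + 4 * T * (d k x ^+ 2 + d k x ^+ 4)))).
  apply: Int_le.
  - by apply: integ_moment_test tt (ltW (q0 k)) (q2 k); [exact: hw|exact: hg].
  - by apply: integD => //; exact: integD.
  move=> x; rewrite wE; apply: power_bound_pointwise => //; [exact: ltW|by rewrite (le_trans (ler_norm _))|exact: tw].
rewrite (IntD (integD i5 i1) i6) (IntD i5 i1) (IntZ _ i0) (IntZ _ i24) (IntD i2 i4) -addrA lerD2l lerD2l.
rewrite ler_wpM2l ?mulr_ge0//; apply: lerD; [exact: sqr_d_le|by rewrite -expr2].
Qed.

Lemma V_term_lower (k : nat) (t : R * R -> R) (A : R) : test_function t -> (forall x, 0 <= t x) ->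
  (forall x, t x != 0 -> A <= V (affmap (e k) (z k) x)) ->
  A * Int (fun x => w k x * t x) <= Int (fun x => V (affmap (e k) (z k) x) * (w k x * t x)).
Proof.
move=> tt t0 AV; have i1 := integ_V_mul (e k) (z k) cV (hw k) tt.
have i2 := integZ A (test_integ_mul (hw k) tt).
rewrite -IntZ; last exact: test_integ_mul.
rewrite -subr_ge0 -(IntB i1 i2); apply: Int_ge0_ae; first exact: integ_mfun (integB i1 i2).
apply: ae2S (wpos k) => x wx; rewrite -mulrBl.
have [->|tN] := eqVneq (t x) 0; first by rewrite !mulr0.
by rewrite mulr_ge0 ?subr_ge0 ?AV// mulr_ge0.
Qed.

(** Test the Euler-Lagrange equation with a bump where w0 <= 1 and, if e k
   does not tend to 0, V is as large as required. Everything but the potential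
   term is bounded by a constant times the integral of w0 t, and the constant
   does not depend on the bump. *)
Lemma e_small (s : R) : 0 < s -> \forall k \near \oo, e k < s.
Proof.
move=> s0; have [M M0 bM] := multiplier_bounded.
(* A height of V that beats all other terms once e k >= s. *)
pose A := (M + 5 * M + k1 + 1) / s ^+ 2.
have s2 : 0 < s ^+ 2 by rewrite exprn_gt0.
have A0 : 0 <= A by rewrite divr_ge0 ?(ltW s2)// !addr_ge0 ?mulr_ge0 ?(ltW k1p).
have [rho HA] := Vinf A; pose Z := enorm y0 + 1.
pose L := (`|rho| + Z) / s.
have cw : continuous w0 := Cn_cont C2w0.
have [t [tt t0 tw tp]] := far_bump L cw hw0 w0p ltr01.
have [ok [okc okb]] := power_bound tt t0 (fun x tx => (tw x tx).2).
have ht := test_sqint tt; have hl := test_sqint (test_lap tt).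
have cS := w_cvg ht; have cL := w_cvg hl.
set S0 := Int (fun x => w0 x * t x) in tp okb cS.
have L0 : Int (fun x => w0 x * lap t x) <= k1 * S0.
  rewrite lap_w0// gerBl mulr_ge0//; apply: Int_ge0 => x.
  by rewrite mulr_ge0// exprn_ge0// ltW.
pose G k := (s ^+ 2 * A - M) * Int (fun x => w k x * t x) - M * (5 * S0 + ok k) - Int (fun x => w k x * lap t x).
have cG : G k @[k --> \oo] --> (s ^+ 2 * A - M) * S0 - M * (5 * S0 + 0) - Int (fun x => w0 x * lap t x).
  apply: cvgB => //; apply: cvgB; apply: cvgM => //; try exact: cvg_cst.
  by apply: cvgD => //; exact: cvg_cst.
have G0 : 0 < (s ^+ 2 * A - M) * S0 - M * (5 * S0 + 0) - Int (fun x => w0 x * lap t x).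
  have -> : s ^+ 2 * A = M + 5 * M + k1 + 1 by rewrite mulrC divfK// gt_eqF.
  exact: limit_gap_gt0.
near=> k; rewrite ltNge; apply/negP => se.
have Gk : 0 < G k by near: k; exact: (cvgr_gt _ cG _ G0).
have [al mu] : c k * (q k + 2) / 2 <= M /\ `|multiplier V (q k) (c k) (e k) (z k) (w k) (g k)| <= M by near: k.
have zk : enorm (z k) < Z by near: k; exact: z_near.
have big x : t x != 0 -> A <= V (affmap (e k) (z k) x).
  move=> /tw[Lx _]; apply: ltW; apply: HA; apply: (le_lt_trans (ler_norm rho)).
  have : enorm (e k *: x) <= enorm (affmap (e k) (z k) x) + enorm (z k).
    have {1}-> : e k *: x = affmap (e k) (z k) x + - z k by rewrite /affmap addrK.
    by rewrite (le_trans (enormD _ _))// enormN.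
  rewrite enormZ ?(ltW (e0 k))// => le.
  have : s * L < e k * enorm x.
    apply: (@lt_le_trans _ _ (s * enorm x)); first by rewrite ltr_pM2l// (lt_le_trans Lx)// normp_le_enorm.
    by rewrite ler_wpM2r ?enorm_ge0.
  rewrite /L mulrC divfK ?gt_eqF//; lra.
have S1 : 0 <= Int (fun x => w k x * t x).
  apply: Int_ge0_ae; first exact: integ_mfun (test_integ_mul (hw k) tt).
  by apply: ae2S (wpos k) => x wx; rewrite mulr_ge0.
have EL := Euler_Lagrange cV (q0 k) (q2 k) (c_ge0 k) (wm k) (wpos k) tt.
have VL := V_term_lower tt t0 big.
have := okb k; move: EL VL Gk al mu; rewrite /G.
have e2 : s ^+ 2 <= e k ^+ 2 by rewrite lerXn2r ?nnegrE ?(ltW (e0 k))// ltW.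
have al0 := alpha_ge0 k.
have P0 : 0 <= Int (fun x => `|w k x| `^ (q k + 1) * t x).
  by apply: Int_ge0 => x; rewrite mulr_ge0 ?powR_ge0.
move=> EL VL Gk al mu Pb.
exact: (large_scale_absurd A0 M0 (ltW s2) S1 P0 al0 e2 EL VL Gk al mu Pb).
Unshelve. all: by end_near. Qed.

(** Test with a bump on which w0 is so small that the cubic term of its
   equation is negligible: there lap w0 is close to k1 w0, so the multiplier
   is close to - k1 or below. The nonlinear term of the Euler-Lagrange
   equation has the good sign and is dropped. *)
Lemma multiplier_neg : \forall k \near \oo,
  multiplier V (q k) (c k) (e k) (z k) (w k) (g k) <= - (k1 / 2).
Proof.
have cw : continuous w0 := Cn_cont C2w0.
(* On the support of the bump the cubic term is then at most a quarter of the
   linear one. *)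
pose de := Num.min 1 (k1 / (4 * (k2 + 1))).
have kk : 0 < 4 * (k2 + 1) by rewrite mulr_gt0// ltr_wpDl.
have de0 : 0 < de by rewrite lt_min ltr01 divr_gt0.
have de1 : de <= 1 by rewrite ge_min lexx.
have dk : k2 * de ^+ 2 <= k1 / 4.
  apply: (@le_trans _ _ ((k2 + 1) * de)).
    apply: ler_pM => //; [exact: sqr_ge0|by rewrite lerDl|by rewrite expr2 ler_piMl ?(ltW de0)].
  have : de <= k1 / (4 * (k2 + 1)) by rewrite ge_min lexx orbT.
  rewrite ler_pdivlMr// ler_pdivlMr//; lra.
have [t [tt t0 tw tp]] := far_bump 0 cw hw0 w0p de0.
have ht := test_sqint tt; have hl := test_sqint (test_lap tt); have ha := sqint_abs ht.
have [r vt] := (proj2 (proj1 (test_functionP t) tt)).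
have cS := w_cvg ht; have cL := w_cvg hl.
set S0 := Int (fun x => w0 x * t x) in tp cS.
have L0 : Int (fun x => w0 x * lap t x) = k1 * S0 - k2 * Int (fun x => w0 x ^+ 3 * t x) by exact: lap_w0.
have i3 : integ (fun x => w0 x ^+ 3 * t x).
  apply: (@csupp_cont_integ _ r); last by move=> x xM; rewrite vt// mulr0.
  apply: contM; last exact: test_cont.
  exact: (contM cw (contM cw cw)).
have I3 : Int (fun x => w0 x ^+ 3 * t x) <= de ^+ 2 * S0.
  have i0 : integ (fun x => w0 x * t x) by exact: test_integ_mul.
  rewrite -(IntZ _ i0); apply: Int_le => //; first exact: integZ.
  move=> x; have [->|tN] := eqVneq (t x) 0; first by rewrite !mulr0.
  rewrite mulrA ler_wpM2r// exprSr ler_wpM2r ?(ltW (w0p x))//.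
  by rewrite lerXn2r ?nnegrE ?(ltW (w0p x)) ?(ltW de0)//; exact: (tw x tN).2.
have [VM VM0 HV] : exists2 VM, 0 <= VM & forall x, `|x| <= r + (`|y0| + 1) -> V x <= VM.
  have [C [_ HC]] : bounded_set (V @` box (r + (`|y0| + 1))).
    apply: compact_bounded; apply: continuous_compact; last exact: box_compact.
    exact: continuous_subspaceT.
  exists (`|C| + 1) => [|x xr]; first by rewrite addr_ge0.
  apply: (le_trans (ler_norm _)); apply: (HC (`|C| + 1)); last by exists x.
  by rewrite (le_lt_trans (ler_norm C))// ltrDl.
have znorm : \forall k \near \oo, `|z k| < `|y0| + 1.
  have zE : `|z k| @[k --> \oo] --> `|y0| by exact: cvg_norm.
  by apply: (cvgr_lt _ zE); rewrite ltrDl.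
pose W := Int (fun x => t x ^+ 2).
have W0 : 0 <= W by exact: Int_sqr_ge0.
pose ep := k1 * S0 / (16 * (VM * (1 + W) + 1)).
have D0 : 0 < 16 * (VM * (1 + W) + 1) by rewrite mulr_gt0// ltr_wpDl// mulr_ge0// addr_ge0.
have ep0 : 0 < ep by rewrite divr_gt0// mulr_gt0.
pose G k := Int (fun x => w k x * lap t x) - k1 / 2 * Int (fun x => w k x * t x).
have cG : G k @[k --> \oo] --> Int (fun x => w0 x * lap t x) - k1 / 2 * S0.
  by apply: cvgB => //; apply: cvgM => //; exact: cvg_cst.
have G0 : k1 * S0 / 8 < Int (fun x => w0 x * lap t x) - k1 / 2 * S0.
  have b1 : k2 * Int (fun x => w0 x ^+ 3 * t x) <= k2 * (de ^+ 2 * S0) by rewrite ler_wpM2l.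
  have b2 : k2 * de ^+ 2 * S0 <= k1 / 4 * S0 by rewrite ler_wpM2r ?(ltW tp).
  have b3 : 0 < k1 * S0 by exact: mulr_gt0.
  rewrite mulrA in b1; rewrite L0; exact: (limit_negative b1 b2 b3).
near=> k.
have Gk : k1 * S0 / 8 < G k by near: k; exact: (cvgr_gt _ cG _ G0).
have Sk : 0 < Int (fun x => w k x * t x) by near: k; exact: (cvgr_gt _ cS _ tp).
have ek : e k < Num.min 1 ep by near: k; apply: e_small; rewrite lt_min ltr01.
have zk : `|z k| < `|y0| + 1 by near: k.
have [e1 e2] : e k < 1 /\ e k < ep by apply/andP; rewrite -lt_min.
have EL := Euler_Lagrange cV (q0 k) (q2 k) (c_ge0 k) (wm k) (wpos k) tt.
have P0 : 0 <= Int (fun x => `|w k x| `^ (q k + 1) * t x).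
  by apply: Int_ge0 => x; rewrite mulr_ge0 ?powR_ge0.
have I2 : Int (fun x => V (affmap (e k) (z k) x) * (w k x * t x)) <= VM * (1 + W).
  have i2 := integ_V_mul (e k) (z k) cV (hw k) tt.
  have iw := sqint_sqr (hw k); have it := sqint_sqr ht; have iwt := integD iw it.
  apply: (@le_trans _ _ (Int (fun x => VM * (w k x ^+ 2 + t x ^+ 2)))).
    apply: Int_le => //; first exact: integZ.
    move=> x; have [->|tN] := eqVneq (t x) 0; first by rewrite !mulr0 mulr_ge0// addr_ge0 ?sqr_ge0.
    have xr : `|x| <= r by rewrite leNgt; apply: contraNN tN => h'; rewrite vt.
    have Vx : V (affmap (e k) (z k) x) <= VM.
      apply: HV; apply: (le_trans (ler_normD _ _)); apply: lerD; last exact: ltW.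
      by rewrite normrZ (gtr0_norm (e0 k)); apply: le_trans xr; rewrite ler_piMl// ltW.
    apply: (@le_trans _ _ (V (affmap (e k) (z k) x) * (w k x ^+ 2 + t x ^+ 2))).
      rewrite ler_wpM2l//; have := sqr_ge0 (w k x - t x); have := sqr_ge0 (w k x); have := sqr_ge0 (t x).
      by move: (w k x) (t x) => s1 s2; lra.
    by rewrite ler_wpM2r// addr_ge0 ?sqr_ge0.
  by rewrite (IntZ _ iwt) (IntD iw it) w1.
have al0 := alpha_ge0 k; have ek0 := e0 k.
have VW : 0 <= VM * (1 + W) by rewrite mulr_ge0// addr_ge0.
have eV : e k ^+ 2 * Int (fun x => V (affmap (e k) (z k) x) * (w k x * t x)) <= k1 * S0 / 16.
  apply: (@le_trans _ _ (e k ^+ 2 * (VM * (1 + W)))); first by rewrite ler_wpM2l ?sqr_ge0.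
  apply: (@le_trans _ _ (ep * (VM * (1 + W)))).
    by rewrite ler_wpM2r// expr2 (le_trans _ (ltW e2))// ler_piMl// ltW.
  have K0 : 0 <= k1 * S0 by rewrite mulr_ge0// ltW.
  exact: fraction_le.
rewrite leNgt; apply/negP => mu.
have Kp : 0 < k1 * S0 by exact: mulr_gt0.
exact: (small_multiplier_absurd EL P0 eV Gk Sk mu al0 Kp).
Unshelve. all: by end_near. Qed.

Lemma tail_cvg0 : tail n%:R w0 g0 @[n --> \oo] --> (0 : R).
Proof.
have i0 := H1density_integ hw0 hg0; rewrite -[X in _ --> X](@Int0 R).
apply: (@Int_dominated _ (fun n x => off n%:R x * (w0 x ^+ 2 + gsq g0 x)) _ (fun x => w0 x ^+ 2 + gsq g0 x)) => //.
- by move=> n; exact: integ_mfun (integ_off _ i0).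
- exact: integ_mfun (@integ0 R).
- move=> x; apply: cvg_near_cst; exists (Num.truncn `|x|).+1 => // n /= xn.
  rewrite /off ltNge (_ : `|x| <= n%:R) ?mul0r//.
  by apply: (le_trans (ltW (truncnS_gt _))); rewrite ler_nat.
- move=> n x; rewrite ger0_norm ?mulr_ge0 ?off_ge0 ?H1density_ge0//.
  by rewrite ler_piMl ?off_le1 ?H1density_ge0.
Qed.

(** The tails of w k are small at a fixed radius uniformly in k by H^1
   convergence, which starts the contraction. *)
Lemma uniform_decay N : exists D L0, [/\ 0 <= D, 1 <= L0 &
  \forall k \near \oo, forall r, L0 <= r -> tail r (w k) (g k) <= D / r ^+ N].
Proof.
have [M M0 bM] := multiplier_bounded.
pose kap := Num.min 1 (k1 / 2).
have kap0 : 0 < kap by rewrite lt_min ltr01 divr_gt0.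
have kap1 : kap <= 1 by rewrite ge_min lexx.
have [rho1 [del [r1 del0 step]]] := tail_contracts N kap0 kap1 M0.
have [n tn] : exists n : nat, rho1 <= n%:R /\ tail n%:R w0 g0 < del / 4.
  have d4 : 0 < del / 4 by rewrite divr_gt0.
  have t4 : \forall n \near \oo, tail n%:R w0 g0 < del / 4 by exact: (cvgr_lt _ tail_cvg0).
  have r4 : \forall n \near \oo, rho1 <= n%:R.
    exists (Num.truncn `|rho1|).+1 => // n /= xn; apply: (le_trans (ler_norm _)).
    by apply: (le_trans (ltW (truncnS_gt _))); rewrite ler_nat.
  by have [n ?] := filter_ex (filterI r4 t4); exists n.
case: tn => rn tn.
exists (del * (8 * n%:R) ^+ N), n%:R; split.
- by rewrite mulr_ge0 ?(ltW del0)// exprn_ge0// mulr_ge0.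
- exact: le_trans rn.
near=> k => r rr.
have hk : h k < del / 4 by near: k; apply: h_near; rewrite divr_gt0.
have mk : multiplier V (q k) (c k) (e k) (z k) (w k) (g k) <= - (k1 / 2) by near: k; exact: multiplier_neg.
have [ck _] : c k * (q k + 2) / 2 <= M /\ `|multiplier V (q k) (c k) (e k) (z k) (w k) (g k)| <= M by near: k.
have tk : tail n%:R (w k) (g k) <= del.
  have := tail_w k n%:R; lra.
apply: (tail_decay (hw k) (hg k) _ _ tk rr); first exact: le_trans rn.
move=> rho nr; apply: (step V (q k) (c k) (e k) (z k) (w k) (g k) rho cV V0 (wm k)) => //.
- exact: c_ge0.
- exact: le_trans (c_le_alpha k) ck.
- by apply: (le_trans mk); rewrite lerN2 ge_min lexx orbT.
- exact: le_trans rn nr.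
- exact: le_trans (tail_le (hw k) (hg k) nr) tk.
Unshelve. all: by end_near. Qed.

(** Weights may depend on k as long as they are bounded: this lets the drift
   move with k without passing to subsequences. *)
Lemma sqr_diff_small (phi : nat -> R * R -> R) Phi : (forall k, mfun2 (phi k)) ->
  (\forall k \near \oo, forall x, `|phi k x| <= Phi) ->
  Int (fun x => phi k x * w k x ^+ 2) - Int (fun x => phi k x * w0 x ^+ 2) @[k --> \oo] --> (0 : R).
Proof.
move=> mphi bphi.
have bound k : (forall x, `|phi k x| <= Phi) ->
   `|Int (fun x => phi k x * w k x ^+ 2) - Int (fun x => phi k x * w0 x ^+ 2)| <=
   Phi * (2 * Int (fun x => `|d k x| * `|w0 x|) + h k).
  move=> pk; have Phi0 : 0 <= Phi by apply: le_trans (pk 0).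
  have i1 := integM (mphi k) pk (sqint_sqr (hw k)); have i2 := integM (mphi k) pk (sqint_sqr hw0).
  have i3 : integ (fun x => `|d k x| * `|w0 x|).
    apply: (@integ_le _ _ (fun x => d k x ^+ 2 + w0 x ^+ 2)).
    - by apply: mfun2M; apply: mfun2_abs; [exact: sqint_mfun|exact: sqint_mfun hw0].
    - move=> x; rewrite ger0_norm ?mulr_ge0//.
      rewrite -[X in _ <= X + _]real_normK ?num_real// -[X in _ <= _ + X]real_normK ?num_real//.
      by have := twice_mul_le `|d k x| `|w0 x|; have : 0 <= `|d k x| * `|w0 x| by []; move: (_ * _) => m; lra.
    - by apply: integD; exact: sqint_sqr.
  have i4 := sqint_sqr (hd k).
  rewrite -IntB//; apply: (@le_trans _ _ (Int (fun x => Phi * (2 * (`|d k x| * `|w0 x|) + d k x ^+ 2)))).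
    apply: Int_abs_le; [exact: integB|by apply: integZ; apply: integD => //; exact: integZ|].
    move=> x; rewrite -mulrBr normrM; apply: ler_pM => //.
    rewrite wE (_ : _ - _ = 2 * (d k x * w0 x) + d k x ^+ 2); last by ring.
    rewrite (le_trans (ler_normD _ _))// !normrM (@ger0_norm _ 2)// lerD2l//.
    by rewrite -normrM -expr2 ger0_norm ?sqr_ge0.
  rewrite IntZ; last by apply: integD => //; exact: integZ.
  rewrite IntD//; last exact: integZ.
  by rewrite IntZ// ler_wpM2l// lerD2l sqr_d_le.
apply: norm_cvg0.
apply: (@squeeze_cvgr _ _ _ _ (fun=> 0) (fun k => Phi * (2 * Int (fun x => `|d k x| * `|w0 x|) + h k))).
- by near=> k; rewrite normr_ge0 /=; apply: bound; near: k.
- exact: cvg_cst.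
- have -> : 0 = Phi * (2 * 0 + 0) :> R by rewrite mulr0 addr0 mulr0.
  apply: cvgM; first exact: cvg_cst.
  by apply: cvgD => //; apply: cvgM; [exact: cvg_cst|exact: d_small].
Unshelve. all: by end_near. Qed.

Section Weighted.
Variables (p lam : R) (ctr : R * R).
Hypotheses (p0 : 0 < p) (lam0 : 0 < lam).
Hypothesis Vup : forall s, 0 < s -> exists2 del, 0 < del &
  forall x, `|x| <= del -> V (x + ctr) <= (lam + s) * enorm x `^ p.

Definition weighted r (v : R * R -> R) : R := Int (fun x => on r x * (enorm x `^ p * v x ^+ 2)).

Lemma weight_integ r (v : R * R -> R) : sqint v -> integ (fun x => on r x * (enorm x `^ p * v x ^+ 2)).
Proof. by move=> hv; apply: integ_on_weight; [exact: ltW|exact: sqint_sqr]. Qed.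

Lemma weighted_cvg r : weighted r (w k) @[k --> \oo] --> weighted r w0.
Proof.
have mphi (k : nat) : mfun2 (fun x => on r x * enorm x `^ p).
  by apply: mfun2M; [exact: mfun2_on|exact: mfun2_enorm_pow].
have bphi : \forall k \near \oo, forall x, `|on r x * enorm x `^ p| <= (2 * r) `^ p.
  apply: nearW => k x; rewrite ger0_norm ?mulr_ge0 ?on_ge0 ?powR_ge0//.
  have [xr|xr] := leP `|x| r; first by rewrite on1// mul1r enorm_pow_le// ltW.
  by rewrite on0// mul0r powR_ge0.
have := sqr_diff_small mphi bphi.
have E (v : R * R -> R) : Int (fun x => on r x * enorm x `^ p * v x ^+ 2) = weighted r v.
  by apply: eq_Int => x; rewrite mulrA.
under eq_fun do rewrite !E.
by move=> /subr_cvg0.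
Qed.

(* Decay of order p + 3 pays for the factor e k ^ (- p - 2) and leaves one
   power of e k. *)
Let N := (Num.truncn `|p|).+4.

Let pN : p + 3 <= N%:R.
Proof.
have := truncnS_gt `|p|; rewrite (ger0_norm (ltW p0)) /N -[(_).+4]addn3 -[(_ + 3)%N]/((Num.truncn `|p|).+1 + 3)%N natrD.
by rewrite (ger0_norm (ltW p0)) => ?; rewrite lerD2r ltW.
Qed.

Lemma weighted_uniform : exists A L0, [/\ 0 <= A, 1 <= L0 & \forall k \near \oo, forall L r, L0 <= L ->
  weighted r (w k) <= weighted L (w k) + A / L].
Proof.
have [D [L0 [D0 L01 dec]]] := uniform_decay N.
exists (2 * 4 `^ p * D), L0; split => //; first by rewrite !mulr_ge0 ?powR_ge0.
near=> k => L r LL.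
have dk : forall r, L0 <= r -> tail r (w k) (g k) <= D / r ^+ N by near: k.
apply: (weighted_tail (N := N) (hw k) (hg k) (ltW p0) _ D0 L01 dk _ LL).
by apply: le_trans pN; rewrite lerD2l ler1n.
Unshelve. all: by end_near. Qed.

Definition profile_moment : R := Int (fun x => enorm x `^ p * w0 x ^+ 2).

Lemma profile_moment_facts : integ (fun x => enorm x `^ p * w0 x ^+ 2) /\ forall r, weighted r w0 <= profile_moment.
Proof.
have [A [L0 [A0 L01 W]]] := weighted_uniform.
have bd r : weighted r w0 <= weighted L0 w0 + A / L0.
  rewrite -lerBlDl; apply: (cvgr_to_le (cvgB (@weighted_cvg r) (@weighted_cvg L0))).
  near=> k; have H : forall L r, L0 <= L -> weighted r (w k) <= weighted L (w k) + A / L by near: k.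
  by rewrite /= lerBlDl; exact: H.
have w00 x : 0 <= enorm x `^ p * w0 x ^+ 2 by rewrite mulr_ge0 ?powR_ge0 ?sqr_ge0.
have onE (n : nat) x : \1_(box n%:R) x * (enorm x `^ p * w0 x ^+ 2) = on n%:R x * (enorm x `^ p * w0 x ^+ 2).
  rewrite indicE /on /off; have [xn|xn] := leP `|x| n%:R; first by rewrite mem_set// subr0.
  by rewrite memNset ?subrr// /box/= leNgt xn.
have mf : mfun2 (fun x => enorm x `^ p * w0 x ^+ 2).
  by apply: mfun2M; [exact: mfun2_enorm_pow|apply: (mfun2X 2); exact: sqint_mfun hw0].
have [i0 _ _] := @Int_bounded_exhaustion R _ (weighted L0 w0 + A / L0) (fun n => box n%:R) mf w00
  (fun n => box_measurable _)
  (fun n m nm x => fun xn : `|x| <= n%:R => le_trans xn (eq_ind_r is_true nm (ler_nat R n m)))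
  (fun x => ex_intro (fun n : nat => `|x| <= n%:R) _ (ltW (truncnS_gt _)))
  (fun n => eq_ind_r integ (weight_integ n%:R hw0) (funext (onE n)))
  (fun n => eq_ind_r (fun y => y <= _) (bd n%:R) (eq_Int (onE n))).
split=> // r; apply: Int_le => //; first exact: weight_integ.
by move=> x; rewrite ler_piMl ?on_le1.
Unshelve. all: by end_near. Qed.

Lemma potential_cutoff_weighted k s del rho : 0 <= s -> 0 < rho -> 8 * rho * e k <= del ->
  (forall x, `|x| <= del -> V (x + ctr) <= (lam + s) * enorm x `^ p) ->
  potential V (e k) ctr (fun x => cutoff (4 * rho) x * w k x) <=
    (lam + s) * e k `^ p * weighted (8 * rho) (w k).
Proof.
move=> s0 r0 re VV; have r4 : 0 < 4 * rho by rewrite mulr_gt0.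
have ls : 0 <= lam + s by rewrite addr_ge0// ltW.
rewrite -IntZ; last exact: weight_integ.
apply: Int_le; [exact: finite_potential_cutoff|by apply: integZ; exact: weight_integ|].
move=> x; have [xr|xr] := ltP (8 * rho) `|x|.
  rewrite cutoff_eq0//; last by rewrite mulrA -natrM.
  have P1 : 0 <= (lam + s) * e k `^ p by rewrite mulr_ge0 ?powR_ge0.
  have P2 : 0 <= enorm x `^ p * w k x ^+ 2 by rewrite mulr_ge0 ?powR_ge0 ?sqr_ge0.
  by rewrite mul0r expr0n mulr0 mulr_ge0// mulr_ge0 ?on_ge0.
rewrite on1// mul1r mulrA; rewrite exprMn.
have Vx : V (affmap (e k) ctr x) <= (lam + s) * e k `^ p * enorm x `^ p.
  apply: le_trans (VV _ _) _.
    by rewrite normrZ (gtr0_norm (e0 k)) mulrC; apply: le_trans re; rewrite ler_wpM2r ?(ltW (e0 k)).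
  by rewrite enormZ ?(ltW (e0 k))// powRM ?enorm_ge0 ?(ltW (e0 k))// mulrA.
rewrite mulrA; apply: ler_wpM2r; first exact: sqr_ge0.
apply: le_trans Vx; rewrite ler_piMr// exprn_ile1 ?cutoff_ge0 ?cutoff_le1//.
Qed.

(** The potential energy of w k on the scale e k ^ p on which it converges. *)
Definition excess k : R := e k `^ (- p) * potential V (e k) (z k) (w k).

(** The competitor is w k, cut off at a radius of order 1 / e k and recentred
   at ctr. There V is at most (lam + s) |x|^p, and the decay of w k makes the
   cost of cutting o(e k ^ (p + 2)). *)
Lemma excess_upper s : 0 < s -> \forall k \near \oo, excess k <= lam * profile_moment + s.
Proof.
move=> s0; have [A [L0 [A0 L01 W]]] := weighted_uniform.
have [D [L1 [D0 L11 dec]]] := uniform_decay N.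
have [M M0 bM] := multiplier_bounded.
have [C C0 cut] := @cut_estimate R.
have [iF Fle] := profile_moment_facts.
have F00 : 0 <= profile_moment by apply: Int_ge0 => x; rewrite mulr_ge0 ?powR_ge0 ?sqr_ge0.
pose s1 := Num.min 1 (s / (4 * (profile_moment + 2))).
have f2 : 0 < 4 * (profile_moment + 2) by rewrite mulr_gt0// ltr_wpDl.
have s10 : 0 < s1 by rewrite lt_min ltr01 divr_gt0.
have s11 : s1 <= 1 by rewrite ge_min lexx.
have s1s : s1 * (profile_moment + 2) <= s / 4.
  have : s1 <= s / (4 * (profile_moment + 2)) by rewrite ge_min lexx orbT.
  by rewrite ler_pdivlMr// mulrCA => h4; rewrite ler_pdivlMr// mulrC.
have [del del0 Vd] := Vup s10.
pose t := Num.min 1 (s / (8 * (lam + 1))).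
have l1 : 0 < 8 * (lam + 1) by rewrite mulr_gt0// addr_gt0.
have t0 : 0 < t by rewrite lt_min ltr01 divr_gt0.
have t1 : t <= 1 by rewrite ge_min lexx.
have ts : (lam + 1) * t <= s / 8.
  have : t <= s / (8 * (lam + 1)) by rewrite ge_min lexx orbT.
  by rewrite ler_pdivlMr// mulrCA => h4; rewrite ler_pdivlMr// mulrC [t * _]mulrC in h4 *.
pose L := Num.max L0 (A / t).
have LL0 : L0 <= L by rewrite le_max lexx.
have Lp : 0 < L by apply: lt_le_trans LL0; exact: lt_le_trans L01.
have AL : A / L <= t.
  rewrite ler_pdivrMr// mulrC -ler_pdivrMr//; by rewrite le_max lexx orbT.
pose E := 3 * (C * (1 + M)) * (D * (8 / del) ^+ N).
have dd0 : 0 <= 8 / del by rewrite divr_ge0// ltW.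
have E0 : 0 <= E.
  by apply: mulr_ge0; apply: mulr_ge0; rewrite ?exprn_ge0// mulr_ge0// addr_ge0.
pose kap := Num.min 1 (k1 / 2).
have kap0 : 0 < kap by rewrite lt_min ltr01 divr_gt0.
have kap1 : kap <= 1 by rewrite ge_min lexx.
pose e1 := Num.min 1 (Num.min (s / (4 * (E + 1))) (Num.min (del / (8 * L1)) (del / (8 * (D + 1))))).
have e10 : 0 < e1.
  have L1p : 0 < 8 * L1 by rewrite mulr_gt0// (lt_le_trans _ L11).
  rewrite !lt_min ltr01 !divr_gt0//.
  - by rewrite mulr_gt0// ltr_wpDl.
  - by rewrite mulr_gt0// ltr_wpDl.
near=> k.
have ek : e k < e1 by near: k; exact: e_small.
have [ek1 ekE ekL ekD] : [/\ e k < 1, e k < s / (4 * (E + 1)), e k < del / (8 * L1) & e k < del / (8 * (D + 1))].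
  by move: ek; rewrite !lt_min => /and4P[].
have Wk : weighted L (w k) < profile_moment + t.
  near: k; apply: (cvgr_lt _ (@weighted_cvg L)); apply: (le_lt_trans (Fle L)); by rewrite ltrDl.
have WL : forall L r, L0 <= L -> weighted r (w k) <= weighted L (w k) + A / L by near: k.
have dk : forall r, L1 <= r -> tail r (w k) (g k) <= D / r ^+ N by near: k.
have [ck _] : c k * (q k + 2) / 2 <= M /\ `|multiplier V (q k) (c k) (e k) (z k) (w k) (g k)| <= M by near: k.
have mk : multiplier V (q k) (c k) (e k) (z k) (w k) (g k) <= - (k1 / 2) by near: k; exact: multiplier_neg.
have ep := e0 k.
(* The cutoff at 4 rho is supported in the square of half-width 8 rho, which
   the blow-down maps into the square of half-width del. *)
pose rho := del / (8 * e k).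
have rho0 : 0 < rho by rewrite divr_gt0// mulr_gt0.
have rE : 8 * rho * e k = del by rewrite /rho; field; rewrite gt_eqF.
have rL1 : L1 <= rho.
  have L1p : 0 < L1 by exact: lt_le_trans L11.
  have h8 : e k * (8 * L1) < del by rewrite -ltr_pdivlMr// mulr_gt0.
  by rewrite /rho ler_pdivlMr ?mulr_gt0// (_ : L1 * (8 * e k) = e k * (8 * L1)) ?(ltW h8)//; ring.
have rho1 : 1 <= rho by exact: le_trans rL1.
have rD : D < rho.
  have D1 : 0 < D + 1 by rewrite ltr_wpDl.
  have h8 : e k * (8 * (D + 1)) < del by rewrite -ltr_pdivlMr// mulr_gt0.
  rewrite /rho ltr_pdivlMr ?mulr_gt0//; apply: le_lt_trans h8.
  rewrite (_ : D * (8 * e k) = e k * (8 * D)); last by ring.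
  by rewrite ler_wpM2l ?(ltW ep)// ler_wpM2l// lerDl.
have tlk := dk _ rL1.
have tl1 : tail rho (w k) (g k) < 1.
  apply: (le_lt_trans tlk); rewrite ltr_pdivrMr ?exprn_gt0// mul1r.
  by apply: (lt_le_trans rD); rewrite -[leLHS]expr1 ler_weXn2l.
have mu' : multiplier V (q k) (c k) (e k) (z k) (w k) (g k) <= - kap.
  by apply: (le_trans mk); rewrite lerN2 ge_min lexx orbT.
have := cut V (q k) (c k) (e k) (z k) (w k) (g k) kap ctr rho 1 cV V0 (wm k) (q1 k) (q2 k) (c_ge0 k)
   kap0 kap1 mu' rho1 ltr01 (lexx 1) tl1.
set P := potential V (e k) (z k) (w k); set P' := potential V (e k) ctr _; set tl := tail rho (w k) (g k) in tlk tl1 *.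
have tl0 : 0 <= tl by exact: tail_ge0.
have t80 : 0 <= kap * tail (8 * rho) (w k) (g k) by rewrite mulr_ge0 ?tail_ge0 ?(ltW kap0).
move=> cutk.
have P'le : P' <= (lam + s1) * e k `^ p * (profile_moment + 2 * t).
  apply: (le_trans (potential_cutoff_weighted (ltW s10) rho0 _ Vd)); first by rewrite rE.
  rewrite ler_wpM2l ?mulr_ge0 ?powR_ge0 ?addr_ge0 ?(ltW lam0) ?(ltW s10)//.
  apply: (le_trans (WL L (8 * rho) LL0)); apply: (le_trans (lerD (ltW Wk) AL)).
  by rewrite -addrA -mulr2n mulr_natl.
have rest : C * (1 + c k) * (rho^-1 + 1 + 1^-1 * tl) * tl <= 3 * (C * (1 + M)) * (D / rho ^+ N).
  have ri : rho^-1 <= 1 by rewrite invf_le1.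
  have ri0 : 0 <= rho^-1 by rewrite invr_ge0 ltW.
  apply: ler_pM => //.
    by rewrite mulr_ge0// ?mulr_ge0 ?addr_ge0 ?c_ge0// invr1 mul1r.
  rewrite [3 * _]mulrC; apply: ler_pM.
  - by rewrite mulr_ge0// addr_ge0 ?c_ge0.
  - by rewrite invr1 mul1r !addr_ge0.
  - by rewrite ler_wpM2l// lerD2l (le_trans (c_le_alpha k)).
  - rewrite invr1 mul1r (_ : 3 = 1 + 1 + 1 :> R); last by ring.
    by apply: lerD; [exact: lerD|exact: ltW].
have eN : D / rho ^+ N = D * (8 / del) ^+ N * e k ^+ N.
  rewrite -mulrA -exprMn; congr (_ * _); rewrite -exprVn; congr (_ ^+ _).
  by rewrite /rho invf_div mulrAC.
have pw : e k ^+ N <= e k `^ p * e k ^+ 2 * e k.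
  have -> : e k `^ p * e k ^+ 2 * e k = e k `^ (p + 3).
    rewrite powRD ?(gt_eqF ep) ?implybT// (powR_nat (ltW ep) (erefl 3%:R)) -mulrA; congr (_ * _).
    by rewrite -exprSr.
  rewrite -powR_mulrn ?(ltW ep)//; apply: ger_powR => //; by rewrite ep ltW.
have e2 : 0 < e k ^+ 2 by rewrite exprn_gt0.
have epp : 0 < e k `^ p by exact: powR_gt0.
have main : e k ^+ 2 * P <= e k ^+ 2 * (e k `^ p * ((lam + s1) * (profile_moment + 2 * t) + E * e k)).
  have a1 : e k ^+ 2 * P' <= e k ^+ 2 * (e k `^ p * ((lam + s1) * (profile_moment + 2 * t))).
    rewrite ler_wpM2l ?(ltW e2)//; apply: (le_trans P'le); rewrite le_eqVlt; apply/orP; left; apply/eqP.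
    by rewrite mulrA [e k `^ p * _]mulrC.
  have a2 : 3 * (C * (1 + M)) * (D / rho ^+ N) <= E * (e k `^ p * e k ^+ 2 * e k).
    by rewrite eN mulrA -/E ler_wpM2l.
  apply: (le_trans (_ : _ <= kap * tail (8 * rho) (w k) (g k) + e k ^+ 2 * P)); first by rewrite lerDr.
  apply: (le_trans cutk); apply: (le_trans (lerD a1 (le_trans rest a2))).
  by rewrite le_eqVlt; apply/orP; left; apply/eqP; move: (e k `^ p) => s2; ring.
rewrite ler_pM2l// in main.
have {main}main : excess k <= (lam + s1) * (profile_moment + 2 * t) + E * e k.
  by rewrite /excess powRN mulrC ler_pdivrMr// mulrC.
apply: (le_trans main).
have b1 : E * e k <= s / 4.
  have E1 : 0 < E + 1 by rewrite ltr_wpDl.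
  have h8 : e k * (4 * (E + 1)) < s by rewrite -ltr_pdivlMr// mulr_gt0.
  have h9 : e k * E <= e k * (E + 1) by rewrite ler_wpM2l ?(ltW ep)// lerDl.
  by rewrite ler_pdivlMr// mulrC [E * _]mulrC; move: h8 h9; rewrite mulrCA; move: (e k * _) (e k * _) => s2 s3; lra.
have b2 : s1 * t <= s1 by rewrite ler_piMr ?(ltW s10).
exact: (error_budget s1s ts b1 b2 s10 t0 s0).
Unshelve. all: by end_near. Qed.

Let profile_moment_int : integ (fun x => enorm x `^ p * w0 x ^+ 2). Proof. by have [] := profile_moment_facts. Qed.

Hypothesis w0rad : radial w0.
Implicit Types (r : R) (x : R * R) (k : nat).

(** A Euclidean disc, not a square: the averaging argument needs a radial
   weight. *)
Definition rad r x : R := (enorm x <= r)%R%:R.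

Lemma rad_ge0 r x : 0 <= rad r x. Proof. exact: ler0n. Qed.
Lemma rad_le1 r x : rad r x <= 1. Proof. by rewrite /rad; case: (enorm x <= r). Qed.

Lemma radE r : rad r = \1_[set x | enorm x <= r].
Proof.
apply/funext => x; rewrite indicE /rad; have [xr|xr] := leP (enorm x) r; first by rewrite mem_set.
by rewrite memNset//= leNgt xr.
Qed.

Lemma measurable_ball r : measurable ([set x | enorm x <= r] : set T2).
Proof.
have -> : [set x | enorm x <= r] = (@enorm R) @^-1` `]-oo, r]%classic by apply/seteqP; split=> x /=; rewrite in_itv.
rewrite -[X in measurable X]setTI; exact: (cont_mfun2 (@enorm_cont R) measurableT (measurable_itv _)).
Qed.

Lemma mfun2_rad r : mfun2 (rad r).
Proof. by rewrite radE; apply: mfun2_indic; exact: measurable_ball. Qed.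

(** The displacement of the centre from y0, measured in the blow-up scale. *)
Definition drift k : R * R := (e k)^-1 *: (z k - y0).

Lemma enorm_drift k : enorm (drift k) = enorm (z k - y0) / e k.
Proof. by rewrite enormZ ?invr_ge0 ?(ltW (e0 k))// mulrC. Qed.

Lemma affmap_drift k x : affmap (e k) (z k) x = e k *: (x + drift k) + y0.
Proof.
rewrite /affmap /drift scalerDr scalerA divff ?gt_eqF// scale1r -addrA; congr (_ + _).
by rewrite subrK.
Qed.

Definition moved r k x : R := rad r x * enorm (x + drift k) `^ p.

Lemma mfun2_moved r k : mfun2 (moved r k).
Proof.
apply: mfun2M; first exact: mfun2_rad.
apply: mfun2_powR; apply: cont_mfun2 => x; apply: continuous_comp; last exact: enorm_cont.
by apply: cvgD; [exact: cvg_id|exact: cvg_cst].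
Qed.

Lemma moved_bound r k (B : R) x : enorm (drift k) <= B -> `|moved r k x| <= (`|r| + B) `^ p.
Proof.
move=> dB; rewrite ger0_norm; last by rewrite mulr_ge0 ?rad_ge0 ?powR_ge0.
rewrite /moved /rad; have [xr|xr] := leP (enorm x) r; last by rewrite mul0r powR_ge0.
rewrite mul1r; apply: ge0_ler_powR; rewrite ?nnegrE ?enorm_ge0 ?(ltW p0)//.
  by rewrite addr_ge0// (le_trans (enorm_ge0 _) dB).
by rewrite (le_trans (enormD _ _))// lerD// (le_trans xr)// ler_norm.
Qed.

Lemma integ_moved r k (v : R * R -> R) : sqint v -> integ (fun x => moved r k x * v x ^+ 2).
Proof.
move=> hv; apply: (integM (mfun2_moved r k) _ (sqint_sqr hv)) => x.
by apply: (@moved_bound r k (enorm (drift k))).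
Qed.

Definition potential_lower (lam' : R) := exists2 del, 0 < del &
  forall x, `|x| <= del -> lam' * enorm x `^ p <= V (x + y0).

(** On a fixed disc the blow-up only sees V near y0. *)
Lemma excess_ge r lam' : 0 < lam' -> potential_lower lam' ->
  \forall k \near \oo, lam' * Int (fun x => moved r k x * w k x ^+ 2) <= excess k.
Proof.
move=> l0 [del del0 low].
have zy : \forall k \near \oo, `|z k - y0| < del / 2.
  have : `|z k - y0| @[k --> \oo] --> `|y0 - y0|.
    by apply: cvg_norm; apply: cvgB => //; exact: cvg_cst.
  by rewrite subrr normr0 => zE; apply: (cvgr_lt _ zE); rewrite divr_gt0.
pose s := del / (2 * (`|r| + 1)).
have r1 : 0 < 2 * (`|r| + 1) by rewrite mulr_gt0// ltr_wpDl.
have s0 : 0 < s by rewrite divr_gt0.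
near=> k; have ek : e k < s by near: k; exact: e_small.
have zk : `|z k - y0| < del / 2 by near: k.
have ep := e0 k; have epp : 0 < e k `^ p by exact: powR_gt0.
have er : e k * `|r| <= del / 2.
  have h8 : e k * (2 * (`|r| + 1)) < del by rewrite -ltr_pdivlMr.
  have h9 : e k * `|r| <= e k * (`|r| + 1) by rewrite ler_wpM2l ?(ltW ep)// lerDl.
  rewrite ler_pdivlMr// (le_trans _ (ltW h8))// -mulrA ler_wpM2l ?(ltW ep)// mulrC ler_wpM2l// lerDl//.
have pt x : lam' * e k `^ p * moved r k x <= V (affmap (e k) (z k) x).
  rewrite /moved /rad; have [xr|xr] := leP (enorm x) r; last by rewrite mul0r mulr0.
  rewrite mul1r affmap_drift; apply: le_trans (low _ _).
    by rewrite enormZ ?(ltW ep)// powRM ?enorm_ge0 ?(ltW ep)// mulrA.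
  rewrite scalerDr (le_trans (ler_normD _ _))// [del](splitr del) lerD//.
    rewrite normrZ (gtr0_norm ep); apply: le_trans er; rewrite ler_wpM2l ?(ltW ep)//.
    by rewrite (le_trans (normp_le_enorm x))// (le_trans xr)// ler_norm.
  by rewrite /drift scalerA divff ?gt_eqF// scale1r ltW.
have : lam' * e k `^ p * Int (fun x => moved r k x * w k x ^+ 2) <= potential V (e k) (z k) (w k).
  have im := integ_moved r k (hw k).
  rewrite -(IntZ _ im); apply: Int_le; [exact: integZ|exact: fw|].
  by move=> x; rewrite mulrA ler_wpM2r ?sqr_ge0.
by move=> PP; rewrite /excess powRN [leRHS]mulrC ler_pdivlMr// mulrAC.
Unshelve. all: by end_near. Qed.

(** A large drift would put a fixed share of the mass where the potential is
   large, contradicting excess_upper. *)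
Lemma drift_bounded lam' : 0 < lam' -> potential_lower lam' ->
  exists2 B, 0 <= B & \forall k \near \oo, enorm (drift k) <= B.
Proof.
move=> l0 low.
have i0 : integ (fun x => rad 1 x * w0 x ^+ 2).
  by apply: (@integM _ _ _ 1 (mfun2_rad 1) _ (sqint_sqr hw0)) => x; rewrite ger0_norm ?rad_ge0 ?rad_le1.
pose m1 := Int (fun x => rad 1 x * w0 x ^+ 2).
have m10 : 0 < m1.
  apply: (@Int_gt0 _ _ 0 (1/2) 0 (1/2)) => //; try by rewrite divr_gt0.
    by move=> x; rewrite mulr_ge0 ?rad_ge0 ?sqr_ge0.
  move=> x [/=]; rewrite !in_itv/= => /andP[h1 h2] /andP[h3 h4]; rewrite /rad.
  suff -> : enorm x <= 1 by rewrite mul1r exprn_gt0.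
  apply: (le_trans (enorm_le_normp x)); rewrite -ler_pdivlMl// mulr1 normp_le !ler_norml.
  by apply/andP; split; apply/andP; split; lra.
have mc : Int (fun x => rad 1 x * w k x ^+ 2) @[k --> \oo] --> m1.
  have := @sqr_diff_small (fun=> rad 1) 1 (fun=> mfun2_rad 1) _.
  move=> /(_ _)/subr_cvg0; apply; apply: nearW => k x; by rewrite ger0_norm ?rad_ge0 ?rad_le1.
have mk2 : \forall k \near \oo, m1 / 2 < Int (fun x => rad 1 x * w k x ^+ 2).
  by apply: (cvgr_gt _ mc); rewrite ltr_pdivrMr// ltr_pMr// ltr1n.
pose Mx := lam * profile_moment + 1.
have F00 : 0 <= profile_moment by apply: Int_ge0 => x; rewrite mulr_ge0 ?powR_ge0 ?sqr_ge0.
have Mx0 : 0 < Mx by rewrite ltr_wpDl// mulr_ge0// ltW.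
have lm : 0 < lam' * (m1 / 2) by rewrite mulr_gt0// divr_gt0.
pose t := (Mx / (lam' * (m1 / 2))) `^ p^-1.
have t0 : 0 <= t by exact: powR_ge0.
have tp : lam' * t `^ p * (m1 / 2) = Mx.
  rewrite /t -powRrM mulVf ?gt_eqF// powRr1 ?divr_ge0 ?(ltW Mx0) ?(ltW lm)//.
  by rewrite mulrAC [_ * (_ / _)]mulrC divfK// gt_eqF.
exists (1 + t); first by rewrite addr_ge0.
near=> k; rewrite leNgt; apply/negP => bk.
have mk : m1 / 2 < Int (fun x => rad 1 x * w k x ^+ 2) by near: k.
have xg : lam' * Int (fun x => moved 1 k x * w k x ^+ 2) <= excess k by near: k; exact: excess_ge.
have xu : excess k <= Mx by near: k; exact: excess_upper.
have ir : integ (fun x => rad 1 x * w k x ^+ 2).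
  by apply: (@integM _ _ _ 1 (mfun2_rad 1) _ (sqint_sqr (hw k))) => x; rewrite ger0_norm ?rad_ge0 ?rad_le1.
have tI : t `^ p * Int (fun x => rad 1 x * w k x ^+ 2) <= Int (fun x => moved 1 k x * w k x ^+ 2).
  rewrite -(IntZ _ ir); apply: Int_le; [exact: integZ|exact: integ_moved|].
  move=> x; rewrite mulrA ler_wpM2r ?sqr_ge0// /moved mulrC /rad.
  have [x1|_] := leP (enorm x) 1; last by rewrite !mul0r.
  rewrite !mul1r; apply: ge0_ler_powR; rewrite ?nnegrE ?enorm_ge0 ?(ltW p0)//.
  have := enormD (x + drift k) (- x); rewrite addrAC subrr add0r enormN; lra.
have : Mx < lam' * Int (fun x => moved 1 k x * w k x ^+ 2).
  rewrite -tp; apply: (@lt_le_trans _ _ (lam' * (t `^ p * Int (fun x => rad 1 x * w k x ^+ 2)))); last by rewrite ler_pM2l.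
  have tpp : 0 < t `^ p.
    have := Mx0; rewrite -tp mulrAC pmulr_rgt0//.
  by rewrite -mulrA ltr_pM2l// ltr_pM2l.
by rewrite ltNge (le_trans xg xu).
Unshelve. all: by end_near. Qed.

(** The lower bound of radial_translate is monotone in the size of the drift,
   so the drift can be replaced by the constant bt; this stands in for the
   extraction of a convergent subsequence. *)
Lemma frequent_lower lam' (bt r : R) : 0 < lam' -> potential_lower lam' -> 0 <= bt ->
  (forall K : nat, exists2 k, (K <= k)%N & bt <= enorm (drift k)) ->
  lam' * Int (fun x => rad r x * (Num.max (enorm x) bt `^ p * w0 x ^+ 2)) <= lam * profile_moment.
Proof.
move=> l0 low b0 fr; apply/ler_addgt0Pr => s s0.
have [B B0 bB] := drift_bounded l0 low.
have s2 : 0 < s / 2 by rewrite divr_gt0.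
have sl : 0 < s / 2 / lam' by rewrite divr_gt0.
have bnd : \forall k \near \oo, forall x, `|moved r k x| <= (`|r| + B) `^ p.
  by near=> k => x; apply: moved_bound; near: k.
have dc := sqr_diff_small (mfun2_moved r) bnd.
have N1 := excess_upper s2; have N2 := excess_ge r l0 low.
have N3 : \forall k \near \oo, - (s / 2 / lam') <
    Int (fun x => moved r k x * w k x ^+ 2) - Int (fun x => moved r k x * w0 x ^+ 2).
  by apply: (cvgr_gt _ dc); rewrite oppr_lt0.
have [K _ HK] := filterI N1 (filterI N2 N3).
have [k Kk bk] := fr K; have [/= x1 [x2 x3]] := HK k Kk.
have E : Int (fun x => rad r x * (Num.max (enorm x) bt `^ p * w0 x ^+ 2)) <=
   Int (fun x => moved r k x * w0 x ^+ 2).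
  pose f x := rad r x * w0 x ^+ 2.
  have f0 x : 0 <= f x by rewrite mulr_ge0 ?rad_ge0 ?sqr_ge0.
  have frad : radial f by move=> x y xy; rewrite /f /rad xy (w0rad xy).
  have fi : integ f.
    by apply: (@integM _ _ _ 1 (mfun2_rad r) _ (sqint_sqr hw0)) => x; rewrite ger0_norm ?rad_ge0 ?rad_le1.
  have fr0 x : r < `|x| -> f x = 0.
    by move=> xr; rewrite /f /rad leNgt (lt_le_trans xr (normp_le_enorm x)) mul0r.
  have := radial_translate p0 f0 frad fi fr0 (drift k).
  have -> : Int (fun y => enorm (y + drift k) `^ p * f y) = Int (fun x => moved r k x * w0 x ^+ 2).
    by apply: eq_Int => x; rewrite /moved /f mulrA [_ * rad r x]mulrC.
  apply: le_trans; apply: Int_le.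
  - have cm : continuous (fun y : R * R => Num.max (enorm y) bt).
      by move=> x; apply: continuous_max; [exact: enorm_cont|exact: cst_continuous].
    have := @integ_cont_mul R r f f0 fi fr0 (fun y => Num.max (enorm y) bt) p _ cm (ltW p0).
    under eq_fun do rewrite mulrCA; apply=> x; by rewrite le_max enorm_ge0.
  - have cm : continuous (fun y : R * R => Num.max (enorm y) (enorm (drift k))).
      by move=> x; apply: continuous_max; [exact: enorm_cont|exact: cst_continuous].
    apply: (@integ_cont_mul R r f f0 fi fr0 (fun y => Num.max (enorm y) (enorm (drift k))) p _ cm (ltW p0)).
    by move=> x; rewrite le_max enorm_ge0.
  move=> x; rewrite mulrCA; apply: (ler_wpM2r (f0 x)).
  have mm : Num.max (enorm x) bt <= Num.max (enorm x) (enorm (drift k)).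
    by rewrite ge_max !le_max lexx bk orbT.
  by apply: (ge0_ler_powR (ltW p0) _ _ mm); rewrite nnegrE le_max enorm_ge0.
have E' := ler_wpM2l (ltW l0) E.
have : lam' * (Int (fun x => moved r k x * w0 x ^+ 2)) <= lam' * Int (fun x => moved r k x * w k x ^+ 2) + s / 2.
  rewrite -lerBlDl -mulrBr -ler_pdivlMl//; move: x3; rewrite [_^-1 * _]mulrC.
  by move: (Int _) (Int _) (s / 2 / lam') => s3 s4 s5; lra.
move: E' x1 x2; set J1 := lam' * Int _; set J2 := lam' * Int _; set J3 := lam' * Int _.
set J4 := lam * profile_moment; move: J1 J2 J3 J4 (excess k) => J1 J2 J3 J4 J5.
lra.
Unshelve. all: by end_near. Qed.

Lemma max_weight_le lam' (bt : R) : 0 < lam' -> potential_lower lam' -> 0 <= bt ->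
  (forall K : nat, exists2 k, (K <= k)%N & bt <= enorm (drift k)) ->
  integ (fun x => Num.max (enorm x) bt `^ p * w0 x ^+ 2) /\
  lam' * Int (fun x => Num.max (enorm x) bt `^ p * w0 x ^+ 2) <= lam * profile_moment.
Proof.
move=> l0 low b0 fr.
have mf : mfun2 (fun x => Num.max (enorm x) bt `^ p * w0 x ^+ 2).
  apply: mfun2M; last by apply: (mfun2X 2); exact: sqint_mfun hw0.
  apply: mfun2_powR; apply: cont_mfun2 => x.
  by apply: continuous_max; [exact: enorm_cont|exact: cst_continuous].
have m0 x : 0 <= Num.max (enorm x) bt `^ p * w0 x ^+ 2 by rewrite mulr_ge0 ?powR_ge0 ?sqr_ge0.
have ir (n : nat) : integ (fun x => rad n%:R x * (Num.max (enorm x) bt `^ p * w0 x ^+ 2)).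
  have cm : continuous (fun y : R * R => Num.max (enorm y) bt).
    by move=> x; apply: continuous_max; [exact: enorm_cont|exact: cst_continuous].
  pose f x := rad n%:R x * w0 x ^+ 2.
  have f0 x : 0 <= f x by rewrite mulr_ge0 ?rad_ge0 ?sqr_ge0.
  have fi : integ f.
    by apply: (@integM _ _ _ 1 (mfun2_rad n%:R) _ (sqint_sqr hw0)) => x; rewrite ger0_norm ?rad_ge0 ?rad_le1.
  have fr0 x : n%:R < `|x| -> f x = 0.
    by move=> xr; rewrite /f /rad leNgt (lt_le_trans xr (normp_le_enorm x)) mul0r.
  have := @integ_cont_mul R n%:R f f0 fi fr0 (fun y => Num.max (enorm y) bt) p _ cm (ltW p0).
  by under eq_fun do rewrite mulrCA; apply=> x; rewrite le_max enorm_ge0.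
have le (n : nat) : Int (fun x => rad n%:R x * (Num.max (enorm x) bt `^ p * w0 x ^+ 2)) <= lam * profile_moment / lam'.
  by rewrite ler_pdivlMr// mulrC; exact: frequent_lower.
have [i0 I0 _] := @Int_bounded_exhaustion R _ (lam * profile_moment / lam') (fun n => [set x | enorm x <= n%:R]) mf m0
  (fun n => measurable_ball _)
  (fun n m nm x => fun xn : enorm x <= n%:R => le_trans xn (eq_ind_r is_true nm (ler_nat R n m)))
  (fun x => ex_intro (fun n : nat => enorm x <= n%:R) _ (ltW (truncnS_gt _)))
  (fun n => eq_ind (rad n%:R) (fun f => integ (fun x => f x * _)) (ir n) _ (radE _))
  (fun n => eq_ind (rad n%:R) (fun f => Int (fun x => f x * _) <= _) (le n) _ (radE _)).
by split=> //; rewrite mulrC -ler_pdivlMr.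
Qed.

Lemma profile_moment_gt0 : 0 < profile_moment.
Proof.
apply: (@Int_gt0 _ _ 0 1 0 1) => //; try exact: ltr01.
  by move=> x; rewrite mulr_ge0 ?powR_ge0 ?sqr_ge0.
move=> x [/=]; rewrite !in_itv/= => /andP[h1 h2] _; rewrite mulr_gt0 ?exprn_gt0// powR_gt0//.
apply: lt_le_trans (normp_le_enorm x); apply: lt_le_trans (normp_ge1 x); by rewrite gtr0_norm.
Qed.

(** Take bt = 0: both bounds of the potential energy contain the same positive
   moment of w0. *)
Lemma lower_le_upper lam' : 0 < lam' -> potential_lower lam' -> lam' <= lam.
Proof.
move=> l0 low; have [] := max_weight_le l0 low (lexx 0) _.
  by move=> K; exists K => //; exact: enorm_ge0.
move=> _; have -> : Int (fun x => Num.max (enorm x) 0 `^ p * w0 x ^+ 2) = profile_moment.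
  by apply: eq_Int => x; rewrite (max_idPl (enorm_ge0 x)).
by rewrite ler_pM2r// profile_moment_gt0.
Qed.

(** A drift that stays away from 0 would replace |y| by max(|y|, bt) in the
   lower bound, which strictly increases the moment of w0 near the origin. *)
Lemma drift_cvg : (forall lam', 0 < lam' -> lam' < lam -> potential_lower lam') ->
  enorm (drift k) @[k --> \oo] --> (0 : R).
Proof.
move=> low; have main (bt : R) : 0 < bt -> exists K : nat, forall k, (K <= k)%N -> enorm (drift k) < bt.
  move=> b0; apply: contrapT => /forallNP fr.
  have {}fr K : exists2 k, (K <= k)%N & bt <= enorm (drift k).
    apply: contrapT => H; apply: (fr K) => k Kk; rewrite ltNge; apply/negP => bk; apply: H.
    by exists k.
  have l2 : lam / 2 < lam by rewrite ltr_pdivrMr// ltr_pMr// ltr1n.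
  have [iM _] := max_weight_le (divr_gt0 lam0 (ltr0n _ 2)) (low _ (divr_gt0 lam0 (ltr0n _ 2)) l2) (ltW b0) fr.
  set FM := Int (fun x => Num.max (enorm x) bt `^ p * w0 x ^+ 2).
  have lt : profile_moment < FM.
    rewrite -subr_gt0 -IntB//.
    have b4 : 0 < bt / 4 by rewrite divr_gt0.
    apply: (@Int_gt0 _ _ 0 (bt / 4) 0 (bt / 4)) => //; first exact: integB.
      move=> x; rewrite -mulrBl mulr_ge0 ?sqr_ge0// subr_ge0; apply: ge0_ler_powR;
        rewrite ?nnegrE ?le_max ?enorm_ge0 ?lexx ?(ltW p0)//.
    move=> x [/=]; rewrite !in_itv/= => /andP[h1 h2] /andP[h3 h4]; rewrite -mulrBl mulr_gt0 ?exprn_gt0// subr_gt0.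
    have eb : enorm x < bt.
      apply: (le_lt_trans (enorm_le_normp x)); apply: (@le_lt_trans _ _ (2 * (bt / 4))); last by lra.
      rewrite ler_wpM2l// normp_le !ler_norml.
      by apply/andP; split; apply/andP; split; lra.
    by rewrite (max_idPr (ltW eb)) gt0_ltr_powR ?nnegrE ?enorm_ge0 ?(ltW b0).
  have FM0 : 0 < FM by exact: lt_trans profile_moment_gt0 lt.
  (* A value below lam for which the lower bound still exceeds the upper one.
     *)
  pose l' := lam * ((profile_moment + FM) / (2 * FM)).
  have F0p := profile_moment_gt0.
  have l'0 : 0 < l' by rewrite mulr_gt0// divr_gt0 ?mulr_gt0// addr_gt0.
  have l'l : l' < lam.
    by rewrite /l' gtr_pMr// ltr_pdivrMr ?mulr_gt0// mul1r mulr_natl mulr2n ltrD2r.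
  have [_] := max_weight_le l'0 (low _ l'0 l'l) (ltW b0) fr.
  have -> : l' * FM = lam * ((profile_moment + FM) / 2) by rewrite /l'; field; rewrite gt_eqF.
  by rewrite ler_pM2l// leNgt ltr_pdivlMr// mulr_natr mulr2n ltrD2l lt.
apply/cvgrPdist_lt => bt b0; have [K HK] := main _ b0; exists K => // k /= Kk.
by rewrite sub0r normrN ger0_norm ?enorm_ge0// HK.
Qed.
End Weighted.
End Concentration.

(** * The potential near its zeros and the limit profile *)

Section Limit_potential.
Context {R : realType}.
Implicit Types (x y z : R * R) (V Q : R * R -> R) (p l s : R).

(** A selection operator returns one of its arguments, so an iterated maximum
   or minimum is the initial value or is attained. *)
Lemma bigop_attained (I : finType) (T : Type) (op : T -> T -> T) (idx : T) (F : I -> T) :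
  (forall t t' : T, op t t' = t \/ op t t' = t') ->
  \big[op/idx]_i F i = idx \/ exists i, \big[op/idx]_i F i = F i.
Proof.
move=> H; apply: (big_ind (fun r => r = idx \/ exists i, r = F i)).
- by left.
- by move=> x y hx hy; case: (H x y) => ->.
- by move=> i _; right; exists i.
Qed.

(** Punctured neighbourhoods of x0 as punctured squares centred at 0. *)
Lemma near_dnbhs_box (x0 : R * R) (P : R * R -> Prop) : (\forall x \near x0^', P x) ->
  exists2 del : R, 0 < del & forall x, `|x| <= del -> x != 0 -> P (x + x0).
Proof.
move=> /nbhs_ballP [r /= r0 br]; exists (r / 2); first by rewrite divr_gt0.
move=> x xr x0'; apply: br.
  rewrite -ball_normE /= opprD addrCA subrr addr0 normrN.
  by apply: (le_lt_trans xr); rewrite ltr_pdivrMr// ltr_pMr// ltr1n.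
by rewrite -subr_eq0 addrK.
Qed.

Section Ratio_at_zero.
Variables (V : R * R -> R) (x0 : R * R) (p : R) (la : \bar R).
Hypotheses (p0 : 0 < p) (Vx0 : V x0 = 0).
Hypothesis lim : (V x / enorm (x - x0) `^ p)%:E @[x --> x0^'] --> la.

Lemma ratio_lt (b : \bar R) : (la < b)%E -> exists2 del : R, 0 < del &
  forall x, `|x| <= del -> x != 0 -> ((V (x + x0) / enorm x `^ p)%:E < b)%E.
Proof.
move=> lb; have nb : nbhs la [set y | (y < b)%E].
  by apply: open_nbhs_nbhs; split => //; exact: open_ereal_lt_ereal.
have [del d0 H] := near_dnbhs_box (lim nb); exists del => // x xd x0'.
by have := H x xd x0'; rewrite /= addrK.
Qed.

Lemma ratio_gt (b : \bar R) : (b < la)%E -> exists2 del : R, 0 < del &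
  forall x, `|x| <= del -> x != 0 -> (b < (V (x + x0) / enorm x `^ p)%:E)%E.
Proof.
move=> lb; have nb : nbhs la [set y | (b < y)%E].
  by apply: open_nbhs_nbhs; split => //; exact: open_ereal_gt_ereal.
have [del d0 H] := near_dnbhs_box (lim nb); exists del => // x xd x0'.
by have := H x xd x0'; rewrite /= addrK.
Qed.

Lemma enorm_pow_gt0 x : x != 0 -> 0 < enorm x `^ p.
Proof.
move=> xN; apply: powR_gt0; apply: lt_le_trans (normp_le_enorm x).
by rewrite normr_gt0.
Qed.

Lemma enorm0_pow : enorm (0 : R * R) `^ p = 0.
Proof. by rewrite /enorm /= expr0n addr0 sqrtr0 powR0// gt_eqF. Qed.

Lemma V_upper (l s : R) : la = l%:E -> 0 < s -> exists2 del : R, 0 < del &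
  forall x, `|x| <= del -> V (x + x0) <= (l + s) * enorm x `^ p.
Proof.
move=> laE s0; have [|del d0 H] := @ratio_lt (l + s)%:E.
  by rewrite laE lte_fin ltrDl.
exists del => // x xd; have [->|xN] := eqVneq x 0.
  by rewrite add0r Vx0 enorm0_pow mulr0.
by have := H x xd xN; rewrite lte_fin ltr_pdivrMr ?enorm_pow_gt0// => /ltW.
Qed.

Lemma V_lower (l : R) : (l%:E < la)%E -> potential_lower V x0 p l.
Proof.
move=> /ratio_gt [del d0 H]; exists del => // x xd; have [->|xN] := eqVneq x 0.
  by rewrite add0r Vx0 enorm0_pow mulr0.
by have := H x xd xN; rewrite lte_fin ltr_pdivlMr ?enorm_pow_gt0// => /ltW.
Qed.

(** At an index where the exponent is p the given real limit is the limit that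
   defines lam, so lam is finite there. *)
Lemma limit_finite (l : R) : V x / enorm (x - x0) `^ p @[x --> x0^'] --> l -> (la < +oo)%E.
Proof.
move=> fl; rewrite ltey; apply/negP => /eqP laE.
have [|d1 d10 H1] := @ratio_gt (l + 1)%:E; first by rewrite laE ltry.
have nb : nbhs l [set y | y < l + 1].
  by apply: open_nbhs_nbhs; split; [exact: open_lt|rewrite /= ltrDl].
have [d2 d20 H2] := near_dnbhs_box (fl _ nb).
pose d := Num.min d1 d2; have d0 : 0 < d by rewrite lt_min d10.
pose x : R * R := (d, 0).
have xN : x != 0 by rewrite /x xpair_eqE negb_and gt_eqF.
have xd : `|x| <= d by rewrite normp_le /= normr0 (gtr0_norm d0) lexx ltW.
have := H1 x (le_trans xd _) xN; rewrite ge_min lexx => /(_ isT); rewrite lte_fin => h1.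
have := H2 x (le_trans xd _) xN; rewrite ge_min lexx orbT => /(_ isT) /=; rewrite addrK => h2.
by have := lt_trans h1 h2; rewrite ltxx.
Qed.
End Ratio_at_zero.

(** Scaling the ground state changes the constants of its equation to 1/e and
   the squared norm of Q. *)
Lemma limit_profile_facts Q : ground_state nonlin_cubic Q ->
  let w0 := limit_profile Q in
  [/\ Cn 2 w0, forall x, 0 < w0 x, radial w0, 0 < (expR 1 : R)^-1 &
   0 <= L2norm Q ^+ 2 /\ forall x, lap w0 x = (expR 1)^-1 * w0 x - L2norm Q ^+ 2 * w0 x ^+ 3].
Proof.
move=> [[CQ Qp HQ Qeq] Qrad _] w0; have [hQ _] := (H1P Q).1 HQ.
have S2 : 0 < L2norm Q ^+ 2.
  rewrite L2norm_sqr//; apply: (@Int_gt0 _ _ 0 1 0 1); rewrite ?ltr01//.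
  - exact: sqint_sqr.
  - by move=> x; exact: sqr_ge0.
  - by move=> x _; rewrite exprn_gt0.
have S0 : 0 < L2norm Q.
  rewrite lt_neqAle fine_ge0 ?Lnorm_ge0// andbT eq_sym; apply: contraTN S2 => /eqP ->.
  by rewrite expr0n ltxx.
pose s : R := (Num.sqrt (expR 1))^-1; pose ct : R := (Num.sqrt (expR 1) * L2norm Q)^-1.
have se : 0 < Num.sqrt (expR 1 : R) by rewrite sqrtr_gt0 expR_gt0.
have s0 : 0 < s by rewrite invr_gt0.
have ct0 : 0 < ct by rewrite invr_gt0 mulr_gt0.
have s2 : s ^+ 2 = (expR 1)^-1 by rewrite exprVn sqr_sqrtr// ltW// expR_gt0.
have wE : w0 = fun x => ct * (Q \o affmap s 0) x.
  by apply/funext => x; rewrite /w0 /limit_profile /= /affmap addr0.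
have Ca : Cn 2 (Q \o affmap s 0) := Cn_affine s 0 CQ.
split.
- by rewrite wE; exact: CnZ.
- by move=> x; rewrite wE; apply: mulr_gt0 => //; exact: Qp.
- move=> x y xy; rewrite wE /=; congr (_ * _); apply: Qrad.
  by rewrite /affmap !addr0 !enormZ ?(ltW s0)// xy.
- by rewrite invr_gt0 expR_gt0.
split; first exact: ltW.
move=> x; have pZ i (f : R * R -> R) : Cn 1 f -> partial i (fun y => ct * f y) = (fun y => ct * partial i f y).
  move=> Cf; rewrite partialM//; last exact: Cn_cst.
  by apply/funext => y; rewrite [partial i (fun=> ct) y](derive_cst ct) mulr0 addr0.
have pZs i (f : R * R -> R) : Cn 1 f -> partial i (fun y => s * f y) = (fun y => s * partial i f y).
  move=> Cf; rewrite partialM//; last exact: Cn_cst.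
  by apply/funext => y; rewrite [partial i (fun=> s) y](derive_cst s) mulr0 addr0.
have C1Q : Cn 1 Q := Cn_pred CQ.
have C1p i : Cn 1 (partial i Q) := Cn_partial i CQ.
have pp i : partial i (partial i w0) x = ct * (s * (s * partial i (partial i Q) (affmap s 0 x))).
  rewrite wE pZ; last exact: Cn_pred Ca.
  rewrite partial_affine// pZ; last by apply: CnZ; exact: (Cn_affine s 0 (C1p i)).
  rewrite (pZs i (partial i Q \o affmap s 0)); last exact: (Cn_affine s 0 (C1p i)).
  by rewrite partial_affine.
rewrite /lap !pp.
have := Qeq (affmap s 0 x); rewrite /laplacian big_bool /nonlin_cubic /=.
set q1 := partial true _ _; set q0 := partial false _ _; set Qx := Q _ => E.
have -> : ct * (s * (s * q0)) + ct * (s * (s * q1)) = ct * s ^+ 2 * (Qx - Qx ^+ 3).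
  have -> : Qx - Qx ^+ 3 = q1 + q0 by move: E; lra.
  by ring.
have -> : w0 x = ct * Qx by rewrite wE.
have cS : s ^+ 2 = L2norm Q ^+ 2 * ct ^+ 2.
  by rewrite /ct /s; field; rewrite !gt_eqF.
rewrite -s2 exprMn mulrBr; congr (_ - _); first by ring.
by rewrite [in LHS]cS; ring.
Qed.
End Limit_potential.

(** * The concentration point and the speed of concentration *)

Theorem theorem1p2 (R : realType)
  (Q : R * R -> R) (hQ : ground_state nonlin_cubic Q)
  (phi : R -> R * R -> R)
  (hphi : forall q : R, 0 < q -> q <= 2 -> ground_state (nonlin q) (phi q))
  (astar : R -> R)
  (hastar : forall q : R, 0 < q -> q <= 2 -> astar q = L2norm (phi q) `^ q)
  (a : R) (ha : L2norm Q ^+ 2 < a)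
  (V : R * R -> R) (V_C1 : Cn 1 V) (V_ge0 : forall x, 0 <= V x)
  (V_infty : tends_to_infinity V) (V_inf : inf (range V) = 0)
  (n : nat) (n_gt0 : (0 < n)%N)
  (X : 'I_n -> R * R) (X_inj : injective X)
  (V_X : forall i, V (X i) = 0)
  (V_gt0 : forall x : R * R, (forall i, x != X i) -> 0 < V x)
  (pw : 'I_n -> R) (pw_gt0 : forall i, 0 < pw i)
  (V_bigO : forall i, exists C : R,
     \forall x \near X i, `|V x| <= C * enorm (x - X i) `^ pw i)
  (V_lim : forall i, exists l : R,
     V x / enorm (x - X i) `^ pw i @[x --> (X i)^'] --> l)
  (p : R) (hp : p = \big[Num.max/0]_(i < n) pw i)
  (lam : 'I_n -> \bar R)
  (hlam : forall i,
     (V x / enorm (x - X i) `^ p)%:E @[x --> (X i)^'] --> lam i)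
  (lam_gt0 : forall i, (0 < lam i)%E)
  (lambda : \bar R) (hlambda : lambda = \big[mine/+oo%E]_(i < n) lam i)
  (u : R -> R * R -> R)
  (hu : forall q : R, 0 < q -> q < 2 -> minimizer V a q (u q))
  (u_ge0 : forall q : R, 0 < q -> q < 2 -> {ae leb2, forall x, 0 <= u q x})
  (q : nat -> R) (q_gt0 : forall k, 0 < q k) (q_lt2 : forall k, q k < 2)
  (q_cvg : q k @[k --> \oo] --> (2 : R))
  (z : nat -> R * R) (y0 : R * R) (V_y0 : V y0 = 0)
  (z_max : \forall k \near \oo, unique_global_max (u (q k)) (z k))
  (z_cvg : z k @[k --> \oo] --> y0)
  (u_cvg : cvg_in_H1
     (fun k => rescale ((a / astar (q k)) `^ (- (2 - q k)^-1))
                 (u (q k)) (z k))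
     (limit_profile Q)) :
  [set X i | i in [set i | lam i = lambda]] y0 /\
  enorm (z k - y0) * (a / astar (q k)) `^ ((2 - q k)^-1)
    @[k --> \oo] --> (0 : R).
Proof.
have [Hw Hw0 hcv] := u_cvg.
set eps := fun k => (a / astar (q k)) `^ (- (2 - q k)^-1).
pose w k := rescale (eps k) (u (q k)) (z k); pose w0 := limit_profile Q.
pose d k := w k \- w0.
have [C2w0 w0p w0rad k1p [k2p eqw0]] := limit_profile_facts hQ.
have [hw0 _] := (H1P w0).1 Hw0; have hg0 := wpartialP Hw0.
pose g0 : bool -> R * R -> R := wpartial^~ w0.
have hd k : sqint (d k) by have [h1 _] := (H1P (w k)).1 (Hw k); exact: sqintB h1 hw0.
have Hd k : H1 (d k).
  apply/H1P; split; first exact: hd.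
  have [h1 _] := (H1P (w k)).1 (Hw k).
  exists (fun i x => wpartial i (w k) x + -1 * g0 i x).
  have := has_gradD h1 (sqintZ (-1) hw0) (wpartialP (Hw k)) (has_gradZ (-1) hw0 hg0).
  congr has_grad; apply/funext => x; by rewrite mulN1r.
pose gd k : bool -> R * R -> R := wpartial^~ (d k).
have hgd k : has_grad (d k) (gd k) := wpartialP (Hd k).
pose h k := Int (fun x => d k x ^+ 2) + dirichlet (gd k).
have h0 k : 0 <= h k := addr_ge0 (Int_sqr_ge0 (d k)) (dirichlet_ge0 (gd k)).
have hE k : H1norm (d k) = Num.sqrt (h k).
  rewrite /H1norm L2norm_sqr//; congr (Num.sqrt (_ + _)).
  by apply: eq_Int => x; exact: grad_sqE.
have hc : h k @[k --> \oo] --> (0 : R).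
  have -> : h = (fun k => H1norm (d k) * H1norm (d k)).
    by apply/funext => k; rewrite hE -expr2 sqr_sqrtr.
  by have -> : 0 = 0 * 0 :> R by [rewrite mul0r]; apply: cvgM.
pose g k (i : bool) x := g0 i x + gd k i x.
have wE k x : w k x = w0 x + d k x by rewrite /d /= addrCA subrr addr0.
have hg k : has_grad (w k) (g k).
  have := has_gradD hw0 (hd k) hg0 (hgd k); congr has_grad.
  by apply/funext => x; rewrite wE.
have a0 : 0 < a by apply: le_lt_trans ha; exact: sqr_ge0.
have eps0 : \forall k \near \oo, 0 < eps k.
  have m0 : 0 < Int (fun x => w0 x ^+ 2).
    apply: (@Int_gt0 _ _ 0 1 0 1); rewrite ?ltr01//; first exact: sqint_sqr.
    - by move=> x; exact: sqr_ge0.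
    - by move=> x _; rewrite exprn_gt0.
  have [K _ HK] : \forall k \near \oo, h k < Int (fun x => w0 x ^+ 2) by exact: (cvgr_lt _ hc).
  exists K => // k /HK /= hk; rewrite lt_neqAle powR_ge0 andbT eq_sym.
  apply: contraTN hk => /eqP e0; rewrite -leNgt.
  have -> : Int (fun x => w0 x ^+ 2) = Int (fun x => d k x ^+ 2).
    by apply: eq_Int => x; rewrite /d /= /w /rescale e0 mul0r sub0r sqrrN.
  by rewrite lerDl dirichlet_ge0.
have q1 : \forall k \near \oo, 1 < q k.
  by apply: (cvgr_gt _ q_cvg); rewrite ltr1n.
(* From the index K on the scale is positive and q is at least 1; the
   sequences are shifted by K. *)
have [K _ HK] := filterI eps0 q1.
have {}HK k : 0 < eps (k + K)%N /\ 1 <= q (k + K)%N.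
  by have [? /ltW ?] := HK _ (leq_addl k K).
have cV : continuous V := Cn_cont V_C1.
pose c k := 2 * a / (q k + 2) * eps k `^ (2 - q k).
have wm k : rescaled_minimizer V (q (k + K)%N) (c (k + K)%N) (eps (k + K)%N) (z (k + K)%N) (w (k + K)%N) (g (k + K)%N).
  set i := (k + K)%N.
  exact: (@minimizer_rescaled R V a (q i) (u (q i)) (eps i) (z i) (g i) cV V_ge0 (q_gt0 i) (ltW (q_lt2 i))
    (HK k).1 (hu _ (q_gt0 i) (q_lt2 i)) (hg i)).
have wpos k : {ae leb2, forall x, 0 <= w (k + K)%N x}.
  have [e0 _] := HK k; have := preserves_ae (preserves_affine (z (k + K)%N) e0) (u_ge0 _ (q_gt0 (k + K)%N) (q_lt2 (k + K)%N)).
  by apply: ae2S => x ux; rewrite /w /rescale mulr_ge0// ltW.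
have zc : z (k + K)%N @[k --> \oo] --> y0 by exact: (cvg_comp _ _ (cvg_addnr K) z_cvg).
have hcK : h (k + K)%N @[k --> \oo] --> (0 : R) by exact: (cvg_comp _ _ (cvg_addnr K) hc).
have [j yj] : exists j, y0 = X j.
  apply: contrapT => /forallNP H; have := V_gt0 y0; rewrite V_y0 ltxx => F; suff : false by [].
  by apply: F => i; apply/eqP; exact: H.
have lej i : pw i <= p by rewrite hp; exact: le_bigmax.
have p0 : 0 < p by apply: lt_le_trans (lej j).
have [ip pE] : exists i, p = pw i.
  have [||[i E]] := @bigop_attained 'I_n R Num.max 0 pw.
  - by move=> x y; rewrite maxEle; case: (_ <= _); [right|left].
  - by rewrite -hp => p00; rewrite p00 ltxx in p0.
  - by exists i; rewrite hp.
have lp : (lam ip < +oo)%E.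
  have [l] := V_lim ip; rewrite -pE => fl; exact: (limit_finite (hlam ip) fl).
have lam_le i : (lambda <= lam i)%E by rewrite hlambda; exact: bigmin_le.
have [i0 lE] : exists i, lambda = lam i.
  have [||[i E]] := @bigop_attained 'I_n (\bar R) mine +oo%E lam.
  - by move=> x y; rewrite minEle; case: (_ <= _)%O; [left|right].
  - by rewrite -hlambda => E; exists ip; apply/eqP; rewrite eq_le lam_le E leey.
  - by exists i; rewrite hlambda.
have [l laE] : exists l : R, lambda = l%:E.
  have lt := le_lt_trans (lam_le ip) lp; have gt := lam_gt0 i0; rewrite -lE in gt.
  by case: (lambda) lt gt => // l _ _; exists l.
have l0 : 0 < l by have := lam_gt0 i0; rewrite -lE laE lte_fin.
have Vup s : 0 < s -> exists2 del, 0 < del &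
    forall x, `|x| <= del -> V (x + X i0) <= (l + s) * enorm x `^ p.
  by apply: (V_upper p0 (V_X i0) (hlam i0)); rewrite -lE.
have Vlow l' : (l'%:E < lam j)%E -> potential_lower V y0 p l'.
  by rewrite yj => lt; exact: (V_lower p0 (V_X j) (hlam j) lt).
have upper := @lower_le_upper R V a (fun k => q (k + K)%N) (fun k => c (k + K)%N) (fun k => eps (k + K)%N)
  (fun k => z (k + K)%N) y0 (fun k => w (k + K)%N) (fun k => d (k + K)%N) (fun k => g (k + K)%N) (fun k => gd (k + K)%N)
  w0 g0 _ _ cV V_ge0 V_infty zc (fun k => (HK k).2) (fun k => ltW (q_lt2 (k + K)%N)) (fun k => (HK k).1) a0
  (fun k => erefl) wm wpos hw0 hg0 C2w0 w0p k1p k2p eqw0 (fun k => hd (k + K)%N) (fun k => hgd (k + K)%N)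
  (fun k => wE (k + K)%N) (fun k i x => erefl) hcK p l (X i0) p0 l0 Vup w0rad.
have lj : lam j = lambda.
  apply/eqP; rewrite eq_le lam_le andbT leNgt; apply/negP; rewrite laE => lt.
  have [l' l'l l'j] : exists2 l' : R, l < l' & (l'%:E < lam j)%E.
    move: lt; case: (lam j) => [r| |//]; rewrite ?lte_fin => lr.
      by exists ((l + r) / 2); rewrite ?lte_fin; lra.
    by exists (l + 1); rewrite ?ltry ?ltrDl.
  have := upper l' (lt_trans l0 l'l) (Vlow _ l'j).
  by rewrite leNgt l'l.
split; first by exists j.
have := @drift_cvg R V a (fun k => q (k + K)%N) (fun k => c (k + K)%N) (fun k => eps (k + K)%N)
  (fun k => z (k + K)%N) y0 (fun k => w (k + K)%N) (fun k => d (k + K)%N) (fun k => g (k + K)%N) (fun k => gd (k + K)%N)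
  w0 g0 _ _ cV V_ge0 V_infty zc (fun k => (HK k).2) (fun k => ltW (q_lt2 (k + K)%N)) (fun k => (HK k).1) a0
  (fun k => erefl) wm wpos hw0 hg0 C2w0 w0p k1p k2p eqw0 (fun k => hd (k + K)%N) (fun k => hgd (k + K)%N)
  (fun k => wE (k + K)%N) (fun k i x => erefl) hcK p l (X i0) p0 l0 Vup w0rad.
have low l' : 0 < l' -> l' < l -> potential_lower V y0 p l'.
  by move=> _ ll; apply: Vlow; rewrite lj laE lte_fin.
move=> /(_ low) D.
rewrite -(@cvg_shiftn K _ (fun k => enorm (z k - y0) * (a / astar (q k)) `^ (2 - q k)^-1)).
suff -> : (fun k => enorm (z (k + K)%N - y0) * (a / astar (q (k + K)%N)) `^ (2 - q (k + K)%N)^-1) =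
  (fun k => enorm (drift (fun k => eps (k + K)%N) (fun k => z (k + K)%N) y0 k)) by exact: D.
apply/funext => k.
have -> := @enorm_drift R (fun k => eps (k + K)%N) (fun k => z (k + K)%N) y0 (fun k => (HK k).1) k.
congr (_ * _).
by rewrite /eps powRN invrK.
Qed.
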